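(* Let $p>0$ be a fixed constant and let a nominal feedback family $\theta\mapsto N(\theta)$, $\theta\mapsto(k_1(\theta),\dots,k_{N(\theta)}(\theta))$, with associated constants $R_\theta>0$ ($\theta\in\mathbb{R}$), be fixed as described in the context. Let $T,a>0$ be positive constants and let $\tilde N\ge 1$ be a positive integer. Then there exists a family of constants $M_{\theta,\hat\theta_0,c,\hat c_0}>0$, $\omega_\theta>0$, parameterized by $\theta\in\mathbb{R}$, $c>0$, $\hat\theta_0\in\mathbb{R}$, $\hat c_0>0$ (with $\omega_\theta$ depending only on $\theta$), such that for every $\theta\in\mathbb{R}$, $c>0$, $u_0\in L^2(0,1)$, $\hat\theta_0\in\mathbb{R}$, $\hat c_0>0$ the closed-loop system consisting of the plant $$\frac{\partial u}{\partial t}(t,x)=p\frac{\partial^2u}{\partial x^2}(t,x)+\theta u(t,x),\qquad u(t,0)=0,\qquad u(t,1)=cU(t),$$ and the adaptive controller (E1)--(E5) of the context, with initial conditions $u[0]=u_0$, $\hat\theta(0)=\hat\theta_0$, $\hat c(0)=\hat c_0$, has a unique solution, in the sense that there exist unique mappings $\hat\theta,\hat c:\mathbb{R}_+\to\mathbb{R}$ and $u\in C^0(\mathbb{R}_+;L^2(0,1))$ satisfying $u\in C^1(I\times[0,1])$ and $u[t]\in C^2([0,1])$ for $t>0$, where $I=\mathbb{R}_+\setminus\{\tau_i\ge 0,\ i=0,1,2,\dots\}$, which also satisfy (E1)--(E5), $u[0]=u_0$, $\hat\theta(0)=\hat\theta_0$, $\hat c(0)=\hat c_0$ and $$\frac{\partial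 u}{\partial t}(t,x)=p\frac{\partial^2u}{\partial x^2}(t,x)+\theta u(t,x)\quad\text{for all }(t,x)\in I\times(0,1),$$ $$u(t,0)=u(t,1)-cU(t)=0\quad\text{for all }t\in I.$$ Moreover, the estimate $$\|u[t]\|\le M_{\theta,\hat\theta_0,c,\hat c_0}\exp(-\omega_\theta t)\|u_0\|$$ holds for all $t\ge 0$. Finally, if $u_0\ne 0$ then $\hat\theta(t)=\theta$ for all $t\ge\tau_1$, and if there exists $t\ge 0$ with $U(t)\neq 0$ then $\hat c(t)=c$ for all $t\ge\tau_2$.
   Context: **Notation.** $\mathbb{R}_+=[0,+\infty)$; $\mathbb{Z}_+$ is the set of non-negative integers; $\|\cdot\|$ is the $L^2(0,1)$ norm; $u[t]$ denotes the profile $x\mapsto u(t,x)$; $C^0(J;L^2(0,1))$ is the space of continuous mappings $J\ni t\mapsto u[t]\in L^2(0,1)$. Put $\phi_n(x)=\sqrt2\sin(n\pi x)$, $n=1,2,\dots$. **Nominal feedback (standing assumption).** Mappings $\mathbb{R}\ni\theta\mapsto N(\theta)\in\{1,2,3,\dots\}$ and $\mathbb{R}\ni\theta\mapsto(k_1(\theta),\dots,k_{N(\theta)}(\theta))\in\mathbb{R}^{N(\theta)}$ are given. Set $$k(\theta,x)=\sum_{n=1}^{N(\theta)}k_n(\theta)\phi_n(x),\quad x\in[0,1].$$ They have the following property: for every $\theta\in\mathbb{R}$ there exist constants $R_\theta,\bar\omega_\theta>0$ (fixed once and for all) such that for every $u_0\in L^2(0,1)$ the problem $\frac{\partial u}{\partial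 t}=p\frac{\partial^2u}{\partial x^2}+\theta u$ for $t>0$, $x\in(0,1)$, $u(t,0)=0$, $u(t,1)=\int_0^1k(\theta,x)u(t,x)\,dx$ for $t>0$, $u[0]=u_0$, has a unique solution $u\in C^0(\mathbb{R}_+;L^2(0,1))\cap C^1((0,+\infty)\times[0,1])$ with $u[t]\in C^2([0,1])$ for $t>0$, and this solution satisfies $\|u[t]\|\le R_\theta\exp(-\bar\omega_\theta t)\|u_0\|$ for $t\ge0$. **Adaptive controller.** $\theta\in\mathbb{R}$ and $c>0$ are the (unknown) plant parameters, and $\hat\theta(t),\hat c(t)$ are their estimates. $\{\tau_i\}_{i\ge0}$ is the sequence of event times. The controller is defined by the following relations. (E1) Control and estimates between events: for $t\in[\tau_i,\tau_{i+1})$, $i\in\mathbb{Z}_+$, $$U(t)=\big(\hat c(\tau_i)\big)^{-1}\int_0^1k(\hat\theta(\tau_i),x)u(t,x)\,dx,\qquad \hat\theta(t)=\hat\theta(\tau_i),\quad \hat c(t)=\hat c(\tau_i).$$ (E2) Event times: $\tau_0=0$ and $\tau_{i+1}=\min(\tau_i+T,r_i)$ for $i\in\mathbb{Z}_+$. (E3) Event trigger: if $u[\tau_i]\ne0$ then $$r_i:=\inf\{t>\tau_i:\|u[t]\|=R_{\hat\theta(\tau_i)}(1+a)\|u[\tau_i]\|\},$$ where $u$ denotes the solution of the plant under the control (E1) computed with the estimates $\hat\theta(\tau_i),\hat c(\tau_i)$, and $r_i=+\infty$ if no such $t$ exists; if $u[\tau_i]=0$ then $r_i:=\tau_i+T$.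 (E4) Data window: $\mu_{i+1}:=\min\{\tau_j:\ j\in\{0,\dots,i\},\ \tau_j\ge\tau_{i+1}-\tilde NT\}$. (E5) Parameter update: $(\hat\theta(\tau_{i+1}),\hat c(\tau_{i+1}))=\mathrm{proj}_{S_i}\big((\hat\theta(\tau_i),\hat c(\tau_i))\big)$, the Euclidean projection on the set $S_i\subseteq\mathbb{R}^2$ of all $(\vartheta_1,\vartheta_2)$ such that for all $n=1,2,\dots$ $$H_{n,1}=\vartheta_1Q_{n,1}+\vartheta_2Q_{n,2},\qquad H_{n,2}=\vartheta_1Q_{n,2}+\vartheta_2Q_{n,3}.$$ Here, with all double integrals over $(t,s)\in[\mu_{i+1},\tau_{i+1}]^2$, $$H_{n,1}=\iint f_ng_n,\quad H_{n,2}=\iint f_nj_n,\quad Q_{n,1}=\iint g_n^2,\quad Q_{n,2}=\iint g_nj_n,\quad Q_{n,3}=\iint j_n^2,$$ and $$f_n(t,s)=\int_0^1\sin(n\pi x)\big(u(t,x)-u(s,x)\big)dx+n^2\pi^2p\int_s^t\int_0^1\sin(n\pi x)u(\tau,x)\,dx\,d\tau,$$ $$g_n(t,s)=\int_s^t\int_0^1\sin(n\pi x)u(\tau,x)\,dx\,d\tau,\qquad j_n(t,s)=-(-1)^npn\pi\int_s^tU(\tau)\,d\tau.$$ *)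

(* Defs.v *)
From HB Require Import structures.
From mathcomp Require Import all_boot all_order all_algebra.
From mathcomp Require Import all_classical all_reals all_analysis.

Set Implicit Arguments.
Unset Strict Implicit.
Unset Printing Implicit Defensive.

Import Order.TTheory GRing.Theory Num.Theory.
Import numFieldNormedType.Exports.

Local Open Scope classical_set_scope.
Local Open Scope ring_scope.

Section Defs.
Context {R : realType}.
Implicit Types (p theta c T a : R) (u v : R -> R -> R) (f g w : R -> R).

Notation leb := (@lebesgue_measure R).

(** Elements of L^2(0,1) are handled through representatives [f : R -> R],
    of which only the restriction to ]0,1[ matters: [f \_ D] is [f] on [D] and
    0 elsewhere.  Equality in L^2(0,1) is [eqL2], not Leibniz equality. *)

Definition inL2 f : Prop := f \_ `]0, 1[%classic \in Lfun leb 2%:E.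

Definition L2norm f : R := fine ('N[leb]_2%:E [EFin \o (f \_ `]0%R, 1%R[%classic)])%E.

Definition eqL2 f g : Prop := f = g %[ae leb in `]0, 1[%classic].

Definition C0_L2 (J : set R) u : Prop :=
  (forall t, J t -> inL2 (u t)) /\
  (forall t, J t -> L2norm (u s \- u t) @[s --> within J (nbhs t)] --> 0).

(** Relative to [`[0, 1]] and at its end points this is the one-sided
    derivative. *)

Definition deriv_within (A : set R) f (x l : R) : Prop :=
  (f y - f x) / (y - x) @[y --> within A (x^')] --> l.

Definition C1_on (J : set R) u : Prop :=
  exists ut ux : R -> R -> R,
  [/\ forall t x, J t -> x \in `[0, 1] ->
        deriv_within J (fun s => u s x) t (ut t x) /\
        deriv_within `[0, 1] (u t) x (ux t x),
      {within J `*` `[0, 1], continuous (fun z : R * R => u z.1 z.2)},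
      {within J `*` `[0, 1], continuous (fun z : R * R => ut z.1 z.2)} &
      {within J `*` `[0, 1], continuous (fun z : R * R => ux z.1 z.2)}].

Definition C2_01 f : Prop :=
  exists f1 f2 : R -> R,
  [/\ forall x, x \in `[0, 1] -> deriv_within `[0, 1] f x (f1 x),
      forall x, x \in `[0, 1] -> deriv_within `[0, 1] f1 x (f2 x) &
      {within `[0, 1], continuous f2}].

Definition pde_at p theta u (t x : R) : Prop :=
  derive1 (fun s => u s x) t = p * derive1n 2 (u t) x + theta * u t x.

(** Solutions of the plant from time [t0] on, with boundary condition
    u(t,1) = B(u[t]). *)
Record boundary_solution p theta (t0 : R) (B : (R -> R) -> R) v : Prop := {
  bs_C0 : C0_L2 [set t | t0 <= t] v ;
  bs_C1 : C1_on [set t | t0 < t] v ;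
  bs_C2 : forall t, t0 < t -> C2_01 (v t) ;
  bs_pde : forall t x, t0 < t -> 0 < x < 1 -> pde_at p theta v t x ;
  bs_left : forall t, t0 < t -> v t 0 = 0 ;
  bs_right : forall t, t0 < t -> v t 1 = B (v t) }.

(** Equality of trajectories on R_+: at t = 0 the profile is only an element of
    L^2(0,1), while for t > 0 it is a function on [0,1]. *)
Definition same_trajectory u v : Prop :=
  (forall t, 0 <= t -> eqL2 (u t) (v t)) /\
  (forall t x, 0 < t -> x \in `[0, 1] -> u t x = v t x).

Definition phi (n : nat) (x : R) : R := Num.sqrt 2 * sin (n%:R * pi * x).

(** [kc th] is the row (k_1(th), ..., k_N(th)), whose entries are indexed
    from 0: [kc th 0 i] is k_(i+1)(th). *)
Definition nominal_kernel (N : R -> nat) (kc : forall th, 'rV[R]_(N th)) (th x : R) : R :=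
  \sum_(i < N th) kc th 0 i * phi i.+1 x.

Definition feedback (k : R -> R -> R) (th : R) w : R :=
  \int[leb]_(x in `[0, 1]) (k th x * w x).

Definition nominal_feedback p (N : R -> nat) (kc : forall th, 'rV[R]_(N th))
    (Rc omb : R -> R) : Prop :=
  forall theta,
  [/\ (1 <= N theta)%N, 0 < Rc theta, 0 < omb theta &
    forall u0 : R -> R, inL2 u0 ->
    exists u,
    let solution v :=
      boundary_solution p theta 0 (feedback (nominal_kernel kc) theta) v /\
      eqL2 (v 0) u0 in
    [/\ solution u,
        forall v, solution v -> same_trajectory u v &
        forall t, 0 <= t ->
          L2norm (u t) <= Rc theta * expR (- omb theta * t) * L2norm u0]].

Definition control (k : R -> R -> R) (th ch : R) w : R :=
  ch^-1 * feedback k th w.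

(** [r] is the trigger time r_i, for the event time [ti], the profile
    [w] = u[tau_i] and the estimates [th], [ch] at [ti].  Here [v] is the plant
    under the control frozen at these estimates, over the whole of
    [[ti, +oo[]; the infimum of the empty set is [+oo]. *)
Definition trigger_time p theta c (k : R -> R -> R) (Rc : R -> R) T a
    (ti : R) w (th ch : R) (r : \bar R) : Prop :=
  (~ eqL2 w (cst 0) ->
     exists v,
     [/\ boundary_solution p theta ti (fun z => c * control k th ch z) v,
         eqL2 (v ti) w &
         r = ereal_inf [set t%:E | t in
               [set t | ti < t /\
                  L2norm (v t) = Rc th * (1 + a) * L2norm w]]]) /\
  (eqL2 w (cst 0) -> r = (ti + T)%:E).

Definition is_min (A : set R) (m : R) : Prop := A m /\ lbound A m.

(** The integral from [s] to [t], with either order of the bounds. *)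
Definition oint (s t : R) f : R :=
  if s <= t then \int[leb]_(r in `[s, t]) f r
  else - \int[leb]_(r in `[t, s]) f r.

Definition sin_mode (n : nat) w : R :=
  \int[leb]_(x in `[0, 1]) (sin (n%:R * pi * x) * w x).

Definition g_data u (n : nat) (t s : R) : R :=
  oint s t (fun r => sin_mode n (u r)).

Definition f_data p u (n : nat) (t s : R) : R :=
  sin_mode n (u t \- u s) + n%:R ^+ 2 * pi ^+ 2 * p * g_data u n t s.

Definition j_data p (U : R -> R) (n : nat) (t s : R) : R :=
  - (-1) ^+ n * p * n%:R * pi * oint s t U.

Definition window_integral (m t1 : R) (F G : R -> R -> R) : R :=
  \int[(leb \x leb)%E]_(z in `[m, t1] `*` `[m, t1]) (F z.1 z.2 * G z.1 z.2).

Definition param_set p u (U : R -> R) (m t1 : R) : set (R * R) :=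
  [set q | forall n, (1 <= n)%N ->
    let f := f_data p u n in
    let g := g_data u n in
    let j := j_data p U n in
    let I := window_integral m t1 in
    I f g = q.1 * I g g + q.2 * I g j /\
    I f j = q.1 * I g j + q.2 * I j j].

(** The library norm on [R * R] is the sup norm. *)
Definition eucl_dist (x y : R * R) : R :=
  Num.sqrt ((x.1 - y.1) ^+ 2 + (x.2 - y.2) ^+ 2).

Definition is_proj (S : set (R * R)) (x y : R * R) : Prop :=
  S y /\ forall z, S z -> eucl_dist x y <= eucl_dist x z.

(** [tau] are the event times, [U] is the control, [that] and [chat] are the
    estimates of [theta] and [c].  Functions of time are only constrained on
    R_+. *)

Definition non_events (tau : nat -> R) : set R :=
  [set t | 0 <= t /\ forall i, t != tau i].

Record closed_loop p (k : R -> R -> R) (Rc : R -> R) T a (Nt : nat)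
    theta c (u0 : R -> R) (th0 c0 : R)
    (tau : nat -> R) (U that chat : R -> R) u : Prop := {
  cl_C0 : C0_L2 [set t | 0 <= t] u ;
  cl_C1 : C1_on (non_events tau) u ;
  cl_C2 : forall t, 0 < t -> C2_01 (u t) ;
  cl_pde : forall t x, non_events tau t -> 0 < x < 1 -> pde_at p theta u t x ;
  cl_bc : forall t, non_events tau t -> u t 0 = 0 /\ u t 1 - c * U t = 0 ;
  cl_u0 : eqL2 (u 0) u0 ;
  cl_that0 : that 0 = th0 ;
  cl_chat0 : chat 0 = c0 ;
  (* [U] divides by [chat (tau i)]; the inverse of 0 is 0 in the library *)
  cl_chat_neq0 : forall i, chat (tau i) != 0 ;
  cl_between : forall i t, tau i <= t < tau i.+1 ->
    [/\ U t = control k (that (tau i)) (chat (tau i)) (u t),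
        that t = that (tau i) & chat t = chat (tau i)] ;
  cl_tau0 : tau 0%N = 0 ;
  cl_event : forall i, exists r : \bar R,
    trigger_time p theta c k Rc T a (tau i) (u (tau i))
      (that (tau i)) (chat (tau i)) r /\
    (tau i.+1)%:E = Order.min (tau i + T)%:E r ;
  cl_update : forall i, exists m : R,
    is_min [set t | exists j : nat,
              [/\ (j <= i)%N, t = tau j & tau i.+1 - Nt%:R * T <= tau j]] m /\
    is_proj (param_set p u U m (tau i.+1))
      (that (tau i), chat (tau i)) (that (tau i.+1), chat (tau i.+1)) }.

End Defs.

(* Main.v *)
Require Import Defs.
From mathcomp Require Import all_boot all_order all_algebra.
From mathcomp Require Import all_classical all_reals all_analysis.
From mathcomp Require Import measurable_realfun ring lra.
Set Implicit Arguments.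
Unset Strict Implicit.
Unset Printing Implicit Defensive.
Import Order.TTheory GRing.Theory Num.Theory.
Import numFieldNormedType.Exports.
Local Open Scope classical_set_scope.
Local Open Scope ring_scope.

(** The sine modes [y_n] of a solution obey
      [y_n' = (theta - p n^2 pi^2) y_n - (-1)^n n pi p u(t,1)]
    and determine it, since the sine system is complete.  With frozen estimates only
    finitely many modes enter the control, so uniqueness is uniqueness for a linear ODE; a
    solution is the sum of one of the form [h S(x) y(t)], with [S] solving the spatial ODE
    and [y] that finite system, of finitely many exponential sine modes, and of a nominal
    solution on which the feedback vanishes.
    Integrating the mode equations in time gives [f_n = theta g_n + c j_n], so (theta, c) always
    passes the least-squares test.  Conversely a pair that passes has first entry theta unless
    [u] vanishes on the window, and second entry c unless [U] does.  Hence theta is identified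
    at tau_1, and c after the first interval on which [U] is not identically 0.
    From tau_2 on the loop is the nominal one: either c is known, or [U] vanished so far, and
    then, exponentials with distinct rates being independent, every mode seen by the feedback
    is 0 and [U] stays 0.  The nominal decay keeps the trigger idle, the events are then
    T-periodic, and the bounds on the three pieces multiply. *)

(** * Differentiation and linear ordinary differential equations *)

(** The standing assumption yields solutions only when the plant parameter equals the argument of
    the gain and the boundary value is exactly the feedback. Before tau_2 either may fail: the gain
    can be taken at a wrong parameter and is multiplied by [c / ch]. Solutions must therefore be
    manufactured from nominal ones. A factor [exp((theta - th) t)] repairs the parameter. The ratio
    [lam = c / ch] is handled by splitting off finitely many modes: what remains is invisible to the
    feedback, so there a nominal solution solves the Dirichlet problem whatever the ratio. The
    finite part must carry the boundary value [lam K(u)], and the obstacle is to reach the row of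
    gains as [h S(1)]; this is a two-point problem for [S'' = M S] that becomes solvable once enough
    modes are included. Accumulation of events is excluded only for the constructed solution; any
    other one agrees with it event by event. Zero initial data form a separate case, in which
    nothing is ever identified. *)

Section real_lemmas.
Context {R : realType}.
Implicit Types (f g F : R -> R) (a b : R).

Lemma is_deriveDx f g (x l m : R) : is_derive x 1 f l -> is_derive x 1 g m ->
  is_derive x 1 (fun y => f y + g y) (l + m).
Proof. by move=> hf hg; exact: is_deriveD. Qed.

Lemma is_deriveNx f (x l : R) : is_derive x 1 f l -> is_derive x 1 (fun y => - f y) (- l).
Proof. by move=> hf; exact: is_deriveN. Qed.

Lemma is_deriveBx f g (x l m : R) : is_derive x 1 f l -> is_derive x 1 g m ->
  is_derive x 1 (fun y => f y - g y) (l - m).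
Proof. by move=> hf hg; apply: is_deriveDx => //; exact: is_deriveNx. Qed.

Lemma is_deriveMx f g (x l m : R) : is_derive x 1 f l -> is_derive x 1 g m ->
  is_derive x 1 (fun y => f y * g y) (l * g x + f x * m).
Proof.
move=> hf hg; apply: (@is_derive_eq _ _ _ _ _ _ _ _ (is_deriveM hf hg)).
by rewrite /GRing.scale/=; ring.
Qed.

Lemma is_deriveZx f (c : R) (x l : R) : is_derive x 1 f l -> is_derive x 1 (fun y => c * f y) (c * l).
Proof. by move=> hf; exact: is_deriveZ. Qed.

Lemma is_derive_sumx (I : finType) (h : I -> R -> R) (dh : I -> R) (x : R) :
  (forall i, is_derive x 1 (h i) (dh i)) ->
  is_derive x 1 (fun y => \sum_i h i y) (\sum_i dh i).
Proof.
move=> H.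
suff : forall s : seq I, is_derive x 1 (fun y => \sum_(i <- s) h i y) (\sum_(i <- s) dh i).
  by [].
elim=> [|i s IH].
  rewrite big_nil; under eq_fun do rewrite big_nil; exact: is_derive_cst.
rewrite big_cons; under eq_fun do rewrite big_cons; exact: is_deriveDx.
Qed.

Lemma is_derive_expR_lin (c x : R) : is_derive x 1 (fun y => expR (c * y)) (c * expR (c * x)).
Proof.
have h : is_derive x 1 (fun y => c * y) (c * 1) by apply: is_deriveZx; exact: is_derive_id.
apply: (is_derive_eq (is_derive1_comp (is_derive_expR _) h)); ring.
Qed.

Lemma is_derive_sin_lin (c x : R) : is_derive x 1 (fun y => sin (c * y)) (c * cos (c * x)).
Proof.
have h : is_derive x 1 (fun y => c * y) (c * 1) by apply: is_deriveZx; exact: is_derive_id.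
apply: (is_derive_eq (is_derive1_comp (is_derive_sin _) h)); ring.
Qed.

Lemma is_derive_cos_lin (c x : R) : is_derive x 1 (fun y => cos (c * y)) (- (c * sin (c * x))).
Proof.
have h : is_derive x 1 (fun y => c * y) (c * 1) by apply: is_deriveZx; exact: is_derive_id.
apply: (is_derive_eq (is_derive1_comp (is_derive_cos _) h)); ring.
Qed.

Lemma is_derive_continuous f (x l : R) : is_derive x 1 f l -> {for x, continuous f}.
Proof. by move=> h; apply: differentiable_continuous; apply/derivable1_diffP; apply: ex_derive. Qed.

Lemma wcontD (T : topologicalType) (A : set T) (f g : T -> R) :
  {within A, continuous f} -> {within A, continuous g} ->
  {within A, continuous (fun x => f x + g x)}.
Proof. by move=> hf hg x; apply: (@cvgD _ R _ _ _ f g); [exact: hf|exact: hg]. Qed.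

Lemma wcontM (T : topologicalType) (A : set T) (f g : T -> R) :
  {within A, continuous f} -> {within A, continuous g} ->
  {within A, continuous (fun x => f x * g x)}.
Proof. by move=> hf hg x; apply: (@cvgM R _ _ _ f g); [exact: hf|exact: hg]. Qed.

Lemma wcont_cst (T : topologicalType) (A : set T) (c : R) : {within A, continuous (fun=> c)}.
Proof. by move=> x; exact: cvg_cst. Qed.

Lemma wcontZ (T : topologicalType) (A : set T) (c : R) (f : T -> R) :
  {within A, continuous f} -> {within A, continuous (fun x => c * f x)}.
Proof. by move=> hf; apply: wcontM => //; exact: wcont_cst. Qed.

Lemma wcontN (T : topologicalType) (A : set T) (f : T -> R) :
  {within A, continuous f} -> {within A, continuous (fun x => - f x)}.
Proof. by move=> hf x; apply: (@cvgN _ R _ _ _ f); exact: hf. Qed.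

Lemma wcontB (T : topologicalType) (A : set T) (f g : T -> R) :
  {within A, continuous f} -> {within A, continuous g} ->
  {within A, continuous (fun x => f x - g x)}.
Proof. by move=> hf hg; apply: wcontD => //; exact: wcontN. Qed.

Lemma wcont_sum (T : topologicalType) (A : set T) (I : finType) (h : I -> T -> R) :
  (forall i, {within A, continuous h i}) ->
  {within A, continuous (fun x => \sum_i h i x)}.
Proof.
move=> H; suff : forall s : seq I, {within A, continuous (fun x => \sum_(i <- s) h i x)} by [].
elim=> [|i s IH].
  under eq_fun do rewrite big_nil; exact: wcont_cst.
under eq_fun do rewrite big_cons; exact: wcontD.
Qed.

Lemma wcont_continuous (A : set R) f : continuous f -> {within A, continuous f}.
Proof. exact: continuous_subspaceT. Qed.

Lemma integrable_seg f a b : {within `[a, b], continuous f} ->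
  (@lebesgue_measure R).-integrable `[a, b] (EFin \o f).
Proof. by move=> h; apply: continuous_compact_integrable => //; exact: segment_compact. Qed.

Lemma Rintegral_FTC F f a b : a <= b -> {within `[a, b], continuous F} ->
  {within `[a, b], continuous f} ->
  (forall x, a < x < b -> is_derive x 1 F (f x)) ->
  \int[@lebesgue_measure R]_(x in `[a, b]) f x = F b - F a.
Proof.
rewrite le_eqVlt => /predU1P[<- _ _ _|ab cF cf dF].
  by rewrite set_itv1 Rintegral_set1 subrr.
rewrite /Rintegral (continuous_FTC2 ab cf (F := F)) //.
- move/(continuous_within_itvP _ ab) : cF => [_ c1 c2].
  by split=> // x; rewrite in_itv/= => /dF[].
- by move=> x; rewrite in_itv/= derive1E => /dF[].
Qed.

Lemma derive_le0_le f df a b : a <= b -> {within `[a, b], continuous f} ->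
  (forall x, a < x < b -> is_derive x 1 f (df x)) ->
  (forall x, a < x < b -> df x <= 0) -> f b <= f a.
Proof.
rewrite le_eqVlt => /predU1P[<- //|ab cf df1 le].
have hd x : x \in `]a, b[ -> is_derive x 1 f (df x) by rewrite in_itv/=; exact: df1.
have [c] := MVT ab hd cf.
rewrite in_itv/= => cab E; rewrite -subr_le0 E.
by rewrite mulr_le0_ge0 ?le// subr_ge0 ltW.
Qed.

Lemma derive0_cst f a b : a <= b -> {within `[a, b], continuous f} ->
  (forall x, a < x < b -> is_derive x 1 f 0) -> f b = f a.
Proof.
rewrite le_eqVlt => /predU1P[<- //|ab cf df1].
have hd x : x \in `]a, b[ -> is_derive x 1 f (0) by rewrite in_itv/=; exact: df1.
have [c] := MVT ab hd cf.
by move=> _; rewrite mul0r => /eqP; rewrite subr_eq0 => /eqP.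
Qed.

(** Gronwall for the energy [E], the sum of the squares of the components: [E' <= 2 C E] with [C]
    the sum of the absolute values of the entries of [A], so [exp(-2 C t) E(t)] is nonincreasing and
    starts at 0. *)
Lemma linear_ode_unique (m : nat) (A : 'M[R]_m) (y : 'I_m -> R -> R) a b :
  (forall i, {within `[a, b], continuous y i}) ->
  (forall i x, a < x < b -> is_derive x 1 (y i) (\sum_j A i j * y j x)) ->
  (forall i, y i a = 0) -> forall i x, a <= x <= b -> y i x = 0.
Proof.
move=> cy dy y0 i x /andP[ax xb].
pose C : R := \sum_i \sum_j `|A i j|.
have C0 : 0 <= C by do 2 apply: sumr_ge0 => ? _.
pose E t := \sum_i y i t ^+ 2.
have E0 t : 0 <= E t by apply: sumr_ge0 => ? _; rewrite sqr_ge0.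
have yE j t : y j t ^+ 2 <= E t.
  by rewrite /E (bigD1 j)//= lerDl sumr_ge0// => ? _; rewrite sqr_ge0.
pose dE t := \sum_i 2 * y i t * \sum_j A i j * y j t.
have dEle t : dE t <= 2 * C * E t.
  rewrite /dE /C -mulrA mulr_suml mulr_sumr ler_sum// => j _.
  rewrite -mulrA ler_pM2l// mulr_suml mulr_sumr ler_sum// => k _.
  rewrite (_ : _ * _ = A j k * (y j t * y k t)); last by ring.
  apply: (le_trans (ler_norm _)); rewrite normrM ler_wpM2l//.
  have h : `|y j t * y k t| <= (y j t ^+ 2 + y k t ^+ 2) / 2.
    have := sqr_ge0 (y j t - y k t); have := sqr_ge0 (y j t + y k t).
    rewrite sqrrD sqrrB ler_norml => h1 h2; apply/andP.
    by split; [rewrite lerNl|]; rewrite ler_pdivlMr//; lra.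
  by apply: (le_trans h); rewrite ler_pdivrMr// mulr_natr mulr2n lerD.
pose h t := expR (- (2 * C) * t) * E t.
have hle : h x <= h a.
  apply: (@derive_le0_le h (fun t => - (2 * C) * expR (- (2 * C) * t) * E t + expR (- (2 * C) * t) * dE t) _ _ ax).
  - apply: wcontM.
      apply: wcont_continuous => t; apply: is_derive_continuous; exact: is_derive_expR_lin.
    apply: wcont_sum => j.
    have cj : {within `[a, x], continuous y j}.
      apply: continuous_subspaceW (cy j) => t /=; rewrite !in_itv/= => /andP[-> tx].
      by rewrite (le_trans tx).
    exact: (wcontM cj cj).
  - move=> t /andP[ta tx]; apply: is_deriveMx; first exact: is_derive_expR_lin.
    apply: is_derive_sumx => j.
    have tb : a < t < b by rewrite ta (lt_le_trans tx).
    apply: (@is_derive_eq _ _ _ _ _ _ _ _ (is_deriveMx (dy j _ tb) (dy j _ tb))).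
    by ring.
  - move=> t _; rewrite mulNr mulNr -mulrA (mulrCA (2 * C)) addrC subr_le0 ler_pM2l ?expR_gt0//.
have ha : h a = 0 by rewrite /h /E big1 ?mulr0// => j _; rewrite y0 expr0n.
move: hle; rewrite ha /h pmulr_rle0 ?expR_gt0// => Ex.
apply/eqP; rewrite -sqrf_eq0 eq_le sqr_ge0 andbT.
by apply: le_trans Ex; exact: yE.
Qed.

(* Picard iteration for a linear system is the exponential series of [A]. *)
Lemma linear_ode_exists (m : nat) (A : 'M[R]_m) (y0 : 'cV[R]_m) :
  exists y : 'I_m -> R -> R, (forall i, y i 0 = y0 i 0) /\
  forall i (x : R), is_derive x 1 (y i) (\sum_j A i j * y j x).
Proof.
pose v k := iter k (mulmx A) y0.
pose a : R := 1 + \sum_i \sum_j `|A i j|.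
pose Y : R := \sum_i `|y0 i 0|.
have a1 : 1 <= a by rewrite /a lerDl; do 2 apply: sumr_ge0 => ? _.
have a0 : 0 <= a by apply: le_trans a1.
have Y0 : 0 <= Y by apply: sumr_ge0 => ? _.
have vS k i : v k.+1 i 0 = \sum_j A i j * v k j 0 by rewrite /v iterS mxE.
have vle k i : `|v k i 0| <= Y * a ^+ k.
  elim: k i => [|k IH] i.
    by rewrite expr0 mulr1 /v/= /Y (bigD1 i)//= lerDl sumr_ge0.
  rewrite vS (le_trans (ler_norm_sum _ _ _))//.
  apply: (@le_trans _ _ (\sum_j `|A i j| * (Y * a ^+ k))).
    by apply: ler_sum => j _; rewrite normrM ler_wpM2l.
  rewrite -mulr_suml exprS (mulrCA Y) ler_wpM2r ?mulr_ge0 ?exprn_ge0//.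
  rewrite /a [X in 1 + X](bigD1 i)//= addrCA lerDl addr_ge0// sumr_ge0// => ? _.
  by apply: sumr_ge0.
(* Coefficients of the [d]-th derivative of component [i]. Termwise differentiation raises [d] by
   one, and so does multiplication by [A]; together these are the equation. The theorem on
   derivatives of power series asks for convergence at [d = 0, 1, 2], hence the general [d]. *)
pose c d i k : R := v (k + d)%N i 0 / k`!%:R.
have cdiff d i : pseries_diffs (c d i) = c d.+1 i.
  apply/funext => k; rewrite /pseries_diffs /c factS natrM invfM mulrCA mulrA.
  by rewrite addSnnS mulrA mulfK ?pnatr_eq0.
have cvgc d i K : cvgn (pseries (c d i) K).
  apply: normed_cvg.
  apply: (@series_le_cvg _ _ (fun k => Y * a ^+ d * exp_coeff (a * `|K|) k)).
  - by move=> k; rewrite normr_ge0.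
  - by move=> k; rewrite mulr_ge0 ?mulr_ge0 ?exprn_ge0 ?invr_ge0 ?mulr_ge0.
  - move=> k; rewrite /c /= !normrM normfV normr_nat normrX /exp_coeff/= exprMn.
    rewrite (_ : Y * a ^+ d * (a ^+ k * `|K| ^+ k / k`!%:R) =
                 (Y * a ^+ (k + d)) / k`!%:R * `|K| ^+ k); last by rewrite exprD; ring.
    by rewrite ler_wpM2r ?exprn_ge0// ler_wpM2r// invr_ge0.
  - have -> : (fun k => Y * a ^+ d * exp_coeff (a * `|K|) k) =
      (Y * a ^+ d) *: exp_coeff (a * `|K|) by [].
    by apply: is_cvg_seriesZ; exact: is_cvg_series_exp_coeff.
exists (fun i x => limn (pseries (c 0%N i) x)); split=> [i|i x].
  apply: cvg_lim => //; apply: (@cvg_trans _ (cst (y0 i 0) n @[n --> \oo])); last exact: cvg_cst.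
  apply: near_eq_cvg; near=> n.
  have n0 : (0 < n)%N by near: n; exists 1%N.
  rewrite /pseries /series/= -(prednK n0) big_nat_recl// expr0 mulr1 big1 ?addr0.
    by rewrite /c addn0 /v /= fact0 divr1.
  by move=> j _; rewrite exprS mul0r mulr0.
have -> : \sum_j A i j * limn (pseries (c 0%N j) x) = limn (pseries (c 1%N i) x).
  apply/esym/cvg_lim => //.
  have -> : pseries (c 1%N i) x = (fun n => \sum_j A i j * pseries (c 0%N j) x n).
    apply/funext => n; rewrite /pseries /series/=.
    under [RHS]eq_bigr do rewrite mulr_sumr.
    rewrite exchange_big/=; apply: eq_bigr => k _.
    rewrite /c addn1 addn0 vS !mulr_suml; apply: eq_bigr => j _; ring.
  apply: cvg_big => [|j _]; first exact: add_continuous.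
  by apply: cvgM; [exact: cvg_cst|exact: cvgc].
rewrite -cdiff; apply: (@pseries_snd_diffs _ _ (`|x| + 1)); rewrite ?cdiff//.
by rewrite (@ger0_norm _ (`|x| + 1)) ?addr_ge0// ltrDl.
Unshelve. all: by end_near. Qed.

End real_lemmas.

(** * Completeness of the sine system *)

Section integrable_real.
Context d (T : measurableType d) (R : realType) (mu : {measure set T -> \bar R}).
Implicit Types (D : set T) (f g : T -> R).

Lemma integrable_addr D f g : measurable D -> mu.-integrable D (EFin \o f) ->
  mu.-integrable D (EFin \o g) -> mu.-integrable D (EFin \o (fun x => f x + g x)).
Proof.
move=> mD hf hg; have := integrableD mD hf hg.
by apply: eq_integrable => // x _; rewrite /= EFinD.
Qed.

Lemma integrable_mulr D (c : R) f : measurable D -> mu.-integrable D (EFin \o f) ->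
  mu.-integrable D (EFin \o (fun x => c * f x)).
Proof.
move=> mD hf; have := integrableZl mD c hf.
by apply: eq_integrable => // x _; rewrite /= EFinM.
Qed.

Lemma integrable_subr D f g : measurable D -> mu.-integrable D (EFin \o f) ->
  mu.-integrable D (EFin \o g) -> mu.-integrable D (EFin \o (fun x => f x - g x)).
Proof.
move=> mD hf hg; have := integrableB mD hf hg.
by apply: eq_integrable => // x _; rewrite /= EFinB.
Qed.

End integrable_real.
Arguments integrable_addr {d T R mu D}.
Arguments integrable_mulr {d T R mu D}.
Arguments integrable_subr {d T R mu D}.

Lemma Rintegral_indic_itv (R : realType) (a b : R) : a <= b ->
  `[a, b]%classic `<=` (`[0, 1]%classic : set R) ->
  \int[@lebesgue_measure R]_(x in `[0, 1]) \1_(`[a, b]%classic : set R) x = b - a.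
Proof.
move=> ab h.
have mI : measurable (`[a, b]%classic : set R) by exact: measurable_itv.
rewrite /Rintegral integral_indic// setIidl//.
have E : lebesgue_measure (`[a, b]%classic : set R) = (b - a)%:E.
  rewrite lebesgue_measure_itv/= lte_fin.
  move: ab; rewrite le_eqVlt => /predU1P[->|ab]; first by rewrite ltxx subrr.
  by rewrite ab EFinB.
exact: (congr1 fine E).
Qed.

Section completeness.
Context {R : realType}.
Notation leb := (@lebesgue_measure R).
Implicit Types (f g : R -> R).

Lemma wcont_sin_lin (A : set R) (c : R) : {within A, continuous (fun x => sin (c * x))}.
Proof. by apply: wcont_continuous => x; apply: is_derive_continuous; exact: is_derive_sin_lin. Qed.

Lemma wcont_cos_lin (A : set R) (c : R) : {within A, continuous (fun x => cos (c * x))}.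
Proof. by apply: wcont_continuous => x; apply: is_derive_continuous; exact: is_derive_cos_lin. Qed.

Lemma sin_natpi (n : nat) : sin (n%:R * pi) = 0 :> R.
Proof.
elim: n => [|n IH]; first by rewrite mul0r sin0.
by rewrite -natr1 mulrDl mul1r sinDpi IH oppr0.
Qed.

Lemma cos_natpi (n : nat) : cos (n%:R * pi) = (-1) ^+ n :> R.
Proof.
elim: n => [|n IH]; first by rewrite mul0r cos0 expr0.
by rewrite -natr1 mulrDl mul1r cosDpi IH exprS mulN1r.
Qed.

(** [2 sin(n y) cos(y) = sin((n+1) y) + sin((n-1) y)], so multiplication by [cos(pi x)] maps the
    span of the sine modes into itself. The weight [g] is arbitrary in order that the lemma can be
    iterated. *)
Lemma sine_orthogonal_cosM f g (c1 : R) :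
  {within `[0, 1], continuous f} -> {within `[0, 1], continuous g} ->
  (forall n, \int[leb]_(x in `[0, 1]) (sin (n%:R * pi * x) * (g x * f x)) = 0) ->
  forall n, \int[leb]_(x in `[0, 1])
    (sin (n%:R * pi * x) * ((cos (pi * x) - c1) * g x * f x)) = 0.
Proof.
move=> cf cg H n.
have cgf : {within `[0, 1], continuous (fun x => g x * f x)} by exact: wcontM.
pose h k (x : R) := sin (k%:R * pi * x) * (g x * f x).
have ih k : leb.-integrable `[0, 1] (EFin \o h k).
  by apply: integrable_seg; apply: wcontM => //; exact: wcont_sin_lin.
have ihZ (c : R) k : leb.-integrable `[0, 1] (EFin \o (fun x => c * h k x)).
  by apply: integrable_seg; apply: wcontZ; apply: wcontM => //; exact: wcont_sin_lin.
case: n => [|n].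
  rewrite (@eq_Rintegral _ _ _ _ _ (fun=> 0)) => [|x _]; last first.
    by rewrite !mul0r sin0 mul0r.
  by rewrite Rintegral_cst// mul0r.
transitivity (\int[leb]_(x in `[0, 1]) ((2^-1 * h n.+2 x + 2^-1 * h n x) - c1 * h n.+1 x)); last first.
  rewrite RintegralB//; last first.
    by apply: integrable_seg; apply: wcontD; apply: wcontZ; apply: wcontM => //; exact: wcont_sin_lin.
  by rewrite RintegralD// !RintegralZl// /h !H; ring.
apply: eq_Rintegral => x _; rewrite /h.
have e2 : n.+2%:R * pi * x = n.+1%:R * pi * x + pi * x by rewrite -(natr1 n.+1); ring.
have e0 : n%:R * pi * x = n.+1%:R * pi * x - pi * x by rewrite -(natr1 n); ring.
by rewrite e2 e0 sinD sinB; field.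
Qed.

(* Tested against [sin(pi x) (1 - (cos(pi x) - cos(pi x1))^2/4)^j], a combination of sine modes
   which concentrates at [x1], a function positive around [x1] cannot have all its modes 0. *)
Lemma sine_complete_bump f (a b m : R) : {within `[0, 1], continuous f} ->
  (forall n, (0 < n)%N -> \int[leb]_(x in `[0, 1]) (sin (n%:R * pi * x) * f x) = 0) ->
  0 < a -> a < b -> b < 1 -> 0 < m -> (forall x, a <= x <= b -> m <= f x) -> False.
Proof.
move=> cf H a0 ab b1 m0 fm.
pose x1 := (a + b) / 2; pose c1 := cos (pi * x1).
pose c x : R := cos (pi * x).
have pi0 : (0 : R) < pi := pi_gt0 R.
have cdec (x y : R) : 0 <= x -> x < y -> y <= 1 -> c y < c x.
  move=> x0 xy y1; rewrite /c ltr_cos ?in_itv/= ?ltr_pM2l//;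
    rewrite mulr_ge0 ?(ltW pi0) ?ler_piMr ?(ltW pi0)//; lra.
have ax1 : a < x1 by rewrite /x1; lra.
have x1b : x1 < b by rewrite /x1; lra.
(* [cos(pi x)] is strictly decreasing on [[0, 1]], so its distance to [c1] is at least [d] outside
   [[a, b]]. *)
pose d := Num.min (c a - c1) (c1 - c b).
have d0 : 0 < d.
  by rewrite lt_min !subr_gt0; apply/andP; split; apply: cdec; lra.
have cle x : `|c x| <= 1 by rewrite ler_norml cos_geN1 cos_le1.
have c1le : `|c1| <= 1 by exact: cle.
have d1 : d <= 1.
  have : d + d <= 2.
    apply: (@le_trans _ _ ((c a - c1) + (c1 - c b))).
      by rewrite lerD// /d ge_min lexx ?orbT.
    by have := cle a; have := cle b; rewrite !ler_norml => /andP[? _] /andP[_ ?]; lra.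
  lra.
have dout x : 0 <= x -> x <= 1 -> ~~ (a <= x <= b) -> d <= `|c x - c1|.
  move=> x0 x1'; rewrite negb_and -!ltNge => /orP[xa|bx].
    rewrite ger0_norm ?subr_ge0; last by apply/ltW/cdec => //; lra.
    apply: (@le_trans _ _ (c a - c1)); first by rewrite /d ge_min lexx.
    by rewrite lerD2r; apply/ltW/cdec => //; lra.
  rewrite ler0_norm ?subr_le0; last by apply/ltW/cdec => //; lra.
  apply: (@le_trans _ _ (c1 - c b)); first by rewrite /d ge_min lexx orbT.
  by rewrite opprB lerD2l lerN2; apply/ltW/cdec => //; lra.
have [e e0 eH] : exists2 e, 0 < e & forall x, x1 - e <= x <= x1 + e -> a <= x <= b /\ `|c x - c1| <= d / 2.
  have /cvgrPdist_le cc : {for x1, continuous c}.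
    by apply: is_derive_continuous; exact: is_derive_cos_lin.
  have /cc /nbhs_ballP[e /= e0 eH] : 0 < d / 2 by rewrite divr_gt0.
  exists (Num.min (e / 2) ((b - a) / 2)) => [|x].
    by rewrite lt_min !divr_gt0// subr_gt0.
  move=> /andP[xl xr]; set mm := Num.min _ _ in xl xr.
  have m1 : mm <= e / 2 by rewrite /mm ge_min lexx.
  have m2 : mm <= (b - a) / 2 by rewrite /mm ge_min lexx orbT.
  split; first by move: xl xr; rewrite /x1 => xl xr; apply/andP; split; lra.
  rewrite distrC; apply: eH; rewrite /ball/=.
  have e2 : e / 2 < e by lra.
  by rewrite ltr_distlC; apply/andP; split; lra.
pose K x : R := 1 - (c x - c1) ^+ 2 / 4.
(* [K] is at most [r0] outside [[a, b]] and at least [r1 > r0] within [e] of [x1]; this is why its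
   powers concentrate at [x1]. *)
pose r0 : R := 1 - d ^+ 2 / 4; pose r1 : R := 1 - d ^+ 2 / 16.
have d2 : 0 < d ^+ 2 by rewrite exprn_gt0.
have d21 : d ^+ 2 <= 1 by rewrite exprn_ile1// ltW.
have r00 : 0 <= r0 by rewrite /r0; lra.
have r10 : 0 < r1 by rewrite /r1; lra.
have r01 : r0 < r1 by rewrite /r0 /r1; lra.
have sqr_normr (x : R) : `|x| ^+ 2 = x ^+ 2 by rewrite real_normK ?num_real.
have K0 x : 0 <= K x.
  rewrite /K subr_ge0 ler_pdivrMr// mul1r -sqr_normr.
  have h : `|c x - c1| <= 2 by apply: (le_trans (ler_normB _ _)); have := cle x; lra.
  have : `|c x - c1| ^+ 2 <= 2 ^+ 2 by rewrite lerXn2r ?nnegrE.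
  by rewrite -natrX.
have Kout x : 0 <= x -> x <= 1 -> ~~ (a <= x <= b) -> K x <= r0.
  move=> x0 x1' xab; rewrite /K /r0 lerD2l lerN2 ler_pM2r ?invr_gt0//.
  by rewrite -[leRHS]sqr_normr lerXn2r ?nnegrE ?(ltW d0)//; exact: dout.
have Kin x : x1 - e <= x <= x1 + e -> r1 <= K x.
  move=> /eH[_ h]; rewrite /K /r1 lerD2l lerN2 -sqr_normr.
  have : `|c x - c1| ^+ 2 <= (d / 2) ^+ 2 by rewrite lerXn2r ?nnegrE ?divr_ge0 ?(ltW d0).
  by rewrite expr_div_n -natrX; lra.
have cK : {within `[0, 1], continuous K}.
  apply: wcontB; first exact: wcont_cst.
  have cc : {within `[0, 1], continuous (fun x => c x - c1)}.
    by apply: wcontB; [exact: wcont_cos_lin|exact: wcont_cst].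
  by apply: wcontM; [exact: (wcontM cc cc)|exact: wcont_cst].
have cKj j : {within `[0, 1], continuous (fun x => K x ^+ j)}.
  elim: j => [|j IH]; first exact: wcont_cst.
  have -> : (fun x => K x ^+ j.+1) = (fun x => K x * K x ^+ j).
    by apply/funext => x; rewrite exprS.
  exact: wcontM.
(* [K] is a polynomial of degree 2 in [cos(pi x)]: two uses of [sine_orthogonal_cosM] add one factor
   [K]. *)
have intK j : forall n, \int[leb]_(x in `[0, 1]) (sin (n%:R * pi * x) * (K x ^+ j * f x)) = 0.
  elim: j => [|j IH].
    case=> [|n].
      rewrite (@eq_Rintegral _ _ _ _ _ (fun=> 0)) => [|x _]; last by rewrite !mul0r sin0 mul0r.
      by rewrite Rintegral_cst// mul0r.
    by rewrite -[RHS](H n.+1)//; apply: eq_Rintegral => x _; rewrite expr0 mul1r.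
  have h1 := sine_orthogonal_cosM c1 cf (cKj j) IH.
  have cg1 : {within `[0, 1], continuous (fun x => (cos (pi * x) - c1) * K x ^+ j)}.
    by apply: wcontM => //; apply: wcontB; [exact: wcont_cos_lin|exact: wcont_cst].
  have h2 := sine_orthogonal_cosM c1 cf cg1 h1.
  move=> n; pose s x : R := sin (n%:R * pi * x).
  have cs : {within `[0, 1], continuous s} by exact: wcont_sin_lin.
  transitivity (\int[leb]_(x in `[0, 1]) (s x * (K x ^+ j * f x) -
     4^-1 * (s x * ((cos (pi * x) - c1) * ((cos (pi * x) - c1) * K x ^+ j) * f x)))); last first.
    have cA : {within `[0, 1], continuous (fun x => s x * ((cos (pi * x) - c1) * ((cos (pi * x) - c1) * K x ^+ j) * f x))}.
      apply: wcontM => //; apply: wcontM => //; apply: wcontM => //.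
      by apply: wcontB; [exact: wcont_cos_lin|exact: wcont_cst].
    rewrite RintegralB//.
    - rewrite RintegralZl//; last exact: integrable_seg.
      by rewrite IH h2 mulr0 subr0.
    - by apply: integrable_seg; apply: wcontM => //; exact: wcontM.
    - by apply: integrable_seg; apply: wcontZ.
  by apply: eq_Rintegral => x _; rewrite exprS {1}/K /s /c; field.
have [F F0 FH] : exists2 F, 0 < F & forall x, 0 <= x <= 1 -> `|f x| <= F.
  have cnf : {within `[0, 1], continuous (fun x => `|f x|)}.
    by move=> x; apply: cvg_norm; exact: cf.
  have [z _ zH] := EVT_max (@ler01 R) cnf.
  exists (`|f z| + 1) => [|x x01]; first by rewrite ltr_pwDr.
  by rewrite (le_trans (zH x _))// ?in_itv//= lerDl.
have sinpos (x : R) : 0 < x < 1 -> 0 < sin (pi * x).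
  by move=> /andP[x0 x1']; rewrite sin_gt0_pi// mulr_gt0//= gtr_pMr.
have [s s00 sH] : exists2 s : R, 0 < s & forall x, a <= x <= b -> s <= sin (pi * x).
  have [|z zab zH] := @EVT_min R (fun x => sin (pi * x)) a b (ltW ab).
    exact: wcont_sin_lin.
  move: zab; rewrite in_itv/= => zab.
  exists (sin (pi * z)); first by apply: sinpos; lra.
  by move=> x xab; apply: zH; rewrite in_itv.
(* Outside [[a, b]] the integrand is at least [- F * r0 ^+ j]; near [x1] it is at least
   [s * m * r1 ^+ j] on a length [2 * e]. The ratio of the two contributions tends to 0. *)
have [j jH] : exists j, F * r0 ^+ j < s * m * r1 ^+ j * (2 * e).
  pose q := r0 / r1.
  have q1 : `|q| < 1.
    by rewrite ger0_norm ?divr_ge0 ?(ltW r10)// ltr_pdivrMr// mul1r.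
  have /cvgrPdist_lt/(_ (s * m * (2 * e) / F)) := cvg_expr q1.
  have sp : 0 < s * m * (2 * e) / F by rewrite divr_gt0// !mulr_gt0.
  move=> /(_ sp)[j _ /(_ j (leqnn j))] /=.
  rewrite sub0r normrN normrX ger0_norm ?divr_ge0 ?(ltW r10)//.
  rewrite ltr_pdivlMr// /q expr_div_n => h; exists j.
  rewrite (_ : s * m * r1 ^+ j * (2 * e) = (s * m * (2 * e)) * r1 ^+ j); last by ring.
  rewrite -ltr_pdivrMr ?exprn_gt0//.
  by rewrite (_ : F * r0 ^+ j / r1 ^+ j = r0 ^+ j / r1 ^+ j * F)//; ring.
pose I : set R := `[x1 - e, x1 + e]%classic.
(* A step function below the integrand on [[0, 1]]. By the choice of [j] its integral is positive,
   whereas that of the integrand is 0. *)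
pose g x : R := s * m * r1 ^+ j * \1_I x - F * r0 ^+ j.
have I01 : I `<=` `[0, 1].
  by move=> x; rewrite /I /= !in_itv/= => /eH[/andP[h1 h2] _]; lra.
have iI0 : leb.-integrable `[0, 1] (EFin \o \1_I).
  apply: (@integrableS _ _ _ _ setT) => //; exact: integrable_indic_itv.
have iI : leb.-integrable `[0, 1] (EFin \o (fun x => s * m * r1 ^+ j * \1_I x)).
  exact: integrable_mulr.
have icst : leb.-integrable `[0, 1] (EFin \o (fun=> F * r0 ^+ j)).
  by apply: integrable_seg; exact: wcont_cst.
have : \int[leb]_(x in `[0, 1]) g x <= 0.
  apply: (@le_trans _ _ (\int[leb]_(x in `[0, 1]) (sin (1%:R * pi * x) * (K x ^+ j * f x)))); last by rewrite (intK j 1%N).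
  apply: le_Rintegral => //.
  - exact: integrable_subr.
  - by apply: integrable_seg; apply: wcontM; [exact: wcont_sin_lin|exact: wcontM].
  move=> x /=; rewrite in_itv/= => x01; rewrite mul1r /g.
  have r0j : 0 <= F * r0 ^+ j by rewrite mulr_ge0 ?exprn_ge0// ltW.
  have sx : 0 <= sin (pi * x).
    by rewrite sin_ge0_pi// mulr_ge0 ?(ltW pi0)//=; case/andP: x01 => // ? ?; rewrite ler_piMr ?(ltW pi0).
  have Kj0 : 0 <= K x ^+ j by rewrite exprn_ge0.
  have [xI|xI] := boolP (x \in I).
    rewrite indicE xI mulr1.
    have xI' : x1 - e <= x <= x1 + e by move: xI; rewrite inE /I/= in_itv.
    have [xab _] := eH _ xI'.
    apply: (@le_trans _ _ (s * m * r1 ^+ j)); first by rewrite gerBl.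
    rewrite -mulrA; apply: ler_pM; rewrite ?(ltW s00) ?mulr_ge0 ?exprn_ge0 ?(ltW m0) ?(ltW r10)//; first exact: sH.
    rewrite mulrC ler_pM ?exprn_ge0 ?(ltW m0) ?(ltW r10)//; last exact: fm.
    by rewrite lerXn2r ?nnegrE ?(ltW r10) ?K0//; exact: Kin.
  rewrite indicE (negbTE xI) mulr0 sub0r.
  have [xab|xab] := boolP (a <= x <= b).
    rewrite (@le_trans _ _ 0) ?oppr_le0// !mulr_ge0// (le_trans (ltW m0))//; exact: fm.
  apply: (@le_trans _ _ (- `|sin (pi * x) * (K x ^+ j * f x)|)); last by rewrite lerNl -normrN ler_norm.
  rewrite lerN2 !normrM (ger0_norm sx) (ger0_norm Kj0).
  rewrite (@le_trans _ _ (1 * (r0 ^+ j * F)))//; last by rewrite mul1r mulrC.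
  case/andP: (x01) => x0 x1'.
  rewrite ler_pM ?mulr_ge0 ?sin_le1// ler_pM//; last exact: FH.
  by rewrite lerXn2r ?nnegrE ?K0//; exact: Kout.
have E1 : \int[leb]_(x in `[0, 1]) g x =
  s * m * r1 ^+ j * \int[leb]_(x in `[0, 1]) \1_I x - F * r0 ^+ j.
  rewrite /g RintegralB// RintegralZl//; congr (_ - _).
  by rewrite Rintegral_cst//= lebesgue_measure_itv/= lte_fin ltr01 oppr0 adde0 mulr1.
rewrite E1 [X in _ * X](_ : _ = 2 * e).
  by rewrite leNgt subr_gt0 jH.
by rewrite Rintegral_indic_itv//; [ring|lra].
Qed.

(** A nonzero value makes [f] or [- f] larger than a positive constant nearby. [sine_complete_bump]
    wants an interval strictly inside []0, 1[], so it is taken to the right of [x] if [x <= 1/2] and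
    to the left otherwise; this covers the end points as well. *)
Lemma sine_complete f : {within `[0, 1], continuous f} ->
  (forall n, (0 < n)%N -> \int[leb]_(x in `[0, 1]) (sin (n%:R * pi * x) * f x) = 0) ->
  forall x, 0 <= x <= 1 -> f x = 0.
Proof.
suff pos g : {within `[0, 1], continuous g} ->
  (forall n, (0 < n)%N -> \int[leb]_(x in `[0, 1]) (sin (n%:R * pi * x) * g x) = 0) ->
  forall x, 0 <= x <= 1 -> g x <= 0.
  move=> cf H x x01; apply/eqP; rewrite eq_le pos//= -oppr_le0.
  apply: (pos (fun x => - f x)) => // [|n n0]; first exact: wcontN.
  transitivity (-1 * \int[leb]_(x in `[0, 1]) (sin (n%:R * pi * x) * f x)).
    rewrite -RintegralZl//; first by apply: eq_Rintegral => y _; ring.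
    by apply: integrable_seg; apply: wcontM => //; exact: wcont_sin_lin.
  by rewrite H// mulr0.
move=> cg H x x01; rewrite leNgt; apply/negP => gx.
have := cg; move=> /subspace_continuousP/(_ x); rewrite /= in_itv/= => /(_ x01).
move=> /cvgrPdist_le/(_ (g x / 2)); rewrite divr_gt0// => /(_ isT).
rewrite /prop_near1 /within/= => /nbhs_ballP[d /= d0 dH].
have gH y : 0 <= y <= 1 -> `|x - y| < d -> g x / 2 <= g y.
  move=> y01 xy; have := dH y xy; rewrite in_itv/= => /(_ y01).
  by rewrite /from_subspace ler_distlC => /andP[h _]; lra.
case/andP: (x01) => x0 x1.
have [xl|xr] := leP x (1 / 2).
  pose q := Num.min d (1 / 2).
  have q0 : 0 < q by rewrite lt_min d0 divr_gt0.
  have qd : q <= d by rewrite ge_min lexx.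
  have q2 : q <= 1 / 2 by rewrite ge_min lexx orbT.
  apply: (@sine_complete_bump g (x + q / 3) (x + q / 2) (g x / 2)) => //; try lra.
  by move=> y /andP[y1 y2]; apply: gH; [lra|rewrite distrC ger0_norm; lra].
pose q := Num.min d (1 / 2).
have q0 : 0 < q by rewrite lt_min d0 divr_gt0.
have qd : q <= d by rewrite ge_min lexx.
have q2 : q <= 1 / 2 by rewrite ge_min lexx orbT.
apply: (@sine_complete_bump g (x - q / 2) (x - q / 3) (g x / 2)) => //; try lra.
by move=> y /andP[y1 y2]; apply: gH; [lra|rewrite ger0_norm; lra].
Qed.

End completeness.

(** * The norm of L^2(0,1) *)

Section L2.
Context {R : realType}.
Notation leb := (@lebesgue_measure R).
Notation TR := (measurableTypeR R).
Notation I01 := (`]0%R, 1%R[%classic : set R).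
Implicit Types (f g s : R -> R).

Let ae_filter : Filter (almost_everywhere leb) := ae_filter_ringOfSetsType leb.
#[local] Existing Instance ae_filter.

Lemma inL2_measurable f : inL2 f -> measurable_fun (setT : set TR) (f \_ I01).
Proof. by move=> /andP[+ _]; rewrite inE. Qed.

Lemma inL2_fin f : inL2 f -> ('N[leb]_2%:E[EFin \o (f \_ I01)] < +oo)%E.
Proof. by move=> /andP[_ +]; rewrite inE. Qed.

Lemma inL2_fineK f : inL2 f -> (L2norm f)%:E = 'N[leb]_2%:E[EFin \o (f \_ I01)]%E.
Proof. by move=> hf; rewrite fineK// ge0_fin_numE ?Lnorm_ge0// inL2_fin. Qed.

Lemma patchD_I01 f g : (fun x => f x + g x) \_ I01 = f \_ I01 \+ g \_ I01.
Proof. by apply/funext => x; rewrite /= !patchE; case: ifP => // _; rewrite addr0. Qed.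

Lemma patchZ_I01 (c : R) f : (fun x => c * f x) \_ I01 = c \*: (f \_ I01).
Proof. by apply/funext => x; rewrite /= !patchE; case: ifP => // _; rewrite scaler0. Qed.

Lemma inL2D f g : inL2 f -> inL2 g -> inL2 (fun x => f x + g x).
Proof. by rewrite /inL2 patchD_I01 => hf hg; apply: (Lfun_addr_closed _ _).2 => //; exact: lee1n. Qed.

Lemma inL2Z (c : R) f : inL2 f -> inL2 (fun x => c * f x).
Proof.
rewrite /inL2 patchZ_I01 => hf; have -> : c \*: (f \_ I01) = c \o* (f \_ I01).
  by apply/funext => x /=; rewrite mulrC.
by apply: Lfun_scale => //; rewrite ler1n.
Qed.

Lemma inL2B f g : inL2 f -> inL2 g -> inL2 (f \- g).
Proof.
move=> hf hg; have := inL2D hf (inL2Z (-1) hg).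
by under [X in inL2 X -> _]eq_fun do rewrite mulN1r.
Qed.

Lemma inL20 : inL2 (cst 0 : R -> R).
Proof.
rewrite /inL2 (_ : _ \_ _ = cst 0); last by apply/funext => x; rewrite patchE; case: ifP.
by apply: (Lfun_addr_closed _ _).1; exact: lee1n.
Qed.

Lemma L2norm_ge0 f : 0 <= L2norm f.
Proof. by rewrite fine_ge0// Lnorm_ge0. Qed.

Lemma L2normD f g : inL2 f -> inL2 g ->
  L2norm (fun x => f x + g x) <= L2norm f + L2norm g.
Proof.
move=> hf hg; have hfg := inL2D hf hg.
rewrite -lee_fin EFinD !inL2_fineK// patchD_I01.
by apply: minkowski_EFin; [exact: inL2_measurable|exact: inL2_measurable|rewrite ler1n].
Qed.

Lemma L2normZ (c : R) f : inL2 f -> L2norm (fun x => c * f x) = `|c| * L2norm f.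
Proof.
move=> hf; apply/EFin_inj; rewrite EFinM !inL2_fineK//; last exact: inL2Z.
by rewrite patchZ_I01 (LnormZ (Lfun_Sub (lee1n 2) hf)).
Qed.

Lemma L2normB_sym f g : inL2 f -> inL2 g -> L2norm (f \- g) = L2norm (g \- f).
Proof.
move=> hf hg.
rewrite -[RHS]mul1r -(normrN1 R) -L2normZ; last exact: inL2B.
by congr L2norm; apply/funext => x /=; rewrite mulN1r opprB.
Qed.

Lemma L2norm_dist f g : inL2 f -> inL2 g -> `|L2norm f - L2norm g| <= L2norm (f \- g).
Proof.
suff H (f' g' : R -> R) : inL2 f' -> inL2 g' -> L2norm f' - L2norm g' <= L2norm (f' \- g').
  move=> hf hg; rewrite ler_norml H// andbT lerNl opprB L2normB_sym//; exact: H.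
move=> hf hg; rewrite lerBlDr.
have := L2normD (inL2B hf hg) hg.
by under [X in L2norm X <= _ -> _]eq_fun do rewrite /= subrK.
Qed.

Lemma eqL2_sym f g : eqL2 f g -> eqL2 g f.
Proof. by apply: (@filterS _ _ ae_filter) => x /= h xD; rewrite h. Qed.

Lemma eqL2_refl f : eqL2 f f.
Proof. exact: aeW. Qed.

Lemma eqL2_trans f g s : eqL2 f g -> eqL2 g s -> eqL2 f s.
Proof. by apply: (@filterS2 _ _ ae_filter) => x /= h1 h2 xD; rewrite h1// h2. Qed.

Lemma eqL2B f g f' g' : eqL2 f f' -> eqL2 g g' -> eqL2 (f \- g) (f' \- g').
Proof. by apply: (@filterS2 _ _ ae_filter) => x /= h1 h2 xD; rewrite h1// h2. Qed.

Lemma eqL2_in f g : (forall x, 0 < x < 1 -> f x = g x) -> eqL2 f g.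
Proof. by move=> h; apply: aeW => x /=; rewrite in_itv/=; exact: h. Qed.

Lemma L2norm_eq0 f : inL2 f -> L2norm f = 0 -> eqL2 f (cst 0).
Proof.
move=> hf h0; have E := inL2_fineK hf; rewrite h0 in E.
have /measurable_EFinP mf := inL2_measurable hf.
have := Lnorm_eq0_eq0 mf (ltr0n _ 2 : (0%R < 2%:E :> \bar R)%E) (esym E).
apply: (@filterS _ _ ae_filter) => x /= h xD; move: (h I) => [].
by rewrite patchE mem_set.
Qed.

Lemma eqL2_L2norm f g : inL2 f -> inL2 g -> eqL2 f g -> L2norm f = L2norm g.
Proof.
move=> hf hg fg; apply/eqP; rewrite -subr_eq0 -normr_eq0 eq_le normr_ge0 andbT.
apply: (le_trans (L2norm_dist hf hg)); rewrite -lee_fin inL2_fineK; last exact: inL2B.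
rewrite unlock /Lnorm.
rewrite (_ : integral _ _ _ = 0%E).
  by rewrite poweR0r// invr_eq0.
have mfg := inL2_measurable (inL2B hf hg).
rewrite (ae_eq_integral (cst 0%E)) ?integral0//.
- by apply: (measurableT_comp (measurable_poweR _)) => //; apply: measurableT_comp => //; exact/measurable_EFinP.
- apply: (@filterS _ _ ae_filter) fg => x /= h _; rewrite patchE; case: ifPn => xD /=.
    by rewrite h; [rewrite subrr normr0 powR0|move: xD; rewrite inE].
  by rewrite normr0 powR0.
Qed.

Lemma L2norm_cst0 : L2norm (cst 0 : R -> R) = 0.
Proof.
rewrite /L2norm (_ : EFin \o _ = cst 0%E) ?Lnorm0//.
by apply/funext => x /=; rewrite patchE; case: ifP.
Qed.

Lemma eqL20_L2norm f : inL2 f -> eqL2 f (cst 0) <-> L2norm f = 0.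
Proof.
move=> hf; split=> [h|]; last exact: L2norm_eq0.
by rewrite (eqL2_L2norm hf inL20 h) L2norm_cst0.
Qed.

Lemma Lnorm2_indic (C : R) : 0 <= C -> 'N[leb]_2%:E[EFin \o (cst C \_ I01)]%E = C%:E.
Proof.
move=> C0; rewrite unlock /Lnorm.
rewrite (_ : integral _ _ _ = (C ^+ 2)%:E).
  by rewrite poweR_EFin -powR_mulrn// -powRrM mulfV// powRr1.
transitivity (\int[leb]_x ((C ^+ 2)%:E * (\1_I01 x)%:E))%E.
  apply: eq_integral => x _ /=; rewrite patchE indicE; case: ifP => _ /=.
    by rewrite mule1 ger0_norm// powR_mulrn.
  by rewrite mule0 normr0 powR0.
rewrite ge0_integralZl//.
- rewrite integral_indic// setIT.
  have E : leb I01 = 1%E by rewrite lebesgue_measure_itv/= lte_fin ltr01 oppr0 adde0.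
  by rewrite [X in (_ * X)%E](E : _ = _) mule1.
- by apply/measurable_EFinP; exact: measurable_indic.
- by rewrite lee_fin exprn_ge0.
Qed.

Lemma inL2_bounded f (C : R) : measurable_fun (setT : set TR) (f \_ I01) ->
  (forall x, 0 < x < 1 -> `|f x| <= C) -> inL2 f /\ L2norm f <= C.
Proof.
move=> mf fC.
have C0 : 0 <= C by apply: le_trans (fC (2^-1) _); rewrite ?normr_ge0//; lra.
have le : ('N[leb]_2%:E[EFin \o (f \_ I01)] <= C%:E)%E.
  rewrite -(Lnorm2_indic C0) unlock /Lnorm.
  apply: gt0_ler_poweR; first by rewrite invr_ge0.
  - by rewrite in_itv/= leey andbT; apply: integral_ge0 => x _; rewrite lee_fin powR_ge0.
  - by rewrite in_itv/= leey andbT; apply: integral_ge0 => x _; rewrite lee_fin powR_ge0.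
  apply: ge0_le_integral => //.
  - by move=> x _; exact: poweR_ge0.
  - by apply: (measurableT_comp (measurable_poweR _)) => //; apply: measurableT_comp => //; exact/measurable_EFinP.
  - apply: (measurableT_comp (measurable_poweR _)) => //; apply: measurableT_comp => //; apply/measurable_EFinP.
    by apply/(measurable_restrictT _ _).1 => //; exact: measurable_cst.
  move=> x _ /=; rewrite lee_fin ge0_ler_powR// ?nnegrE// !patchE; case: ifPn => // xD.
  by rewrite (ger0_norm C0) fC//; move: xD; rewrite inE/= in_itv.
split; last by rewrite -lee_fin (le_trans _ le)// fineK// ge0_fin_numE ?Lnorm_ge0// (le_lt_trans le) ?ltry.
by apply/andP; split; rewrite inE//=; rewrite /finite_norm (le_lt_trans le) ?ltry.
Qed.

Lemma wcont_measurable f : {within `[0, 1], continuous f} -> measurable_fun (setT : set TR) (f \_ I01).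
Proof.
move=> cf; apply/(measurable_restrictT _ _).1 => //.
apply: (@measurable_funS _ _ _ _ (`[0, 1]%classic : set TR)) => //.
  exact: subset_itv_oo_cc.
exact: subspace_continuous_measurable_fun.
Qed.

Lemma wcont_bounded f (a b : R) : a <= b -> {within `[a, b], continuous f} ->
  exists2 C, 0 < C & forall x, a <= x <= b -> `|f x| <= C.
Proof.
move=> ab cf.
have cnf : {within `[a, b], continuous (fun x => `|f x|)}.
  by move=> x; apply: cvg_norm; exact: cf.
have [z _ zH] := EVT_max ab cnf.
exists (`|f z| + 1) => [|x x01]; first by rewrite ltr_pwDr.
by rewrite (le_trans (zH x _))// ?in_itv//= lerDl.
Qed.

Lemma inL2_wcont f : {within `[0, 1], continuous f} -> inL2 f.
Proof.
move=> cf; have [C _ fC] := wcont_bounded ler01 cf.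
apply: (inL2_bounded (C := C) _ _).1; first exact: wcont_measurable.
by move=> x /andP[x0 x1]; apply: fC; rewrite !ltW.
Qed.

(* Hoelder with exponents 2, 2 against the indicator of ]0, 1[, which has norm 1. *)
Lemma inL2_L1 f : inL2 f -> leb.-integrable I01 (EFin \o f) /\
  \int[leb]_(x in I01) `|f x| <= L2norm f.
Proof.
move=> hf; have mf := inL2_measurable hf.
have m1 : measurable_fun (setT : set TR) ((cst 1 : R -> R) \_ I01).
  by apply/(measurable_restrictT _ _).1 => //; exact: measurable_cst.
have pq : 2^-1 + 2^-1 = 1 :> R by lra.
have := @hoelder _ _ _ leb _ _ 2 2 mf m1 (ltr0n _ 2) (ltr0n _ 2) pq.
rewrite (Lnorm2_indic ler01) mule1 Lnorm1 -(inL2_fineK hf).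
have E : (\int[leb]_x `|(EFin \o (f \_ I01 \* (cst 1 : R -> R) \_ I01)%R) x| = \int[leb]_(x in I01) (`|f x|)%:E)%E.
  rewrite [RHS]integral_mkcond; apply: eq_integral => x _ /=.
  by rewrite !patchE; case: ifP => _; rewrite ?mulr1 ?mul0r ?normr0.
move=> h.
have mfI : measurable_fun (I01 : set TR) f by apply/(measurable_restrictT _ _).2.
rewrite E in h; split.
  by apply/integrableP; split; [exact/measurable_EFinP|rewrite (le_lt_trans h)// ltry].
rewrite /Rintegral -lee_fin fineK// ge0_fin_numE.
  by rewrite (le_lt_trans h)// ltry.
by apply: integral_ge0 => x _; rewrite lee_fin.
Qed.

End L2.

(** * Epsilon-delta forms of limits and of relative derivatives *)

Section eps.
Context {R : realType}.
Implicit Types (f g : R -> R) (A : set R).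

Lemma cvg_withinP A f (x l : R) :
  f y @[y --> within A (nbhs x)] --> l <->
  forall e, 0 < e -> exists2 d, 0 < d & forall y, A y -> `|y - x| < d -> `|f y - l| < e.
Proof.
split=> [/cvgrPdist_lt h e e0|h].
  have := h e e0; rewrite /prop_near1 /within/= => /nbhs_ballP[d /= d0 dH].
  exists d => // y Ay yx; rewrite distrC; apply: dH => //.
  by rewrite /ball/= distrC.
apply/cvgrPdist_lt => e /h[d d0 dH].
rewrite /prop_near1 /within/=; apply/nbhs_ballP; exists d => //= y yx Ay.
by rewrite distrC; apply: dH => //; rewrite distrC.
Qed.

Lemma deriv_withinP A f (x l : R) : deriv_within A f x l <->
  forall e, 0 < e -> exists2 d, 0 < d & forall y, A y -> y != x -> `|y - x| < d ->
    `|(f y - f x) / (y - x) - l| < e.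
Proof.
split=> [/cvgrPdist_lt h e e0|h].
  have := h e e0; rewrite /prop_near1 /within/= => /nbhs_ballP[d /= d0 dH].
  exists d => // y Ay yx yxd; rewrite distrC; apply: dH => //.
  by rewrite /ball/= distrC.
apply/cvgrPdist_lt => e /h[d d0 dH].
rewrite /prop_near1 /within/=; apply/nbhs_ballP; exists d => //= y yx yx0 Ay.
by rewrite distrC; apply: dH => //; rewrite distrC.
Qed.

Lemma is_deriveP f (x l : R) : is_derive x 1 f l <-> deriv_within setT f x l.
Proof.
have E h : h^-1 *: ((f \o shift x) (h *: 1) - f x) = (f (h + x) - f x) / h.
  by rewrite /= /GRing.scale/= mulr1 mulrC.
split=> [[df df1]|/deriv_withinP h].
  apply/deriv_withinP => e e0.
  have := df; rewrite /derivable => /cvg_ex[/= m hm].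
  have ml : m = l by rewrite -df1; apply/esym/cvg_lim.
  move: hm => /cvgrPdist_lt/(_ e e0); rewrite /prop_near1 => /nbhs_ballP[d /= d0 dH].
  exists d => // y _ yx yxd; have := dH (y - x).
  rewrite E subrK -ml distrC; apply; last by rewrite subr_eq0.
  by rewrite /ball/= sub0r normrN.
have c : h0^-1 *: ((f \o shift x) (h0 *: 1) - f x) @[h0 --> 0^'] --> l.
  apply/cvgrPdist_lt => e /h[d d0 dH].
  apply/nbhs_ballP; exists d => //= y; rewrite /ball/= sub0r normrN => yd y0.
  have := dH (y + x) I; rewrite addrK -subr_eq0 addrK => /(_ y0 yd).
  by rewrite distrC E.
by apply: DeriveDef; [apply/cvg_ex; exists l|exact/cvg_lim].
Qed.

Lemma is_derive_deriv_within A f (x l : R) : is_derive x 1 f l -> deriv_within A f x l.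
Proof.
move=> /is_deriveP/deriv_withinP h; apply/deriv_withinP => e /h[d d0 dH].
by exists d => // y _; apply: dH.
Qed.

Lemma deriv_within_is_derive A f (x l e : R) : 0 < e ->
  (forall y, `|y - x| < e -> A y) -> deriv_within A f x l -> is_derive x 1 f l.
Proof.
move=> e0 eA /deriv_withinP h; apply/is_deriveP/deriv_withinP => e' /h[d d0 dH].
exists (Num.min d e) => [|y _ yx]; first by rewrite lt_min d0.
by rewrite lt_min => /andP[h1 h2]; apply: dH => //; exact: eA.
Qed.

Lemma deriv_within_cvg A f (x l : R) : deriv_within A f x l ->
  f y @[y --> within A (nbhs x)] --> f x.
Proof.
move=> /deriv_withinP/(_ 1 ltr01)[d d0 dH]; apply/cvg_withinP => e e0.
exists (Num.min d (e / (`|l| + 1))) => [|y Ay].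
  by rewrite lt_min d0 divr_gt0// ltr_wpDl.
rewrite lt_min => /andP[h1 h2].
have [->|yx] := eqVneq y x; first by rewrite subrr normr0.
have q := dH y Ay yx h1.
have yx0 : y - x != 0 by rewrite subr_eq0.
have -> : f y - f x = (f y - f x) / (y - x) * (y - x) by rewrite divfK.
set qq := (f y - f x) / (y - x) in q *.
have q1 : `|qq| < `|l| + 1.
  by rewrite -(subrK l qq) (le_lt_trans (ler_normD _ _))// addrC ltrD2l.
have yx1 : 0 < `|y - x| by rewrite normr_gt0.
rewrite normrM; move: h2; rewrite ltr_pdivlMr; last by rewrite ltr_wpDl.
by move=> h2; rewrite (le_lt_trans _ h2)// mulrC ler_pM2l// ltW.
Qed.

Lemma wcontP A f : {within A, continuous f} <->
  forall x, A x -> f y @[y --> within A (nbhs x)] --> f x.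
Proof. exact: subspace_continuousP. Qed.

Lemma deriv_within_wcont A f (f1 : R -> R) :
  (forall x, A x -> deriv_within A f x (f1 x)) -> {within A, continuous f}.
Proof. by move=> h; apply/wcontP => x /h; exact: deriv_within_cvg. Qed.

Lemma deriv_within_seg f f1 : (forall x, x \in `[0, 1] -> deriv_within `[0, 1] f x (f1 x)) ->
  {within `[0, 1], continuous f} /\ (forall x : R, 0 < x < 1 -> is_derive x 1 f (f1 x)).
Proof.
move=> h; split; first by apply: deriv_within_wcont => x; exact: h.
move=> x /andP[x0 x1].
have xI : x \in `[0, 1] by rewrite in_itv/= !ltW.
apply: (deriv_within_is_derive (e := Num.min x (1 - x)) _ _ (h x xI)).
  by rewrite lt_min x0 subr_gt0.
move=> y; rewrite lt_min !ltr_distl => /andP[/andP[h1 h2] /andP[h3 h4]] /=.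
by rewrite in_itv/=; lra.
Qed.

Lemma is_derive_eqnear f g (x l d : R) : 0 < d -> (forall y, `|y - x| < d -> f y = g y) ->
  is_derive x 1 f l -> is_derive x 1 g l.
Proof.
move=> d0 fg /is_deriveP/deriv_withinP h; apply/is_deriveP/deriv_withinP => e /h[d' d'0 dH].
exists (Num.min d d') => [|y _ yx]; first by rewrite lt_min d0.
rewrite lt_min => /andP[h1 h2]; rewrite -!fg//; first exact: dH.
by rewrite subrr normr0.
Qed.

Lemma is_derive_unique f (x l m : R) : is_derive x 1 f l -> is_derive x 1 f m -> l = m.
Proof. by move=> [_ <-] [_ <-]. Qed.

(** [derive1n 2] iterates the two-sided derivative, while [C2_01] speaks of derivatives relative to
    [[0, 1]]. The two notions agree on a neighbourhood of each interior point, which is enough to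
    differentiate once more. *)
Lemma C2_01_derive1n (f : R -> R) : C2_01 f -> exists f1 f2 : R -> R,
  [/\ {within `[0, 1], continuous f}, {within `[0, 1], continuous f1},
      {within `[0, 1], continuous f2} &
      forall x : R, 0 < x < 1 ->
      [/\ is_derive x 1 f (f1 x), is_derive x 1 f1 (f2 x) & derive1n 2 f x = f2 x]].
Proof.
move=> [f1 [f2 [d1 d2 c2]]]; exists f1, f2.
have [c0 i1] := deriv_within_seg d1; have [c1 i2] := deriv_within_seg d2.
split=> // x x01; split; [exact: i1|exact: i2|].
have /andP[x0 x1] := x01.
have E : is_derive x 1 (derive1 f) (f2 x).
  apply: (is_derive_eqnear (f := f1) (d := Num.min x (1 - x))); last exact: i2.
    by rewrite lt_min x0 subr_gt0.
  move=> y; rewrite lt_min !ltr_distl => /andP[/andP[h1 h2] /andP[h3 h4]].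
  have y01 : 0 < y < 1 by lra.
  by rewrite derive1E; have [_ ->] := i1 _ y01.
by rewrite /= derive1E; case: E.
Qed.

End eps.

(** * Sine modes of square-integrable profiles *)

Section modes.
Context {R : realType}.
Notation leb := (@lebesgue_measure R).
Notation TR := (measurableTypeR R).
Implicit Types (f g s : R -> R).

(** Profiles are controlled on []0, 1[] only, whereas modes and the feedback integrate over
    [[0, 1]]. This lemma and the next ones pass from one to the other, the end points being
    negligible. *)
Lemma integrable_oo_cc f (a b : R) : leb.-integrable `]a, b[ (EFin \o f) ->
  leb.-integrable `[a, b] (EFin \o f).
Proof.
move=> /integrableP[mf fi]; apply/integrableP; split.
  exact: emeasurable_fun_itv_cc mf.
rewrite integral_itv_bndoo//.
by apply: measurableT_comp.
Qed.

Lemma Rintegral_oo_cc f (a b : R) : leb.-integrable `]a, b[ (EFin \o f) ->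
  \int[leb]_(x in `[a, b]) f x = \int[leb]_(x in `]a, b[) f x.
Proof. by move=> /integrableP[mf _]; rewrite /Rintegral integral_itv_bndoo. Qed.

Lemma integrable_eq_oo f g (a b : R) : (forall x, a < x < b -> f x = g x) ->
  leb.-integrable `[a, b] (EFin \o f) -> leb.-integrable `[a, b] (EFin \o g).
Proof.
move=> fg fi; apply: integrable_oo_cc.
have {}fi : leb.-integrable `]a, b[ (EFin \o f).
  by apply: integrableS fi => //; exact: subset_itv_oo_cc.
apply: eq_integrable fi => // x; rewrite inE/= in_itv/= => xab.
by rewrite fg.
Qed.

Lemma Rintegral_eq_oo f g (a b : R) : (forall x, a < x < b -> f x = g x) ->
  leb.-integrable `[a, b] (EFin \o f) ->
  \int[leb]_(x in `[a, b]) f x = \int[leb]_(x in `[a, b]) g x.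
Proof.
move=> fg fi; have gi := integrable_eq_oo fg fi.
have S (h : R -> R) : leb.-integrable `[a, b] (EFin \o h) -> leb.-integrable `]a, b[ (EFin \o h).
  by apply: integrableS => //; exact: subset_itv_oo_cc.
rewrite !Rintegral_oo_cc; [|exact: S..].
by apply: eq_Rintegral => x; rewrite inE/= in_itv/=; exact: fg.
Qed.

Lemma inL2_mul s f : {within `[0, 1], continuous s} -> inL2 f ->
  leb.-integrable `[0, 1] (EFin \o (fun x => s x * f x)).
Proof.
move=> cs hf; apply: integrable_oo_cc.
have := Lfun2_mul_Lfun1 (inL2_wcont cs) hf.
move=> /Lfun1_integrable h; apply/integrable_mkcond => //.
apply: eq_integrable h => // x _ /=.
by rewrite !patchE; case: ifP => //=; rewrite mul0r.
Qed.

Lemma inL2_mul_le s f (C : R) : {within `[0, 1], continuous s} -> inL2 f ->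
  (forall x, 0 < x < 1 -> `|s x| <= C) ->
  `|\int[leb]_(x in `[0, 1]) (s x * f x)| <= C * L2norm f.
Proof.
move=> cs hf sC; have sfi := inL2_mul cs hf.
have C0 : 0 <= C by apply: le_trans (sC (2^-1) _); rewrite ?normr_ge0//; lra.
have sfi' : leb.-integrable `]0, 1[ (EFin \o (fun x => s x * f x)).
  by apply: integrableS sfi => //; exact: subset_itv_oo_cc.
have [fi fle] := inL2_L1 hf.
rewrite Rintegral_oo_cc// (le_trans (le_normr_Rintegral _ sfi'))//.
apply: le_trans (_ : \int[leb]_(x in `]0, 1[) (C * `|f x|) <= _).
  apply: le_Rintegral => //.
  - exact: (integrable_norm sfi').
  - by apply: integrable_mulr => //; exact: (integrable_norm fi).
  - by move=> x /=; rewrite in_itv/= => x01; rewrite normrM ler_wpM2r// sC.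
by rewrite RintegralZl//; [exact: ler_wpM2l|exact: (integrable_norm fi)].
Qed.

Lemma inL2_mul_eq s f g : {within `[0, 1], continuous s} -> inL2 f -> inL2 g -> eqL2 f g ->
  \int[leb]_(x in `[0, 1]) (s x * f x) = \int[leb]_(x in `[0, 1]) (s x * g x).
Proof.
move=> cs hf hg fg; have [C C0 sC] := wcont_bounded ler01 cs.
apply/eqP; rewrite -subr_eq0 -RintegralB//; [|exact: inL2_mul..].
have -> : \int[leb]_(x in `[0, 1]) (s x * f x - s x * g x) =
          \int[leb]_(x in `[0, 1]) (s x * (f \- g) x).
  by apply: eq_Rintegral => x _; rewrite -mulrBr.
rewrite -normr_eq0 eq_le normr_ge0 andbT.
have hfg := inL2B hf hg.
have := @inL2_mul_le s (f \- g) C cs hfg.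
rewrite (_ : L2norm (f \- g) = 0); first by rewrite mulr0; apply => x /andP[? ?]; rewrite sC// !ltW.
rewrite -(L2norm_cst0 (R := R)); apply: eqL2_L2norm => //; first exact: inL20.
by apply: (eqL2_trans (eqL2B fg (eqL2_refl g))); apply: eqL2_in => x _ /=; rewrite subrr.
Qed.

Lemma wcont_sin_mode (n : nat) : {within `[0, 1], continuous (fun x : R => sin (n%:R * pi * x))}.
Proof. exact: wcont_sin_lin. Qed.

Lemma sin_mode_le n f : inL2 f -> `|sin_mode n f| <= L2norm f.
Proof.
move=> hf; rewrite -[leRHS]mul1r; apply: inL2_mul_le => //; first exact: wcont_sin_mode.
by move=> x _; rewrite ler_norml sin_geN1 sin_le1.
Qed.

Lemma sin_modeB n f g : inL2 f -> inL2 g -> sin_mode n (f \- g) = sin_mode n f - sin_mode n g.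
Proof.
move=> hf hg; rewrite /sin_mode -RintegralB//; [|by apply: inL2_mul => //; exact: wcont_sin_mode..].
by apply: eq_Rintegral => x _; rewrite mulrBr.
Qed.

Lemma sin_modeD n f g : inL2 f -> inL2 g ->
  sin_mode n (fun x => f x + g x) = sin_mode n f + sin_mode n g.
Proof.
move=> hf hg; rewrite /sin_mode -RintegralD//; [|by apply: inL2_mul => //; exact: wcont_sin_mode..].
by apply: eq_Rintegral => x _; rewrite mulrDr.
Qed.

Lemma sin_modeZ n (c : R) f : inL2 f -> sin_mode n (fun x => c * f x) = c * sin_mode n f.
Proof.
move=> hf; rewrite /sin_mode -RintegralZl//; last by apply: inL2_mul => //; exact: wcont_sin_mode.
by apply: eq_Rintegral => x _; rewrite mulrCA.
Qed.

Lemma sin_mode_eqL2 n f g : inL2 f -> inL2 g -> eqL2 f g -> sin_mode n f = sin_mode n g.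
Proof. by move=> hf hg fg; apply: inL2_mul_eq => //; exact: wcont_sin_mode. Qed.

Lemma sin_mode_sum (I : finType) n (h : I -> R -> R) : (forall i, inL2 (h i)) ->
  sin_mode n (fun x => \sum_i h i x) = \sum_i sin_mode n (h i).
Proof.
move=> H; suff : forall r : seq I, inL2 (fun x => \sum_(i <- r) h i x) /\
  sin_mode n (fun x => \sum_(i <- r) h i x) = \sum_(i <- r) sin_mode n (h i) by move=> /(_ (index_enum I))[].
elim=> [|i r [IH1 IH2]].
  under eq_fun do rewrite big_nil; split; first exact: inL20.
  rewrite big_nil /sin_mode; under eq_Rintegral do rewrite mulr0.
  by rewrite Rintegral_cst// mul0r.
under eq_fun do rewrite big_cons; split; first exact: inL2D.
by rewrite big_cons sin_modeD// IH2.
Qed.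

Lemma feedback_modes (N : R -> nat) (kc : forall th, 'rV[R]_(N th)) th w : inL2 w ->
  feedback (nominal_kernel kc) th w =
  \sum_(i < N th) kc th 0 i * Num.sqrt 2 * sin_mode i.+1 w.
Proof.
move=> hw; rewrite /feedback /nominal_kernel.
pose h (i : 'I_(N th)) (x : R) := kc th 0 i * phi i.+1 x.
transitivity (\int[leb]_(x in `[0, 1]) \sum_i (kc th 0 i * Num.sqrt 2 * (sin (i.+1%:R * pi * x) * w x))).
  apply: eq_Rintegral => x _; rewrite mulr_suml; apply: eq_bigr => i _.
  by rewrite /phi !mulrA.
suff : forall r : seq 'I_(N th),
  leb.-integrable `[0, 1] (EFin \o (fun x => \sum_(i <- r) (kc th 0 i * Num.sqrt 2 * (sin (i.+1%:R * pi * x) * w x)))) /\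
  \int[leb]_(x in `[0, 1]) \sum_(i <- r) (kc th 0 i * Num.sqrt 2 * (sin (i.+1%:R * pi * x) * w x)) =
  \sum_(i <- r) kc th 0 i * Num.sqrt 2 * sin_mode i.+1 w by move=> /(_ (index_enum _))[].
elim=> [|i r [IH1 IH2]].
  split; last by under eq_Rintegral do rewrite big_nil; rewrite Rintegral_cst// mul0r big_nil.
  have := integrable_seg (@wcont_cst R R (`[0, 1]%classic : set R) 0).
  by apply: eq_integrable => // x _ /=; rewrite big_nil.
have hi : leb.-integrable `[0, 1] (EFin \o (fun x => kc th 0 i * Num.sqrt 2 * (sin (i.+1%:R * pi * x) * w x))).
  by apply: integrable_mulr => //; apply: inL2_mul => //; exact: wcont_sin_mode.
split.
  have mI : measurable (`[0, 1]%classic : set TR) by exact: measurable_itv.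
  have := integrable_addr _ _ mI hi IH1.
  by apply: eq_integrable => // x _ /=; rewrite big_cons.
under eq_Rintegral do rewrite big_cons.
rewrite RintegralD// IH2 big_cons RintegralZl//.
by apply: inL2_mul => //; exact: wcont_sin_mode.
Qed.

Lemma C0_L2_sin_mode (J : set R) (u : R -> R -> R) n : C0_L2 J u ->
  {within J, continuous (fun t => sin_mode n (u t))}.
Proof.
move=> [uL uc]; apply/wcontP => t Jt; apply/cvg_withinP => e e0.
have /cvg_withinP/(_ e e0)[d d0 dH] := uc t Jt.
exists d => // s Js sd; rewrite -sin_modeB; [|exact: uL..].
rewrite (le_lt_trans (sin_mode_le _ _))//; first by apply: inL2B; exact: uL.
by have := dH s Js sd; rewrite subr0 ger0_norm ?L2norm_ge0.
Qed.

Lemma C0_L2_L2norm (J : set R) (u : R -> R -> R) : C0_L2 J u ->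
  {within J, continuous (fun t => L2norm (u t))}.
Proof.
move=> [uL uc]; apply/wcontP => t Jt; apply/cvg_withinP => e e0.
have /cvg_withinP/(_ e e0)[d d0 dH] := uc t Jt.
exists d => // s Js sd; rewrite (le_lt_trans (L2norm_dist _ _))//; [exact: uL..|].
by have := dH s Js sd; rewrite subr0 ger0_norm ?L2norm_ge0.
Qed.

(* sin(nx) f' - n cos(nx) f is a primitive of sin(nx) f'' + n^2 sin(nx) f *)
Lemma sin_mode_green n f (f1 f2 : R -> R) :
  {within `[0, 1], continuous f} -> {within `[0, 1], continuous f1} ->
  {within `[0, 1], continuous f2} ->
  (forall x : R, 0 < x < 1 -> is_derive x 1 f (f1 x)) ->
  (forall x : R, 0 < x < 1 -> is_derive x 1 f1 (f2 x)) ->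
  \int[leb]_(x in `[0, 1]) (sin (n%:R * pi * x) * f2 x) =
  - (n%:R * pi) ^+ 2 * sin_mode n f - n%:R * pi * ((-1) ^+ n * f 1 - f 0).
Proof.
move=> c0 c1 c2 d1 d2; set m : R := n%:R * pi.
pose F (x : R) := sin (m * x) * f1 x - m * (cos (m * x) * f x).
pose F' (x : R) := sin (m * x) * f2 x + m ^+ 2 * (sin (m * x) * f x).
have cs : {within `[0, 1], continuous (fun x : R => sin (m * x))} by exact: wcont_sin_lin.
have cc : {within `[0, 1], continuous (fun x : R => cos (m * x))} by exact: wcont_cos_lin.
have := @Rintegral_FTC R F F' 0 1 ler01.
have -> : F 1 - F 0 = - m * ((-1) ^+ n * f 1 - f 0).
  by rewrite /F !mulr1 !mulr0 sin_natpi cos_natpi sin0 cos0; ring.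
have -> : \int[leb]_(x in `[0, 1]) F' x =
    \int[leb]_(x in `[0, 1]) (sin (m * x) * f2 x) + m ^+ 2 * sin_mode n f.
  rewrite /F' RintegralD//.
  - by rewrite RintegralZl//; apply: integrable_seg; exact: wcontM.
  - by apply: integrable_seg; exact: wcontM.
  - by apply: integrable_seg; apply: wcontZ; exact: wcontM.
move=> H.
suff H' : \int[leb]_(x in `[0, 1]) (sin (m * x) * f2 x) + m ^+ 2 * sin_mode n f =
    - m * ((-1) ^+ n * f 1 - f 0).
  by rewrite -(addrK (m ^+ 2 * sin_mode n f) (Rintegral _ _ _)) H'; ring.
apply: H.
- apply: wcontB; first exact: wcontM.
  by apply: wcontZ; exact: wcontM.
- apply: wcontD; first exact: wcontM.
  by apply: wcontZ; exact: wcontM.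
- move=> x x01; have h1 := is_deriveMx (is_derive_sin_lin m x) (d2 x x01).
  have h2 := is_deriveMx (is_derive_cos_lin m x) (d1 x x01).
  apply: (is_derive_eq (is_deriveBx h1 (is_deriveZx m h2))).
  by rewrite /F'; ring.
Qed.

End modes.

(** * The differential equation of a sine mode *)

Section mode_ode.
Context {R : realType}.
Notation leb := (@lebesgue_measure R).
Notation TR := (measurableTypeR R).
Implicit Types (s x : R).

Lemma wcont_compact_bounded (A : set (R * R)) (h : R * R -> R) : compact A ->
  {within A, continuous h} -> exists2 C, 0 <= C & forall z, A z -> `|h z| <= C.
Proof.
move=> cA ch; have /compact_bounded[M [_ MH]] := continuous_compact ch cA.
exists (`|M| + 1) => [|z Az]; first by rewrite addr_ge0.
have MM : M < `|M| + 1 by rewrite (le_lt_trans (ler_norm _))// ltrDl.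
by apply: (MH _ MM); exists z.
Qed.

(** Differentiation under the integral sign, then the plant equation and [sin_mode_green]; the
    boundary value at 1 survives as the forcing term. The equation holds on []0, 1[] only, so the
    integrand is replaced off the end points. *)
Lemma sin_mode_derive (J : set R) p theta (u : R -> R -> R) (t d : R) n : 0 < d ->
  (forall s, `|s - t| < d -> J s) -> C1_on J u -> C2_01 (u t) ->
  (forall x, 0 < x < 1 -> pde_at p theta u t x) -> u t 0 = 0 ->
  is_derive t 1 (fun s => sin_mode n (u s))
    ((theta - p * (n%:R * pi) ^+ 2) * sin_mode n (u t) - (-1) ^+ n * p * (n%:R * pi) * u t 1).
Proof.
move=> d0 dJ [ut [ux [du cu cut _]]] /C2_01_derive1n[f1 [f2 [c0 c1 c2 d12]]] pde u0.
set m : R := n%:R * pi.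
have cs : {within `[0, 1], continuous (fun x : R => sin (m * x))} by exact: wcont_sin_lin.
have Jt : J t by apply: dJ; rewrite subrr normr0.
have dus s x : `|s - t| < d -> x \in `[0, 1] -> is_derive s 1 (fun r => u r x) (ut s x).
  move=> sd xI; apply: (deriv_within_is_derive (e := d - `|s - t|) (A := J)).
  - by rewrite subr_gt0.
  - move=> y yd; apply: dJ; rewrite -(subrK s y) -addrA.
    by rewrite (le_lt_trans (ler_normD _ _))// -ltrBrDr.
  - exact: (du s x (dJ _ sd) xI).1.
have cus s : J s -> {within `[0, 1], continuous (u s)}.
  by move=> Js; apply: (deriv_within_wcont (f1 := ux s)) => x xI; exact: (du s x Js xI).2.
(* A compact slab on which [ut] is bounded; the bound is the dominating function for the time
   derivative. Half of [d] keeps the closed slab inside [J]. *)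
pose A : set (R * R) := `[t - d / 2, t + d / 2]%classic `*` `[0, 1]%classic.
have AJ : A `<=` J `*` `[0, 1].
  move=> [s x] [/= sI xI]; split => //=; apply: dJ.
  move: sI; rewrite in_itv/= => /andP[h1 h2].
  by rewrite ltr_distl; apply/andP; split; lra.
have [C C0 CH] : exists2 C, 0 <= C & forall z, A z -> `|ut z.1 z.2| <= C.
  apply: wcont_compact_bounded; first by apply: compact_setX; exact: segment_compact.
  exact: (continuous_subspaceW AJ).
pose f s x := sin (m * x) * u s x.
have df s x : `|s - t| < d -> x \in `[0, 1] -> is_derive s 1 (f ^~ x) (sin (m * x) * ut s x).
  by move=> sd xI; apply: is_deriveZx; exact: dus.
pose a := t - d / 2; pose b := t + d / 2.
have Iab : (`]a, b[%classic : set R) t by rewrite /= in_itv/= /a /b; lra.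
have near (s : R) : (`]a, b[%classic : set R) s -> `|s - t| < d.
  by rewrite /= in_itv/= /a /b => /andP[h1 h2]; rewrite ltr_distl; apply/andP; split; lra.
have mB : measurable (`[0, 1]%classic : set TR) by exact: measurable_itv.
have intf s : (`]a, b[%classic : set R) s -> leb.-integrable `[0, 1] (EFin \o f s).
  by move=> /near/dJ/cus cs'; apply: integrable_seg; exact: wcontM.
have derf (s : R) x : (`]a, b[%classic : set R) s -> (`[0, 1]%classic : set TR) x -> derivable (f ^~ x) s 1.
  by move=> /near sd xI; have [] := df s x sd xI.
have iC : leb.-integrable `[0, 1] (EFin \o (fun=> C)).
  by apply: integrable_seg; exact: wcont_cst.
have Gub (s : R) x : (`]a, b[%classic : set R) s -> (`[0, 1]%classic : set TR) x -> `|partial1of2 f s x| <= C.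
  move=> sI xI; rewrite partial1of2E; have sd := near _ sI.
  have [_ ->] := df s x sd xI.
  rewrite normrM -[leRHS]mul1r ler_pM//; first by rewrite ler_norml sin_geN1 sin_le1.
  by apply: (CH (s, x)); split => //; apply: subset_itv_oo_cc.
have der := @derivable_under_integral R _ TR leb f _ mB t a b Iab intf derf (fun=> C) (fun=> C0) iC Gub.
have val := @differentiation_under_integral R _ TR leb f _ mB t a b Iab intf derf (fun=> C) (fun=> C0) iC Gub.
apply: DeriveDef; first exact: der.
rewrite -derive1E val.
have E x : 0 < x < 1 -> partial1of2 f t x = p * (sin (m * x) * f2 x) + theta * (sin (m * x) * u t x).
  move=> x01; have xI : x \in `[0, 1] by rewrite in_itv/=; lra.
  rewrite partial1of2E; have sd : `|t - t| < d by rewrite subrr normr0.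
  have [_ ->] := df t x sd xI.
  have := pde x x01; rewrite /pde_at derive1E.
  have [_ ->] := dus t x sd xI; have [_ _ ->] := d12 x x01.
  by move=> ->; ring.
have i2 : leb.-integrable `[0, 1] (EFin \o (fun x => sin (m * x) * f2 x)).
  by apply: integrable_seg; exact: wcontM.
have i0 : leb.-integrable `[0, 1] (EFin \o (fun x => sin (m * x) * u t x)).
  by apply: integrable_seg; apply: wcontM => //; exact: cus.
transitivity (\int[leb]_(x in `[0, 1]) (p * (sin (m * x) * f2 x) + theta * (sin (m * x) * u t x))).
  apply/esym/Rintegral_eq_oo => [x x01|]; first by rewrite E.
  by apply: integrable_addr => //; exact: integrable_mulr.
rewrite RintegralD//; [|exact: integrable_mulr..].
have d1 x : 0 < x < 1 -> is_derive x 1 (u t) (f1 x) by move=> /d12[].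
have d2 x : 0 < x < 1 -> is_derive x 1 f1 (f2 x) by move=> /d12[].
rewrite !RintegralZl// (sin_mode_green n c0 c1 c2 d1 d2) u0.
rewrite /sin_mode -/m; ring.
Qed.

End mode_ode.

(** * The plant with a prescribed boundary value *)

Section plant.
Context {R : realType}.
Notation leb := (@lebesgue_measure R).
Implicit Types (s t x : R) (u v : R -> R -> R) (J : set R) (f g b : R -> R).

Lemma wcont_compP (T T' : topologicalType) (A : set T) (A' : set T') (h : T -> R) (ph : T' -> T) :
  continuous ph -> (forall z, A' z -> A (ph z)) ->
  {within A, continuous h} -> {within A', continuous (h \o ph)}.
Proof.
move=> cph AA /subspace_continuousP ch; apply/subspace_continuousP => z A'z.
apply: (cvg_comp _ _ _ (ch _ (AA _ A'z))) => P; rewrite /within/= => hP.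
have h1 : nbhs z (ph @^-1` (fun y => A y -> P y)) := cph z _ hP.
suff : nbhs z (fun w => A' w -> P (ph w)) by [].
by apply: filterS h1 => w hw A'w; exact: hw (AA _ A'w).
Qed.

Lemma deriv_within_sub (A B : set R) f x (l : R) : A `<=` B -> deriv_within B f x l ->
  deriv_within A f x l.
Proof.
move=> AB /deriv_withinP h; apply/deriv_withinP => e /h[d d0 dH].
by exists d => // y /AB; exact: dH.
Qed.

Lemma deriv_withinD (A : set R) f g x (l m : R) : deriv_within A f x l -> deriv_within A g x m ->
  deriv_within A (fun y => f y + g y) x (l + m).
Proof.
move=> hf hg; rewrite /deriv_within.
suff -> : (fun y => (f y + g y - (f x + g x)) / (y - x)) =
    (fun y => (f y - f x) / (y - x) + (g y - g x) / (y - x)) by exact: (cvgD hf hg).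
by apply/funext => y; rewrite -mulrDl; congr (_ / _); ring.
Qed.

Lemma deriv_withinM (A : set R) f g x (l m : R) : deriv_within A f x l -> deriv_within A g x m ->
  deriv_within A (fun y => f y * g y) x (l * g x + f x * m).
Proof.
move=> hf hg.
have gc : g y @[y --> within A x^'] --> g x.
  apply: cvg_trans (deriv_within_cvg hg) => P; rewrite /nbhs/= /within/= => hP.
  move/nbhs_ballP : hP => [d d0 dH]; apply/nbhs_ballP; exists d => // y yd _.
  exact: dH.
rewrite /deriv_within.
suff -> : (fun y => (f y * g y - f x * g x) / (y - x)) =
    (fun y => (f y - f x) / (y - x) * g y + f x * ((g y - g x) / (y - x))).
  by apply: cvgD; apply: cvgM => //; exact: cvg_cst.
by apply/funext => y; rewrite mulrAC mulrA -mulrDl; congr (_ / _); ring.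
Qed.

Lemma deriv_within_shift (A : set R) f x (c l : R) : deriv_within A f (x - c) l ->
  deriv_within [set y | A (y - c)] (fun y => f (y - c)) x l.
Proof.
move=> /deriv_withinP h; apply/deriv_withinP => e /h[d d0 dH].
exists d => // y Ay yx yd; have E : y - c - (x - c) = y - x by ring.
by have := dH (y - c) Ay; rewrite E; apply => //; rewrite -subr_eq0 E subr_eq0.
Qed.

Lemma C0_L2_sub J J' u : J' `<=` J -> C0_L2 J u -> C0_L2 J' u.
Proof.
move=> JJ [h1 h2]; split=> [t /JJ|t J't]; first exact: h1.
have /cvg_withinP h := h2 t (JJ _ J't); apply/cvg_withinP => e /h[d d0 dH].
by exists d => // y /JJ; exact: dH.
Qed.

Lemma C1_on_sub J J' u : J' `<=` J -> C1_on J u -> C1_on J' u.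
Proof.
move=> JJ [ut [ux [h1 h2 h3 h4]]]; exists ut, ux.
have S : J' `*` (`[0, 1]%classic : set R) `<=` J `*` (`[0, 1]%classic : set R).
  by move=> [r x] [hr hx]; split => //; exact: (JJ _ hr).
split; [|exact: (continuous_subspaceW S)..].
by move=> t x J't xI; have [a b] := h1 t x (JJ _ J't) xI; split=> //; exact: deriv_within_sub a.
Qed.

Lemma C0_L2P J u : C0_L2 J u <-> (forall t, J t -> inL2 (u t)) /\
  (forall t, J t -> forall e, 0 < e -> exists2 d, 0 < d &
     forall s, J s -> `|s - t| < d -> L2norm (u s \- u t) < e).
Proof.
split=> [[h1 h2]|[h1 h2]]; split=> // t Jt.
  move=> e e0; have /cvg_withinP/(_ e e0)[d d0 dH] := h2 t Jt; exists d => // s Js sd.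
  by have := dH s Js sd; rewrite subr0 ger0_norm ?L2norm_ge0.
apply/cvg_withinP => e /(h2 t Jt)[d d0 dH]; exists d => // s Js sd.
by rewrite subr0 ger0_norm ?L2norm_ge0 ?dH.
Qed.

Lemma C0_L2D J u v : C0_L2 J u -> C0_L2 J v -> C0_L2 J (fun t x => u t x + v t x).
Proof.
move=> /C0_L2P[u1 u2] /C0_L2P[v1 v2]; apply/C0_L2P; split=> [t Jt|t Jt e e0].
  by apply: inL2D; [exact: u1|exact: v1].
have [d d0 dH] := u2 t Jt (e / 2) (divr_gt0 e0 (ltr0Sn _ 1)).
have [d' d'0 dH'] := v2 t Jt (e / 2) (divr_gt0 e0 (ltr0Sn _ 1)).
exists (Num.min d d') => [|s Js]; first by rewrite lt_min d0.
rewrite lt_min => /andP[sd sd'].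
have -> : (fun x => u s x + v s x) \- (fun x => u t x + v t x) =
    (fun x => (u s \- u t) x + (v s \- v t) x) by apply/funext => x /=; ring.
rewrite (le_lt_trans (L2normD _ _))//; [by apply: inL2B; exact: u1|by apply: inL2B; exact: v1|].
by have := dH s Js sd; have := dH' s Js sd'; lra.
Qed.

Lemma C0_L2_scale J u f : {within J, continuous f} -> C0_L2 J u ->
  C0_L2 J (fun t x => f t * u t x).
Proof.
move=> /wcontP cf /[dup] uC0 /C0_L2P[u1 u2]; apply/C0_L2P; split=> [t Jt|t Jt e e0].
  by apply: inL2Z; exact: u1.
(* The increment is [f s (u s - u t) + (f s - f t) u t]. With [e1 <= 1] one has
   [|f s| <= |f t| + 1], so both terms together are at most [e1 * C <= e / 2]. *)
pose C := 1 + `|f t| + L2norm (u t).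
have C0 : 0 < C by rewrite /C; have := normr_ge0 (f t); have := L2norm_ge0 (u t); lra.
pose e1 := Num.min 1 (e / (2 * C)).
have e10 : 0 < e1 by rewrite lt_min ltr01 divr_gt0// mulr_gt0.
have e1C : e1 * C <= e / 2.
  have : e1 <= e / (2 * C) by rewrite ge_min lexx orbT.
  by rewrite ler_pdivlMr ?mulr_gt0//; lra.
have e11 : e1 <= 1 by rewrite ge_min lexx.
have /cvg_withinP/(_ e1 e10)[d d0 dH] := cf t Jt.
have [d' d'0 dH'] := u2 t Jt e1 e10.
exists (Num.min d d') => [|s Js]; first by rewrite lt_min d0.
rewrite lt_min => /andP[sd sd'].
have h1 := dH s Js sd; have h2 := dH' s Js sd'.
have -> : (fun x => f s * u s x) \- (fun x => f t * u t x) =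
    (fun x => f s * (u s \- u t) x + (f s - f t) * u t x) by apply/funext => x /=; ring.
have iB : inL2 (u s \- u t) by apply: inL2B; exact: u1.
rewrite (le_lt_trans (L2normD _ _))//; [exact: inL2Z|by apply: inL2Z; exact: u1|].
rewrite !L2normZ//; last exact: u1.
have fs : `|f s| <= `|f t| + 1.
  rewrite -(subrK (f t) (f s)) (le_trans (ler_normD _ _))// addrC lerD2l.
  by rewrite (le_trans (ltW h1)).
have p1 : `|f s| * L2norm (u s \- u t) <= (`|f t| + 1) * e1.
  by rewrite ler_pM ?L2norm_ge0// ltW.
have p2 : `|f s - f t| * L2norm (u t) <= e1 * L2norm (u t).
  by rewrite ler_wpM2r ?L2norm_ge0// ltW.
rewrite /C in e1C; lra.
Qed.

Lemma C0_L2_shift J u (c : R) : C0_L2 J u -> C0_L2 [set t | J (t - c)] (fun t => u (t - c)).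
Proof.
move=> /C0_L2P[u1 u2]; apply/C0_L2P; split=> [t Jt|t Jt e e0]; first exact: u1.
have [d d0 dH] := u2 _ Jt e e0; exists d => // s Js sd; apply: dH => //.
by rewrite (_ : s - c - (t - c) = s - t)//; ring.
Qed.

Lemma C1_onD J u v : C1_on J u -> C1_on J v -> C1_on J (fun t x => u t x + v t x).
Proof.
move=> [ut [ux [h1 h2 h3 h4]]] [vt [vx [k1 k2 k3 k4]]].
exists (fun t x => ut t x + vt t x), (fun t x => ux t x + vx t x).
split; [|exact: wcontD..] => t x Jt xI.
have [a b] := h1 t x Jt xI; have [a' b'] := k1 t x Jt xI.
by split; exact: deriv_withinD.
Qed.

Lemma wcont_fst J (B : set R) f : {within J, continuous f} ->
  {within J `*` B, continuous (fun z : R * R => f z.1)}.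
Proof.
move=> cf; apply: (@wcont_compP _ _ J _ f (fun z : R * R => z.1)) => //; last by move=> z [].
by move=> z; exact: cvg_fst.
Qed.

Lemma C1_on_scale J u f f1 : (forall t, J t -> is_derive t 1 f (f1 t)) ->
  {within J, continuous f1} -> C1_on J u -> C1_on J (fun t x => f t * u t x).
Proof.
move=> df cf1 [ut [ux [h1 h2 h3 h4]]].
have cf : {within J, continuous f}.
  by apply: (deriv_within_wcont (f1 := f1)) => t /df; exact: is_derive_deriv_within.
have cf2 := @wcont_fst J (`[0, 1]%classic : set R) _ cf.
have cf12 := @wcont_fst J (`[0, 1]%classic : set R) _ cf1.
exists (fun t x => f1 t * u t x + f t * ut t x), (fun t x => f t * ux t x).
split; [|exact: wcontM|apply: wcontD; exact: wcontM|exact: wcontM].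
move=> t x Jt xI; have [a b] := h1 t x Jt xI; split.
  by apply: deriv_withinM => //; apply: is_derive_deriv_within; exact: df.
have := deriv_withinM (is_derive_deriv_within `[0, 1]%classic (is_derive_cst (f t) x 1)) b.
by rewrite mul0r add0r.
Qed.

Lemma C1_on_shift J u (c : R) : C1_on J u -> C1_on [set t | J (t - c)] (fun t => u (t - c)).
Proof.
move=> [ut [ux [h1 h2 h3 h4]]]; exists (fun t => ut (t - c)), (fun t => ux (t - c)).
pose ph (z : R * R) := (z.1 - c, z.2).
have cph : continuous ph.
  move=> z; have k1 : (z'.1 - c) @[z' --> z] --> z.1 - c by apply: cvgB; [exact: cvg_fst|exact: cvg_cst].
  have k2 : z'.2 @[z' --> z] --> z.2 by exact: cvg_snd.
  exact: (cvg_pair k1 k2).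
have H (w : R -> R -> R) : {within J `*` `[0, 1], continuous (fun z => w z.1 z.2)} ->
    {within [set t | J (t - c)] `*` `[0, 1], continuous (fun z => w (z.1 - c) z.2)}.
  by move=> cw; apply: (wcont_compP cph _ cw) => z [].
split; [|exact: H..] => t x Jt xI; have [a b] := h1 _ _ Jt xI; split=> //.
exact: (deriv_within_shift a).
Qed.

Lemma C2_01D f g : C2_01 f -> C2_01 g -> C2_01 (fun x => f x + g x).
Proof.
move=> [f1 [f2 [a1 a2 a3]]] [g1 [g2 [b1 b2 b3]]].
exists (fun x => f1 x + g1 x), (fun x => f2 x + g2 x); split; last exact: wcontD.
- by move=> x xI; apply: deriv_withinD; [exact: a1|exact: b1].
- by move=> x xI; apply: deriv_withinD; [exact: a2|exact: b2].
Qed.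

Lemma deriv_withinZ (A : set R) f x (c l : R) : deriv_within A f x l ->
  deriv_within A (fun y => c * f y) x (c * l).
Proof.
move=> h; have := deriv_withinM (is_derive_deriv_within A (is_derive_cst c x 1)) h.
by rewrite mul0r add0r.
Qed.

Lemma C2_01Z (c : R) f : C2_01 f -> C2_01 (fun x => c * f x).
Proof.
move=> [f1 [f2 [a1 a2 a3]]].
exists (fun x => c * f1 x), (fun x => c * f2 x); split; last exact: wcontZ.
- by move=> x xI; apply: deriv_withinZ; exact: a1.
- by move=> x xI; apply: deriv_withinZ; exact: a2.
Qed.

Lemma C2_01_wcont f : C2_01 f -> {within `[0, 1], continuous f}.
Proof. by move=> [f1 [f2 [a1 _ _]]]; have [] := deriv_within_seg a1. Qed.

Lemma pde_atP p theta u t x (l m : R) : is_derive t 1 (fun s => u s x) l ->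
  derive1n 2 (u t) x = m -> pde_at p theta u t x <-> l = p * m + theta * u t x.
Proof. by move=> [_ h] hm; rewrite /pde_at derive1E h hm. Qed.

Lemma C2_01_derive2D f g x : C2_01 f -> C2_01 g -> 0 < x < 1 ->
  derive1n 2 (fun x => f x + g x) x = derive1n 2 f x + derive1n 2 g x.
Proof.
move=> hf hg x01.
have [f1 [f2 [_ _ _ Hf]]] := C2_01_derive1n hf.
have [g1 [g2 [_ _ _ Hg]]] := C2_01_derive1n hg.
have [h1 [h2 [_ _ _ Hh]]] := C2_01_derive1n (C2_01D hf hg).
have [_ a2 ->] := Hf x x01; have [_ b2 ->] := Hg x x01; have [_ c2 ->] := Hh x x01.
apply: (is_derive_unique c2).
have d0 : 0 < Num.min x (1 - x) by have /andP[? ?] := x01; rewrite lt_min subr_gt0; apply/andP.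
apply: (is_derive_eqnear d0 _ (is_deriveDx a2 b2)).
move=> y; rewrite lt_min !ltr_distl => /andP[/andP[k1 k2] /andP[k3 k4]].
have y01 : 0 < y < 1 by lra.
have [a1 _ _] := Hf y y01; have [b1 _ _] := Hg y y01; have [c1 _ _] := Hh y y01.
exact: (is_derive_unique (is_deriveDx a1 b1) c1).
Qed.

Lemma C2_01_derive2Z (c : R) f x : C2_01 f -> 0 < x < 1 ->
  derive1n 2 (fun x => c * f x) x = c * derive1n 2 f x.
Proof.
move=> hf x01.
have [f1 [f2 [_ _ _ Hf]]] := C2_01_derive1n hf.
have [h1 [h2 [_ _ _ Hh]]] := C2_01_derive1n (C2_01Z c hf).
have [_ a2 ->] := Hf x x01; have [_ c2 ->] := Hh x x01.
apply: (is_derive_unique c2).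
have d0 : 0 < Num.min x (1 - x) by have /andP[? ?] := x01; rewrite lt_min subr_gt0; apply/andP.
apply: (is_derive_eqnear d0 _ (is_deriveZx c a2)).
move=> y; rewrite lt_min !ltr_distl => /andP[/andP[k1 k2] /andP[k3 k4]].
have y01 : 0 < y < 1 by lra.
have [a1 _ _] := Hf y y01; have [c1 _ _] := Hh y y01.
exact: (is_derive_unique (is_deriveZx c a1) c1).
Qed.

(** Openness in epsilon form: at points of such a [J], derivatives relative to [J] are ordinary
    two-sided ones. *)
Definition nbhd_set J := forall t, J t -> exists2 d, 0 < d & forall s, `|s - t| < d -> J s.

Lemma C1_on_is_derive J u t x : nbhd_set J -> C1_on J u -> J t -> 0 <= x <= 1 ->
  exists l, is_derive t 1 (fun s => u s x) l.
Proof.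
move=> nJ [ut [ux [h1 _ _ _]]] Jt x01; exists (ut t x).
have [d d0 dJ] := nJ t Jt.
have xI : x \in `[0, 1] by rewrite in_itv.
by apply: (deriv_within_is_derive d0 dJ); have [] := h1 t x Jt xI.
Qed.

(** The plant with boundary value [b t] at the right end point: [J0] carries the
    continuity in L^2(0,1), [J] the equation. *)
Record plant p theta J0 J b u : Prop := {
  pl_C0 : C0_L2 J0 u ;
  pl_C1 : C1_on J u ;
  pl_C2 : forall t, J t -> C2_01 (u t) ;
  pl_pde : forall t x, J t -> 0 < x < 1 -> pde_at p theta u t x ;
  pl_left : forall t, J t -> u t 0 = 0 ;
  pl_right : forall t, J t -> u t 1 = b t }.

Lemma plant_sub p theta J0 J J0' J' b u : J0' `<=` J0 -> J' `<=` J ->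
  plant p theta J0 J b u -> plant p theta J0' J' b u.
Proof.
move=> s0 s [h1 h2 h3 h4 h5 h6]; split.
- exact: C0_L2_sub h1.
- exact: C1_on_sub h2.
- by move=> t /s; exact: h3.
- by move=> t x /s; exact: h4.
- by move=> t /s; exact: h5.
- by move=> t /s; exact: h6.
Qed.

Lemma plant_eqb p theta J0 J b b' u : (forall t, J t -> b t = b' t) ->
  plant p theta J0 J b u -> plant p theta J0 J b' u.
Proof. by move=> bb [h1 h2 h3 h4 h5 h6]; split=> // t Jt; rewrite -bb//; exact: h6. Qed.

Lemma plantD p theta J0 J b b' u v : nbhd_set J ->
  plant p theta J0 J b u -> plant p theta J0 J b' v ->
  plant p theta J0 J (fun t => b t + b' t) (fun t x => u t x + v t x).
Proof.
move=> nJ [h1 h2 h3 h4 h5 h6] [k1 k2 k3 k4 k5 k6]; split.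
- exact: C0_L2D.
- exact: C1_onD.
- by move=> t Jt; apply: C2_01D; [exact: h3|exact: k3].
- move=> t x Jt x01; have xI : 0 <= x <= 1 by lra.
  have [l dl] := C1_on_is_derive nJ h2 Jt xI.
  have [m dm] := C1_on_is_derive nJ k2 Jt xI.
  apply/(pde_atP _ _ (is_deriveDx dl dm) (C2_01_derive2D (h3 _ Jt) (k3 _ Jt) x01)).
  have /(pde_atP _ _ dl erefl) -> := h4 t x Jt x01.
  have /(pde_atP _ _ dm erefl) -> := k4 t x Jt x01.
  by move: (derive1n 2 _ x) (derive1n 2 _ x) => A B; ring.
- by move=> t Jt; rewrite h5// k5// addr0.
- by move=> t Jt; rewrite h6// k6.
Qed.

(** The exponential factor adds [sg] to the reaction coefficient. This converts a nominal solution
    for one parameter into a solution of the plant with another. *)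
Lemma plant_exp p theta (sg : R) J0 J b u : nbhd_set J -> plant p theta J0 J b u ->
  plant p (theta + sg) J0 J (fun t => expR (sg * t) * b t) (fun t x => expR (sg * t) * u t x).
Proof.
move=> nJ [h1 h2 h3 h4 h5 h6].
have ce : continuous (fun t => expR (sg * t)).
  by move=> t; apply: is_derive_continuous; exact: is_derive_expR_lin.
split.
- by apply: C0_L2_scale => //; exact: wcont_continuous.
- apply: (C1_on_scale (f1 := fun t => sg * expR (sg * t))) => //.
    by move=> t _; exact: is_derive_expR_lin.
  by apply: wcontZ; exact: wcont_continuous.
- by move=> t Jt; apply: C2_01Z; exact: h3.
- move=> t x Jt x01; have xI : 0 <= x <= 1 by lra.
  have [l dl] := C1_on_is_derive nJ h2 Jt xI.
  apply/(pde_atP _ _ (is_deriveMx (is_derive_expR_lin sg t) dl) (C2_01_derive2Z _ (h3 _ Jt) x01)).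
  have /(pde_atP _ _ dl erefl) -> := h4 t x Jt x01.
  by move: (derive1n 2 _ x) => A; ring.
- by move=> t Jt; rewrite h5// mulr0.
- by move=> t Jt; rewrite h6.
Qed.

Lemma plant_shift p theta (c : R) J0 J b u : nbhd_set J -> plant p theta J0 J b u ->
  plant p theta [set t | J0 (t - c)] [set t | J (t - c)] (fun t => b (t - c)) (fun t => u (t - c)).
Proof.
move=> nJ [h1 h2 h3 h4 h5 h6]; split.
- exact: C0_L2_shift.
- exact: C1_on_shift.
- by move=> t; exact: h3.
- move=> t x Jt x01; have xI : 0 <= x <= 1 by lra.
  have [l dl] := C1_on_is_derive nJ h2 Jt xI.
  have dl' : is_derive t 1 (fun s => u (s - c) x) l.
    move/is_deriveP in dl; apply/is_deriveP.
    exact: (deriv_within_shift dl).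
  apply/(pde_atP _ _ dl' erefl).
  by have /(pde_atP _ _ dl erefl) -> := h4 _ x Jt x01.
- by move=> t; exact: h5.
- by move=> t; exact: h6.
Qed.

Lemma plant_sin_mode p theta J0 J b u t n : nbhd_set J -> plant p theta J0 J b u -> J t ->
  is_derive t 1 (fun s => sin_mode n (u s))
    ((theta - p * (n%:R * pi) ^+ 2) * sin_mode n (u t) - (-1) ^+ n * p * (n%:R * pi) * b t).
Proof.
move=> nJ [h1 h2 h3 h4 h5 h6] Jt; have [d d0 dJ] := nJ t Jt.
rewrite -h6//; apply: (sin_mode_derive _ d0 dJ h2 (h3 _ Jt)); last exact: h5.
by move=> x; exact: h4.
Qed.

Lemma nbhd_oo (a c : R) : nbhd_set [set t | a < t < c].
Proof.
move=> t /= /andP[at_ tc]; exists (Num.min (t - a) (c - t)); first by rewrite lt_min !subr_gt0 at_.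
by move=> s; rewrite lt_min !ltr_distl => /andP[/andP[? ?] /andP[? ?]]; lra.
Qed.

Lemma nbhd_gt (a : R) : nbhd_set [set t | a < t].
Proof.
move=> t /= at_; exists (t - a); first by rewrite subr_gt0.
by move=> s; rewrite ltr_distl => /andP[? ?]; lra.
Qed.

Lemma scalar_ode_unique (y z : R -> R) (c : R) g (a b' : R) :
  {within `[a, b'], continuous y} -> {within `[a, b'], continuous z} ->
  (forall x, a < x < b' -> is_derive x 1 y (c * y x + g x)) ->
  (forall x, a < x < b' -> is_derive x 1 z (c * z x + g x)) ->
  y a = z a -> forall x, a <= x <= b' -> y x = z x.
Proof.
move=> cy cz dy dz yz x xab; apply/eqP; rewrite -subr_eq0; apply/eqP.
pose w (i : 'I_1) x := y x - z x.
have cw i : {within `[a, b'], continuous (w i)} by exact: wcontB.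
have dw i (t : R) : a < t < b' -> is_derive t 1 (w i) (\sum_j (c%:M : 'M[R]_1) i j * w j t).
  move=> tab; rewrite big_ord_recl big_ord0 addr0 (ord1 i) !mxE eqxx mulr1n.
  by apply: (is_derive_eq (is_deriveBx (dy t tab) (dz t tab))); rewrite /w; ring.
have w0 i : w i a = 0 by rewrite /w yz subrr.
exact: (linear_ode_unique cw dw w0 ord0 xab).
Qed.

Lemma profile_eq f g : {within `[0, 1], continuous f} -> {within `[0, 1], continuous g} ->
  (forall n, (0 < n)%N -> sin_mode n f = sin_mode n g) -> forall x, 0 <= x <= 1 -> f x = g x.
Proof.
move=> cf cg fg x x01; apply/eqP; rewrite -subr_eq0; apply/eqP.
apply: (@sine_complete R (f \- g)) => //; first exact: wcontB.
move=> n n0; have := sin_modeB n (inL2_wcont cf) (inL2_wcont cg).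
by rewrite fg// subrr.
Qed.

Lemma wcont_sub_seg (J0 : set R) f (a b' : R) : (forall t, a <= t <= b' -> J0 t) ->
  {within J0, continuous f} -> {within `[a, b'], continuous f}.
Proof. by move=> h; apply: continuous_subspaceW => t /=; rewrite in_itv/=; exact: h. Qed.

(** With the boundary value prescribed, each mode obeys a scalar linear equation whose forcing is
    common to [u] and [v]. The conclusion reaches [b'], where only the continuity in L^2(0,1) is
    available. *)
Lemma plant_modes_unique p theta (J0 J : set R) (a b' : R) b u v :
  nbhd_set J -> (forall t, a <= t <= b' -> J0 t) -> (forall t, a < t < b' -> J t) ->
  plant p theta J0 J b u -> plant p theta J0 J b v -> eqL2 (u a) (v a) -> a <= b' ->
  forall n t, a <= t <= b' -> sin_mode n (u t) = sin_mode n (v t).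
Proof.
move=> nJ s0 s pu pv uv ab n t tab.
pose g t := - ((-1) ^+ n * p * (n%:R * pi) * b t).
have J0a : J0 a by apply: s0; rewrite lexx.
apply: (@scalar_ode_unique (fun t => sin_mode n (u t)) (fun t => sin_mode n (v t))
  (theta - p * (n%:R * pi) ^+ 2) g a b') => //.
- by apply: (wcont_sub_seg s0); apply: C0_L2_sin_mode; exact: (pl_C0 pu).
- by apply: (wcont_sub_seg s0); apply: C0_L2_sin_mode; exact: (pl_C0 pv).
- by move=> x /s Jx; exact: (plant_sin_mode n nJ pu Jx).
- by move=> x /s Jx; exact: (plant_sin_mode n nJ pv Jx).
- by apply: sin_mode_eqL2 => //; [exact: (pl_C0 pu).1|exact: (pl_C0 pv).1].
Qed.

End plant.

(** * The plant under a feedback with frozen gains *)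

Section profile.
Context {R : realType}.
Implicit Types (t x : R).

Lemma second_order_exists m (M : 'M[R]_m) (e : 'cV[R]_m) :
  exists E E1 : 'I_m -> R -> R, [/\ forall i, E i 0 = 0, forall i, E1 i 0 = e i 0,
    forall i x, is_derive x 1 (E i) (E1 i x) &
    forall i x, is_derive x 1 (E1 i) (\sum_j M i j * E j x)].
Proof.
have [y [y0 dy]] := linear_ode_exists (block_mx 0 1%:M M 0) (col_mx (0 : 'cV_m) e).
exists (fun i => y (lshift m i)), (fun i => y (rshift m i)); split=> [i|i|i x|i x].
- by rewrite y0 col_mxEu mxE.
- by rewrite y0 col_mxEd.
- apply: (is_derive_eq (dy _ x)); rewrite big_split_ord/=.
  rewrite big1 ?add0r => [|j _]; last by rewrite block_mxEul mxE mul0r.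
  rewrite (bigD1 i)//= block_mxEur mxE eqxx mul1r big1 ?addr0// => j ji.
  by rewrite block_mxEur mxE eq_sym (negbTE ji) mul0r.
- apply: (is_derive_eq (dy _ x)); rewrite big_split_ord/=.
  rewrite [X in _ + X]big1 ?addr0 => [|j _]; last by rewrite block_mxEdr mxE mul0r.
  by apply: eq_bigr => j _; rewrite block_mxEdl.
Qed.

Lemma second_order_unique m (M : 'M[R]_m) (E E1 : 'I_m -> R -> R) :
  (forall i, E i 0 = 0) -> (forall i, E1 i 0 = 0) ->
  (forall i x, is_derive x 1 (E i) (E1 i x)) ->
  (forall i x, is_derive x 1 (E1 i) (\sum_j M i j * E j x)) ->
  forall i x, 0 <= x <= 1 -> E i x = 0.
Proof.
move=> E0 E10 dE dE1 i x x01.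
pose y (k : 'I_(m + m)) x := match fintype.split k with inl i => E i x | inr i => E1 i x end.
have yl j x' : y (lshift m j) x' = E j x' by rewrite /y (unsplitK (inl j)).
have yr j x' : y (rshift m j) x' = E1 j x' by rewrite /y (unsplitK (inr j)).
rewrite -yl.
have dy k (x' : R) : is_derive x' 1 (y k) (\sum_j (block_mx 0 1%:M M 0) k j * y j x').
  rewrite -(splitK k); case: (fintype.split k) => j /=.
    have -> : y (lshift m j) = E j by apply/funext => z; rewrite yl.
    apply: (is_derive_eq (dE j x')); rewrite big_split_ord/=.
    rewrite big1 ?add0r => [|l _]; last by rewrite block_mxEul mxE mul0r.
    rewrite (bigD1 j)//= block_mxEur mxE eqxx mul1r big1 ?addr0 ?yr// => l lj.
    by rewrite block_mxEur mxE eq_sym (negbTE lj) mul0r.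
  have -> : y (rshift m j) = E1 j by apply/funext => z; rewrite yr.
  apply: (is_derive_eq (dE1 j x')); rewrite big_split_ord/=.
  rewrite [X in _ + X]big1 ?addr0 => [|l _]; last by rewrite block_mxEdr mxE mul0r.
  by apply: eq_bigr => l _; rewrite block_mxEdl yl.
apply: (linear_ode_unique (A := block_mx 0 1%:M M 0) (y := y) (a := 0) (b := 1)) => //.
- by move=> k; apply: wcont_continuous => z; apply: is_derive_continuous.
- move=> k; rewrite -(splitK k); case: (fintype.split k) => j /=; by rewrite ?yl ?yr.
Qed.

Variables (p theta lam : R) (N : nat) (ka : nat -> R).
Hypotheses (p0 : 0 < p) (lam0 : lam != 0) (kaN : forall i, (N <= i)%N -> ka i = 0).

Let bn (i : nat) : R := (-1) ^+ i.+1 * p * (i.+1%:R * pi).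
Let dn (i : nat) : R := theta - p * (i.+1%:R * pi) ^+ 2.
(** The system obeyed by the first [n0] modes under the boundary value [lam * sum_j ka j * y_j]:
    [dn] is the free rate of a mode and [bn] the weight of the boundary value in its equation. *)
Definition mode_matrix n0 : 'M[R]_n0 :=
  \matrix_(i, j) ((if i == j then dn i else 0) - lam * bn i * ka j).
(** With [y' = A y], the product [h S(x) y(t)] solves the plant as soon as [p S'' + theta S = A S]
    and [S] commutes with [A]. The first condition is [S'' = M S] for this matrix [M]. *)
Definition spatial_matrix n0 : 'M[R]_n0 := p^-1 *: (mode_matrix n0 - theta%:M).

Lemma mode_matrix_sum n0 (z : 'I_n0 -> R) i :
  \sum_j mode_matrix n0 i j * z j = dn i * z i - lam * bn i * \sum_(j < n0) ka j * z j.
Proof.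
rewrite (eq_bigr (fun j => (if i == j then dn i else 0) * z j - lam * bn i * (ka j * z j))).
  rewrite sumrB -mulr_sumr; congr (_ - _).
  rewrite (bigD1 i)//= eqxx big1 ?addr0// => j ji.
  by rewrite eq_sym (negbTE ji) mul0r.
by move=> j _; rewrite mxE; ring.
Qed.

Lemma spatial_matrix_sum n0 (z : 'I_n0 -> R) i :
  \sum_j spatial_matrix n0 i j * z j =
  p^-1 * ((dn i - theta) * z i - lam * bn i * \sum_(j < n0) ka j * z j).
Proof.
rewrite mulrBl addrAC -mode_matrix_sum mulrBr mulr_sumr.
rewrite (eq_bigr (fun j => p^-1 * (mode_matrix n0 i j * z j) - p^-1 * (theta%:M i j * z j))).
  rewrite sumrB; congr (_ - _).
  rewrite (bigD1 i)//= mxE eqxx mulr1n big1 ?addr0// => j ji.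
  by rewrite mxE eq_sym (negbTE ji) mul0r mulr0.
by move=> j _; rewrite !mxE; ring.
Qed.

(* [n0] is taken past every possible resonance between the closed loop and the
   Dirichlet modes [n > n0]. *)
Lemma spatial_kernel : exists2 n0, (N <= n0)%N & forall E E1 : 'I_n0 -> R -> R,
  (forall i, E i 0 = 0) -> (forall i, E i 1 = 0) ->
  (forall i x, is_derive x 1 (E i) (E1 i x)) ->
  (forall i x, is_derive x 1 (E1 i) (\sum_j spatial_matrix n0 i j * E j x)) ->
  \sum_(i < n0) ka i * E1 i 0 = 0.
Proof.
(* For [n > n0] the mode [n] of the function [K] below will equal [sigma] times itself with
   [|sigma| <= C / n]; since [n0] exceeds [C], this forces it to be 0. *)
pose C : R := \sum_(i < N) `|ka i * lam * bn i / (p * pi ^+ 2)|.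
have C0 : 0 <= C by apply: sumr_ge0 => ? _.
pose n0 := (N + Num.bound C)%N.
have pi0 : (0 : R) < pi := pi_gt0 R.
have pi2 : (pi : R) ^+ 2 != 0 by rewrite sqrf_eq0 gt_eqF.
exists n0 => [|E E1 E0 E1_ dE dE1]; first exact: leq_addr.
pose K x := \sum_(i < n0) ka i * E i x.
have cE i : {within `[0, 1], continuous (E i)}.
  by apply: wcont_continuous => z; apply: is_derive_continuous.
have cE1 i : {within `[0, 1], continuous (E1 i)}.
  by apply: wcont_continuous => z; apply: is_derive_continuous.
have iE i : inL2 (E i) by exact: inL2_wcont.
have cK : {within `[0, 1], continuous K} by apply: wcont_sum => i; exact: wcontZ.
have modeK n : sin_mode n K = \sum_(i < n0) ka i * sin_mode n (E i).
  rewrite /K sin_mode_sum => [|i]; last exact: inL2Z.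
  by apply: eq_bigr => i _; rewrite sin_modeZ.
(* Green's identity for [E i], whose boundary terms vanish at both ends. The diagonal part of the
   spatial matrix contributes [(i+1)^2], the identity itself [n^2], and the coupling through [K] is
   left on the right. *)
have key n (i : 'I_n0) : ((i.+1%:R ^+ 2 - n%:R ^+ 2) * (p * pi ^+ 2)) * sin_mode n (E i) =
    - (lam * bn i) * sin_mode n K.
  have cS : {within `[0, 1], continuous (fun x => \sum_j spatial_matrix n0 i j * E j x)}.
    by apply: wcont_sum => j; exact: wcontZ.
  have d1 x : 0 < x < 1 -> is_derive x 1 (E i) (E1 i x) by [].
  have d2 x : 0 < x < 1 -> is_derive x 1 (E1 i) (\sum_j spatial_matrix n0 i j * E j x) by [].
  have := sin_mode_green n (cE i) (cE1 i) cS d1 d2.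
  rewrite E0 E1_ mulr0 subrr mulr0 subr0.
  have -> : Rintegral lebesgue_measure `[0%R, 1%R]%classic
      (fun x => sin (n%:R * pi * x) * (\sum_j spatial_matrix n0 i j * E j x)) =
      \sum_j spatial_matrix n0 i j * sin_mode n (E j).
    transitivity (sin_mode n (fun x => \sum_j spatial_matrix n0 i j * E j x)); first by [].
    rewrite sin_mode_sum => [|j]; last exact: inL2Z.
    by apply: eq_bigr => j _; rewrite sin_modeZ.
  rewrite spatial_matrix_sum -modeK => /(congr1 (fun z => p * z)).
  rewrite mulrA mulfV ?gt_eqF// mul1r /dn => h.
  apply/eqP; rewrite -subr_eq0; apply/eqP; move/eqP: h; rewrite -subr_eq0 => /eqP h.
  by rewrite -[RHS]oppr0 -h; ring.
have modeK0 n : (0 < n)%N -> sin_mode n K = 0.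
  (* For [n <= n0] the index [i = n - 1] annihilates the left side of [key], and [lam * bn i] is
     nonzero. For [n > n0] one divides [key] by its coefficient and sums with the weights [ka],
     which returns a multiple of the same mode. *)
  move=> n_gt0; have [nn0|n0n] := leqP n n0.
    have i0 : (n.-1 < n0)%N by rewrite prednK.
    have := key n (Ordinal i0); rewrite /= prednK// subrr !mul0r => /esym/eqP.
    rewrite mulf_eq0 oppr_eq0 mulf_eq0 (negbTE lam0)/= => /orP[|/eqP//].
    rewrite /bn !mulf_eq0 signr_eq0 (gt_eqF p0) (gt_eqF pi0) prednK// pnatr_eq0.
    by rewrite orbF; case: (n) n_gt0.
  have nR : (0 : R) < n%:R by rewrite ltr0n.
  have Cn : C < n%:R.
    have h := archi_boundP C0.
    by rewrite (lt_le_trans h)// ler_nat ltnW// (leq_ltn_trans _ n0n)// leq_addl.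
  pose sg i : R := ka i * lam * bn i / (p * pi ^+ 2) / (n%:R ^+ 2 - i.+1%:R ^+ 2).
  have den i : (i < n0)%N -> n%:R <= n%:R ^+ 2 - i.+1%:R ^+ 2 :> R.
    move=> ii; have h1 : i.+2%:R <= n%:R :> R by rewrite ler_nat (leq_trans _ n0n).
    have h2 : (0 : R) <= i.+1%:R by [].
    rewrite -natr1 in h1; rewrite subr_sqr.
    have h3 : 1 <= n%:R - i.+1%:R :> R by lra.
    have h4 : n%:R <= n%:R + i.+1%:R :> R by lra.
    by rewrite -[leLHS]mul1r ler_pM.
  have Eq : sin_mode n K = (\sum_(i < n0) sg i) * sin_mode n K.
    rewrite {1}modeK mulr_suml; apply: eq_bigr => i _.
    have dpos : 0 < n%:R ^+ 2 - i.+1%:R ^+ 2 :> R by rewrite (lt_le_trans nR)// den.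
    have ppi : p * pi ^+ 2 != 0 by rewrite mulf_neq0// gt_eqF.
    have dd : (n%:R ^+ 2 - i.+1%:R ^+ 2) * (p * pi ^+ 2) != 0 by rewrite mulf_neq0// gt_eqF.
    apply: (mulfI dd); have k := key n i.
    rewrite mulrCA (_ : _ * sin_mode n (E i) = lam * bn i * sin_mode n K); last first.
      by rewrite mulNr in k; apply: oppr_inj; rewrite -k; ring.
    have Q0 : n%:R ^+ 2 - i.+1%:R ^+ 2 != 0 :> R by rewrite gt_eqF.
    rewrite /sg; move: (p * pi ^+ 2) ppi (n%:R ^+ 2 - i.+1%:R ^+ 2) Q0 => P P0 Q Q0.
    by field; rewrite ?P0 ?Q0.
  have sg1 : `|\sum_(i < n0) sg i| < 1.
    apply: le_lt_trans (_ : C / n%:R < 1); last by rewrite ltr_pdivrMr// mul1r.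
    rewrite (le_trans (ler_norm_sum _ _ _))//.
    rewrite /C mulr_suml big_split_ord/=.
    rewrite [X in _ + X]big1 ?addr0 => [|i _]; last by rewrite /sg kaN ?leq_addr// !mul0r normr0.
    apply: ler_sum => i _; rewrite /sg normrM ler_wpM2l// normfV.
    have h := den i (leq_trans (ltn_ord i) (leq_addr _ _)).
    by rewrite lef_pV2 ?posrE ?normr_gt0 ?gt_eqF ?(lt_le_trans nR h)// (le_trans h)// ler_norm.
  apply/eqP; rewrite -normr_eq0 eq_le normr_ge0 andbT leNgt; apply/negP => h.
  have := congr1 Num.norm Eq; rewrite normrM => h'.
  have : `|sin_mode n K| < `|sin_mode n K| by rewrite {1}h' gtr_pMl.
  by rewrite ltxx.
have K0 x : 0 <= x <= 1 -> K x = 0.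
  by apply: sine_complete => // n; exact: modeK0.
(* The claim is [K'(0) = 0]. As [K] is known to vanish on [[0, 1]] only, a difference quotient at a
   point [y > 0] is used. *)
have dK : is_derive (0 : R) 1 K (\sum_(i < n0) ka i * E1 i 0).
  by apply: is_derive_sumx => i; exact: is_deriveZx.
move/is_deriveP/deriv_withinP in dK.
apply/eqP; rewrite -normr_le0 leNgt; apply/negP => h.
have [d d0 dH] := dK _ h; pose y := Num.min (d / 2) 1.
have y0 : 0 < y by rewrite lt_min divr_gt0//= ltr01.
have yd : y <= d / 2 by rewrite ge_min lexx.
have y1 : y <= 1 by rewrite ge_min lexx orbT.
have yd' : y < d by lra.
have Ky : K y = 0 by apply: K0; rewrite (ltW y0).
have K00 : K 0 = 0 by apply: K0; rewrite lexx ler01.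
have := dH y I; rewrite subr0 gt_eqF// (ger0_norm (ltW y0)) => /(_ isT yd').
by rewrite Ky K00 subrr mul0r sub0r normrN ltxx.
Qed.

(** [G = h S], where [S'' = M S], [S(0) = 0], [S'(0) = 1] and the row [h] satisfies
    [h S(1) = lam ka]. The last identity makes [sum_i y_i G_i] a solution of the plant when
    [y' = A y]; the values at 1 make its boundary value the feedback of [y]. *)
Lemma spatial_profile : exists n0 (G G1 G2 : 'I_n0 -> R -> R),
  [/\ (N <= n0)%N, forall i x, is_derive x 1 (G i) (G1 i x),
      forall i x, is_derive x 1 (G1 i) (G2 i x) & forall i, continuous (G2 i)] /\
  [/\ forall i, G i 0 = 0, forall i, G i 1 = lam * ka i &
      forall x j, 0 <= x <= 1 ->
        \sum_i G i x * mode_matrix n0 i j = p * G2 j x + theta * G j x].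
Proof.
have [n0 Nn0 ker] := spatial_kernel.
have AE0 : mode_matrix n0 = p *: spatial_matrix n0 + theta%:M.
  by rewrite /spatial_matrix scalerA mulfV ?gt_eqF// scale1r subrK.
exists n0; move: (spatial_matrix n0) (mode_matrix n0) ker AE0 => M A ker AE.
have /choice[S HS] : forall l : 'I_n0, exists E : ('I_n0 -> R -> R) * ('I_n0 -> R -> R),
    [/\ forall i, E.1 i 0 = 0, forall i, E.2 i 0 = (i == l)%:R,
    forall i x, is_derive x 1 (E.1 i) (E.2 i x) &
    forall i x, is_derive x 1 (E.2 i) (\sum_j M i j * E.1 j x)].
  move=> l; have [E [E1 [h1 h2 h3 h4]]] := second_order_exists M (delta_mx l 0).
  by exists (E, E1); split=> //= i; rewrite h2 mxE eqxx andbT.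
pose S0 (x : R) : 'M[R]_n0 := \matrix_(i, l) (S l).1 i x.
pose S1 (x : R) : 'M[R]_n0 := \matrix_(i, l) (S l).2 i x.
have dS0 i l x : is_derive x 1 (fun x => S0 x i l) (S1 x i l).
  have -> : (fun x => S0 x i l) = (S l).1 i by apply/funext => z; rewrite mxE.
  by rewrite mxE; have [_ _ + _] := HS l; apply.
have dS1 i l x : is_derive x 1 (fun x => S1 x i l) ((M *m S0 x) i l).
  have -> : (fun x => S1 x i l) = (S l).2 i by apply/funext => z; rewrite mxE.
  have [_ _ _ /(_ i x) h] := HS l; apply: (is_derive_eq h).
  by rewrite mxE; apply: eq_bigr => j _; rewrite mxE.
have S00 : S0 0 = 0 by apply/matrixP => i l; rewrite !mxE; have [-> _ _ _] := HS l.
have S10 : S1 0 = 1%:M by apply/matrixP => i l; rewrite !mxE; have [_ -> _ _] := HS l.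
pose kr : 'rV[R]_n0 := \row_j (lam * ka j).
(* A row lies in the row space of [S(1)] if it annihilates the cokernel matrix. A column [e] of that
   matrix gives [E = S(x) e], which vanishes at 0 and at 1 and has [E'(0) = e]: the situation of
   [spatial_kernel]. *)
have /submxP[h hE] : (kr <= S0 1)%MS.
  rewrite submxE; apply/eqP/matrixP => i j; rewrite !mxE.
  pose e := cokermx (S0 1).
  pose E (i : 'I_n0) x := (S0 x *m e) i j; pose E1 (i : 'I_n0) x := (S1 x *m e) i j.
  have dmul (F F1 : R -> 'M[R]_n0) (i' : 'I_n0) x :
      (forall i l, is_derive x 1 (fun x => F x i l) (F1 x i l)) ->
      is_derive x 1 (fun x => (F x *m e) i' j) ((F1 x *m e) i' j).
    move=> dF; rewrite mxE; under eq_fun do rewrite mxE.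
    apply: is_derive_sumx => l; rewrite mulrC; under eq_fun do rewrite mulrC.
    exact: is_deriveZx.
  have /(_ E E1) := ker; rewrite (eq_bigr (fun i : 'I_n0 => ka i * e i j)); last first.
    by move=> i' _; rewrite /E1 S10 mul1mx.
  move=> H; transitivity (lam * \sum_(i < n0) ka i * e i j); last first.
    suff H0 : \sum_(i < n0) ka i * e i j = 0 by rewrite H0 mulr0.
  have E00 i' : E i' 0 = 0 by rewrite /E S00 mul0mx mxE.
  have E01 i' : E i' 1 = 0 by rewrite /E mulmx_coker mxE.
  have dE i' x : is_derive x 1 (E i') (E1 i' x) by apply: dmul => ? ?; exact: dS0.
  have dE1 i' x : is_derive x 1 (E1 i') (\sum_j M i' j * E j x).
    have dd : is_derive x 1 (E1 i') ((M *m S0 x *m e) i' j).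
      by apply: (dmul S1 (fun x => M *m S0 x)) => ? ?; exact: dS1.
    by apply: (is_derive_eq dd); rewrite -mulmxA mxE.
    exact: (H E00 E01 dE dE1).
  by rewrite mulr_sumr; apply: eq_bigr => l _; rewrite mxE mulrA.
have AM : A *m M = M *m A.
  by rewrite AE mulmxDl mulmxDr -scalemxAl -scalemxAr scalar_mxC.
(* [A] is affine in [M] and so commutes with it; the commutator of [S] and [A] then solves the same
   second-order system with zero initial data. *)
have comm x : 0 <= x <= 1 -> S0 x *m A = A *m S0 x.
  move=> x01; apply/matrixP => i j; apply/eqP; rewrite -subr_eq0; apply/eqP.
  pose X (i : 'I_n0) x := (S0 x *m A) i j - (A *m S0 x) i j.
  pose X1 (i : 'I_n0) x := (S1 x *m A) i j - (A *m S1 x) i j.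
  have dX (F F1 : R -> 'M[R]_n0) (i' : 'I_n0) (y : R) :
      (forall i l, is_derive y 1 (fun x => F x i l) (F1 y i l)) ->
      is_derive y 1 (fun x => (F x *m A) i' j - (A *m F x) i' j) ((F1 y *m A) i' j - (A *m F1 y) i' j).
    move=> dF; apply: is_deriveBx; rewrite mxE; under eq_fun do rewrite mxE.
      apply: is_derive_sumx => l; rewrite mulrC; under eq_fun do rewrite mulrC.
      exact: is_deriveZx.
    by apply: is_derive_sumx => l; exact: is_deriveZx.
  have X0 i' : X i' 0 = 0 by rewrite /X S00 mul0mx mulmx0 subrr.
  have X10 i' : X1 i' 0 = 0 by rewrite /X1 S10 mul1mx mulmx1 subrr.
  have dXX i' (y : R) : is_derive y 1 (X i') (X1 i' y) by apply: dX => ? ?; exact: dS0.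
  have dX1 i' (y : R) : is_derive y 1 (X1 i') (\sum_l M i' l * X l y).
    have dd := dX S1 (fun x => M *m S0 x) i' y (fun i l => dS1 i l y).
    apply: (is_derive_eq dd).
    transitivity ((M *m (S0 y *m A - A *m S0 y)) i' j).
      by rewrite mulmxBr !mulmxA AM !mxE.
    by rewrite mxE; apply: eq_bigr => l _; rewrite /X !mxE.
  exact: (second_order_unique X0 X10 dXX dX1 i x01).
have dh (F F1 : R -> 'M[R]_n0) (j : 'I_n0) x :
    (forall i l, is_derive x 1 (fun x => F x i l) (F1 x i l)) ->
    is_derive x 1 (fun x => (h *m F x) 0 j) ((h *m F1 x) 0 j).
  move=> dF; rewrite mxE; under eq_fun do rewrite mxE.
  by apply: is_derive_sumx => l; exact: is_deriveZx.
exists (fun j x => (h *m S0 x) 0 j), (fun j x => (h *m S1 x) 0 j),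
  (fun j x => (h *m (M *m S0 x)) 0 j); split; split=> //.
- by move=> j x; apply: dh => ? ?; exact: dS0.
- by move=> j x; apply: (dh S1 (fun x => M *m S0 x)) => ? ?; exact: dS1.
- move=> j x; apply: (@is_derive_continuous _ _ _ ((h *m (M *m S1 x)) 0 j)).
  apply: (dh (fun x => M *m S0 x) (fun x => M *m S1 x)) => i l.
  rewrite mxE; under eq_fun do rewrite mxE.
  by apply: is_derive_sumx => l'; exact: is_deriveZx.
- by move=> j; rewrite S00 mulmx0 mxE.
- by move=> j; rewrite -hE mxE.
- move=> x j x01; transitivity ((h *m S0 x *m A) 0 j); first by rewrite [RHS]mxE.
  rewrite -mulmxA comm// AE mulmxDl mulmxDr mul_scalar_mx -scalemxAl -!scalemxAr.
  by rewrite !mxE.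
Qed.

End profile.

(** * Solutions of the plant from arbitrary initial data *)

Section existence.
Context {R : realType}.
Implicit Types (t x : R) (u v : R -> R -> R) (f g w : R -> R).

Lemma C0_L2_const (J : set R) f : inL2 f -> C0_L2 J (fun _ => f).
Proof.
move=> hf; apply/C0_L2P; split=> // t Jt e e0; exists 1 => // s _ _.
rewrite (_ : f \- f = cst 0) ?L2norm_cst0//.
by apply/funext => x /=; rewrite subrr.
Qed.

Lemma C0_L2_sum (J : set R) (I : finType) (h : I -> R -> R -> R) :
  (forall i, C0_L2 J (h i)) -> C0_L2 J (fun t x => \sum_i h i t x).
Proof.
move=> H; suff : forall r : seq I, C0_L2 J (fun t x => \sum_(i <- r) h i t x) by [].
elim=> [|i r IH].
  have -> : (fun t x => \sum_(i <- [::]) h i t x) = fun _ => cst 0.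
    by apply/funext => t; apply/funext => x; rewrite big_nil.
  by apply: C0_L2_const; exact: inL20.
have -> : (fun t x => \sum_(j <- i :: r) h j t x) = fun t x => h i t x + \sum_(j <- r) h j t x.
  by apply/funext => t; apply/funext => x; rewrite big_cons.
exact: C0_L2D.
Qed.

Lemma wcont_prod_sum (A : set (R * R)) (I : finType) (Y G : I -> R -> R) :
  (forall i, continuous (Y i)) -> (forall i, continuous (G i)) ->
  {within A, continuous (fun z : R * R => \sum_i Y i z.1 * G i z.2)}.
Proof.
move=> cY cG; apply: wcont_sum => i; apply: continuous_subspaceT => z.
apply: cvgM.
- by apply: (cvg_comp _ _ cvg_fst); exact: cY.
- by apply: (cvg_comp _ _ cvg_snd); exact: cG.
Qed.

Lemma plant_separated p theta (I : finType) (Y Y1 G G1 G2 : I -> R -> R) (J0 J : set R) :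
  (forall i t, is_derive t 1 (Y i) (Y1 i t)) -> (forall i, continuous (Y1 i)) ->
  (forall i x, is_derive x 1 (G i) (G1 i x)) ->
  (forall i x, is_derive x 1 (G1 i) (G2 i x)) -> (forall i, continuous (G2 i)) ->
  (forall t x, 0 < x < 1 -> \sum_i Y1 i t * G i x = \sum_i Y i t * (p * G2 i x + theta * G i x)) ->
  (forall i, G i 0 = 0) ->
  plant p theta J0 J (fun t => \sum_i Y i t * G i 1) (fun t x => \sum_i Y i t * G i x).
Proof.
move=> dY cY1 dG dG1 cG2 E G0.
have cY i : continuous (Y i) by move=> t; exact: is_derive_continuous.
have cG i : continuous (G i) by move=> t; exact: is_derive_continuous.
have cG1 i : continuous (G1 i) by move=> t; exact: is_derive_continuous.
have dx t x : is_derive x 1 (fun x => \sum_i Y i t * G i x) (\sum_i Y i t * G1 i x).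
  by apply: is_derive_sumx => i; exact: is_deriveZx.
have dxx t x : is_derive x 1 (fun x => \sum_i Y i t * G1 i x) (\sum_i Y i t * G2 i x).
  by apply: is_derive_sumx => i; exact: is_deriveZx.
have dt t x : is_derive t 1 (fun t => \sum_i Y i t * G i x) (\sum_i Y1 i t * G i x).
  apply: is_derive_sumx => i; rewrite mulrC; under eq_fun do rewrite mulrC.
  exact: is_deriveZx.
split.
- apply: C0_L2_sum => i; apply: C0_L2_scale; first exact: wcont_continuous.
  by apply: C0_L2_const; apply: inL2_wcont; exact: wcont_continuous.
- exists (fun t x => \sum_i Y1 i t * G i x), (fun t x => \sum_i Y i t * G1 i x).
  split; [|exact: wcont_prod_sum..] => t x Jt xI.
  by split; [exact: is_derive_deriv_within (dt t x)|exact: is_derive_deriv_within (dx t x)].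
- move=> t Jt; exists (fun x => \sum_i Y i t * G1 i x), (fun x => \sum_i Y i t * G2 i x).
  split=> [x _|x _|]; [exact: is_derive_deriv_within (dx t x)|exact: is_derive_deriv_within (dxx t x)|].
  by apply: wcont_sum => i; apply: wcontZ; exact: wcont_continuous.
- move=> t x Jt x01.
  have E2 : derive1n 2 (fun x => \sum_i Y i t * G i x) x = \sum_i Y i t * G2 i x.
    rewrite /= (_ : derive1 (fun x => \sum_i Y i t * G i x) = fun x => \sum_i Y i t * G1 i x).
      by rewrite derive1E; have [_ ->] := dxx t x.
    by apply/funext => y; rewrite derive1E; have [_ ->] := dx t y.
  apply/(pde_atP _ _ (dt t x) E2); rewrite E// !mulr_sumr -big_split/=.
  by apply: eq_bigr => i _; ring.
- by move=> t Jt; rewrite big1// => i _; rewrite G0 mulr0.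
- by [].
Qed.

Lemma plant_sine p theta n (a : R) (J0 J : set R) :
  plant p theta J0 J (fun=> 0)
   (fun t x => a * expR ((theta - p * (n%:R * pi) ^+ 2) * t) * sin (n%:R * pi * x)).
Proof.
set c := theta - _; set m : R := n%:R * pi.
have cs (d : R) : continuous (fun x => sin (d * x)).
  by move=> x; apply: is_derive_continuous; exact: is_derive_sin_lin.
have ce : continuous (fun t => expR (c * t)).
  by move=> t; apply: is_derive_continuous; exact: is_derive_expR_lin.
have := @plant_separated p theta 'I_1 (fun _ t => a * expR (c * t)) (fun _ t => a * (c * expR (c * t)))
  (fun _ x => sin (m * x)) (fun _ x => m * cos (m * x)) (fun _ x => m * (- (m * sin (m * x)))) J0 J.
have -> : (fun t => \sum_(i < 1) a * expR (c * t) * sin (m * 1)) = (fun=> 0).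
  by apply/funext => t; rewrite big_ord_recl big_ord0 mulr1 sin_natpi mulr0 addr0.
have -> : (fun t x => \sum_(i < 1) a * expR (c * t) * sin (m * x)) =
  (fun t x => a * expR (c * t) * sin (m * x)).
  by apply/funext => t; apply/funext => x; rewrite big_ord_recl big_ord0 addr0.
apply.
- by move=> _ t; apply: is_deriveZx; exact: is_derive_expR_lin.
- move=> _ t; apply: cvgM; first exact: cvg_cst.
  apply: cvgM; first exact: cvg_cst.
  exact: ce.
- by move=> _ x; exact: is_derive_sin_lin.
- by move=> _ x; apply: is_deriveZx; exact: is_derive_cos_lin.
- move=> _ x; apply: cvgM; first exact: cvg_cst.
  by apply: cvgN; apply: cvgM; [exact: cvg_cst|exact: cs].
- move=> t x _; rewrite !big_ord_recl !big_ord0 !addr0 /c -/m; ring.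
- by move=> _; rewrite mulr0 sin0.
Qed.

Lemma sin_mode_sine_neq n k : n != k -> sin_mode k (fun x : R => sin (n%:R * pi * x)) = 0.
Proof.
move=> nk; set m : R := n%:R * pi.
have d1 x : 0 < x < 1 -> is_derive x 1 (fun x => sin (m * x)) (m * cos (m * x)).
  by move=> _; exact: is_derive_sin_lin.
have d2 x : 0 < x < 1 -> is_derive x 1 (fun x => m * cos (m * x)) (m * (- (m * sin (m * x)))).
  by move=> _; apply: is_deriveZx; exact: is_derive_cos_lin.
have c0 : {within `[0, 1], continuous (fun x => sin (m * x))} by exact: wcont_sin_lin.
have c1 : {within `[0, 1], continuous (fun x => m * cos (m * x))} by apply: wcontZ; exact: wcont_cos_lin.
have c2 : {within `[0, 1], continuous (fun x => m * (- (m * sin (m * x))))}.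
  by apply: wcontZ; apply: wcontN; exact: wcontZ.
have := sin_mode_green k c0 c1 c2 d1 d2.
rewrite mulr1 mulr0 sin_natpi sin0 mulr0 subrr mulr0 subr0.
have -> : Rintegral lebesgue_measure `[0%R, 1%R]%classic
    (fun x => sin (k%:R * pi * x) * (m * (- (m * sin (m * x))))) =
    - m ^+ 2 * sin_mode k (fun x => sin (m * x)).
  rewrite -sin_modeZ; last exact: inL2_wcont.
  by rewrite /sin_mode; apply: eq_Rintegral => x _; ring.
move=> /eqP; rewrite -subr_eq0 -mulrBl mulf_eq0 => /orP[|/eqP//].
rewrite opprK addrC subr_sqr mulf_eq0 /m -mulrBl -mulrDl !mulf_eq0 (gt_eqF (pi_gt0 R)) !orbF.
rewrite subr_eq0 eqr_nat eq_sym (negbTE nk)/= -natrD pnatr_eq0 addn_eq0 => /andP[/eqP k0 /eqP n0].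
by move: nk; rewrite k0 n0 eqxx.
Qed.

(** The integral is not computed: if it vanished, all modes of this sine would vanish by
    orthogonality, and completeness would give the value 0 at [1/(2n)], where the sine is 1. *)
Lemma sin_mode_sine_eq n : (0 < n)%N -> sin_mode n (fun x : R => sin (n%:R * pi * x)) != 0.
Proof.
move=> n0; apply/eqP => h.
have nR : (0 : R) < n%:R by rewrite ltr0n.
have cs : {within `[0, 1], continuous (fun x : R => sin (n%:R * pi * x))} by exact: wcont_sin_lin.
have := sine_complete cs; move=> /(_ _ (2 * n%:R)^-1).
rewrite (_ : n%:R * pi * (2 * n%:R)^-1 = pi / 2); last by field; rewrite gt_eqF.
rewrite sin_pihalf => H; suff : (1 : R) = 0 by apply/eqP; rewrite oner_eq0.
apply: H.
- move=> k k0; have [<-//|nk] := eqVneq n k; exact: sin_mode_sine_neq.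
- have n1 : (1 : R) <= n%:R by rewrite ler1n.
  have h2 : (1 : R) <= 2 * n%:R by lra.
  by rewrite invr_ge0 (le_trans ler01 h2)/= invf_le1// (lt_le_trans ltr01 h2).
Qed.

Lemma plant0 p theta (J0 J : set R) : plant p theta J0 J (fun=> 0) (fun _ => cst 0).
Proof.
have := plant_sine p theta 0 0 J0 J.
have -> : (fun t x => 0 * expR ((theta - p * (0%:R * pi) ^+ 2) * t) * sin (0%:R * pi * x)) =
   (fun _ => cst 0 : R -> R) by apply/funext => t; apply/funext => x; rewrite !mul0r.
by [].
Qed.

Lemma plant_sum p theta (I : finType) (J0 J : set R) (h : I -> R -> R -> R) : nbhd_set J ->
  (forall i, plant p theta J0 J (fun=> 0) (h i)) ->
  plant p theta J0 J (fun=> 0) (fun t x => \sum_i h i t x).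
Proof.
move=> nJ H; suff : forall r : seq I, plant p theta J0 J (fun=> 0) (fun t x => \sum_(i <- r) h i t x) by [].
elim=> [|i r IH].
  have -> : (fun t x => \sum_(i <- [::]) h i t x) = fun _ => cst 0.
    by apply/funext => t; apply/funext => x; rewrite big_nil.
  exact: plant0.
have -> : (fun t x => \sum_(j <- i :: r) h j t x) = fun t x => h i t x + \sum_(j <- r) h j t x.
  by apply/funext => t; apply/funext => x; rewrite big_cons.
have := plantD nJ (H i) IH; apply: plant_eqb => t _; exact: addr0.
Qed.

Lemma sin_mode_cst0 n : sin_mode n (cst 0 : R -> R) = 0.
Proof.
by rewrite /sin_mode; under eq_Rintegral do rewrite mulr0; rewrite Rintegral_cst// mul0r.
Qed.

Lemma boundary_solution_plant p theta t0 B v :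
  boundary_solution p theta t0 B v <->
  plant p theta [set t | t0 <= t] [set t | t0 < t] (fun t => B (v t)) v.
Proof. by split=> -[]. Qed.

Section feedback.
Variables (p theta : R) (N : R -> nat) (kc : forall th : R, 'rV[R]_(N th)).
Hypothesis p0 : 0 < p.
Let K th := feedback (nominal_kernel kc) th.
(** The gains extended by 0 beyond [N th], with the factor of [phi] absorbed, because
    [spatial_profile] enlarges the system to [n0 >= N th] modes. *)
Let ka th (i : nat) : R := match (i < N th)%N =P true with
  | ReflectT h => kc th 0 (Ordinal h) * Num.sqrt 2 | ReflectF _ => 0 end.

Lemma kaE th (i : 'I_(N th)) : ka th i = kc th 0 i * Num.sqrt 2.
Proof.
rewrite /ka; case: eqP => [h|]; last by rewrite ltn_ord.
by congr (kc th 0 _ * _); apply: val_inj.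
Qed.

Lemma feedbackE th w : inL2 w -> K th w = \sum_(i < N th) ka th i * sin_mode i.+1 w.
Proof. by move=> hw; rewrite /K feedback_modes//; apply: eq_bigr => i _; rewrite kaE. Qed.

Lemma feedback_eq_modes th w w' : inL2 w -> inL2 w' ->
  (forall i, (0 < i <= N th)%N -> sin_mode i w = sin_mode i w') -> K th w = K th w'.
Proof.
move=> hw hw' H; rewrite !feedbackE//; apply: eq_bigr => i _; rewrite H//.
by rewrite ltn_ord.
Qed.

Lemma feedback_eqL2 th w w' : inL2 w -> inL2 w' -> eqL2 w w' -> K th w = K th w'.
Proof. by move=> hw hw' ww; apply: feedback_eq_modes => // i _; exact: sin_mode_eqL2. Qed.

Lemma feedback_cst0 th : K th (cst 0) = 0.
Proof.
rewrite (feedbackE th inL20) big1// => i _.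
by rewrite sin_mode_cst0 mulr0.
Qed.

Lemma feedbackZ th (c : R) w : inL2 w -> K th (fun x => c * w x) = c * K th w.
Proof.
move=> hw; rewrite !feedbackE//; last exact: inL2Z.
by rewrite mulr_sumr; apply: eq_bigr => i _; rewrite sin_modeZ//; ring.
Qed.

Lemma C0_L2_feedback th (J : set R) u : C0_L2 J u -> {within J, continuous (fun t => K th (u t))}.
Proof.
move=> cu; have H : {within J, continuous (fun t => \sum_(i < N th) ka th i * sin_mode i.+1 (u t))}.
  by apply: wcont_sum => i; apply: wcontZ; exact: C0_L2_sin_mode.
apply/wcontP => t Jt; apply/cvg_withinP => e e0.
move/wcontP/(_ t Jt)/cvg_withinP/(_ e e0) : H => [d d0 dH]; exists d => // s Js sd.
by rewrite !feedbackE; [exact: dH|exact: cu.1..].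
Qed.

(* The first [N th] modes of a closed-loop solution solve a closed linear system. *)
Lemma feedback_modes_unique th (lam : R) (J0 J : set R) (a b' : R) u v :
  nbhd_set J -> (forall t, a <= t <= b' -> J0 t) -> (forall t, a < t < b' -> J t) -> a <= b' ->
  plant p theta J0 J (fun t => lam * K th (u t)) u ->
  plant p theta J0 J (fun t => lam * K th (v t)) v ->
  (forall i, (0 < i <= N th)%N -> sin_mode i (u a) = sin_mode i (v a)) ->
  forall t, a <= t <= b' -> K th (u t) = K th (v t).
Proof.
move=> nJ s0 s ab pu pv H t tab.
pose y (i : 'I_(N th)) t := sin_mode i.+1 (u t) - sin_mode i.+1 (v t).
pose A : 'M[R]_(N th) := mode_matrix p theta lam (ka th) (N th).
have cy i : {within `[a, b'], continuous (y i)}.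
  by apply: wcontB; apply: (wcont_sub_seg s0); apply: C0_L2_sin_mode; [exact: (pl_C0 pu)|exact: (pl_C0 pv)].
have dy i x : a < x < b' -> is_derive x 1 (y i) (\sum_j A i j * y j x).
  move=> xab; have J0x : J0 x by apply: s0; lra.
  have hu := plant_sin_mode i.+1 nJ pu (s x xab); have hv := plant_sin_mode i.+1 nJ pv (s x xab).
  apply: (is_derive_eq (is_deriveBx hu hv)).
  rewrite mode_matrix_sum /y.
  rewrite !feedbackE; [|exact: (pl_C0 pv).1|exact: (pl_C0 pu).1].
  have -> : \sum_(j < N th) ka th j * (sin_mode j.+1 (u x) - sin_mode j.+1 (v x)) =
    \sum_(j < N th) ka th j * sin_mode j.+1 (u x) - \sum_(j < N th) ka th j * sin_mode j.+1 (v x).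
    by rewrite -sumrB; apply: eq_bigr => j _; rewrite mulrBr.
  ring.
have y0 i : y i a = 0 by rewrite /y H ?subrr// ltn_ord.
have Y := linear_ode_unique cy dy y0.
apply: feedback_eq_modes; [by apply: (pl_C0 pu).1; exact: s0|by apply: (pl_C0 pv).1; exact: s0|].
move=> i /andP[i0 iN]; have i' : (i.-1 < N th)%N by rewrite prednK.
have := Y (Ordinal i') t tab; rewrite /y /= prednK// => /eqP.
by rewrite subr_eq0 => /eqP.
Qed.

(** By [feedback_modes_unique] the two feedbacks coincide; both trajectories then have one
    prescribed boundary value, so all modes agree, and the profiles by completeness. At the end
    points only modes are compared, since the profiles need not be continuous there. *)
Lemma closed_loop_unique th (lam : R) (J0 J : set R) (a b' : R) u v :
  nbhd_set J -> (forall t, a <= t <= b' -> J0 t) -> (forall t, a < t < b' -> J t) -> a <= b' ->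
  plant p theta J0 J (fun t => lam * K th (u t)) u ->
  plant p theta J0 J (fun t => lam * K th (v t)) v ->
  eqL2 (u a) (v a) ->
  (forall n t, a <= t <= b' -> sin_mode n (u t) = sin_mode n (v t)) /\
  (forall t x, a < t < b' -> 0 <= x <= 1 -> u t x = v t x).
Proof.
move=> nJ s0 s ab pu pv uv.
have J0a : J0 a by apply: s0; rewrite lexx.
have H0 i : sin_mode i (u a) = sin_mode i (v a).
  by apply: sin_mode_eqL2 => //; [exact: (pl_C0 pu).1|exact: (pl_C0 pv).1].
have HK := feedback_modes_unique nJ s0 s ab pu pv (fun i _ => H0 i).
have Hm n t : a <= t <= b' -> sin_mode n (u t) = sin_mode n (v t).
  pose J1 : set R := [set t | a < t < b'].
  have J1J : J1 `<=` J by exact: s.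
  have pu' := plant_sub (@subset_refl _ J0) J1J pu.
  have pv' : plant p theta J0 J1 (fun t => lam * K th (u t)) v.
    apply: plant_eqb (plant_sub (@subset_refl _ J0) J1J pv) => r /= /andP[r1 r2].
    by rewrite HK// !ltW.
  exact: (plant_modes_unique (@nbhd_oo R a b') s0 (fun _ h => h) pu' pv' uv ab).
split=> // t x tab x01.
apply: profile_eq => //.
- by apply: C2_01_wcont; apply: (pl_C2 pu); exact: s.
- by apply: C2_01_wcont; apply: (pl_C2 pv); exact: s.
- by move=> n _; apply: Hm; have /andP[h1 h2] := tab; rewrite !ltW.
Qed.

Variables (Rc omb : R -> R).
Hypothesis nom : nominal_feedback p kc Rc omb.

Let J0 : set R := [set t | 0 <= t].
Let J : set R := [set t | 0 < t].

(** The assumption covers the plant whose parameter is that of the gain; the factor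
    [expR ((theta - th) * t)] changes the parameter and passes through the linear feedback. For
    [th = theta] the bound is the nominal decay. *)
Lemma nominal_plant th w : inL2 w -> exists v,
  [/\ plant p theta J0 J (fun t => K th (v t)) v, eqL2 (v 0) w &
   forall t, 0 <= t -> L2norm (v t) <= expR ((theta - th) * t) * (Rc th * expR (- omb th * t)) * L2norm w].
Proof.
move=> hw; have [_ _ _ /(_ w hw)[v [[/boundary_solution_plant pv v0] _ vle]]] := nom th.
have vL t : 0 <= t -> inL2 (v t) by exact: (pl_C0 pv).1.
exists (fun t x => expR ((theta - th) * t) * v t x); split.
- have := plant_exp (theta - th) (@nbhd_gt R 0) pv; rewrite addrC subrK.
  by apply: plant_eqb => t /= t0; rewrite feedbackZ//; exact: vL (ltW t0).
- apply: eqL2_trans v0; apply: eqL2_in => x _; by rewrite mulr0 expR0 mul1r.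
- move=> t t0; rewrite (L2normZ _ (vL t t0)) ger0_norm ?expR_ge0// -mulrA ler_wpM2l ?expR_ge0//.
  exact: vle.
Qed.

(** This is how the Dirichlet problem is solved for rough data: a nominal solution whose visible
    modes start at 0 has zero feedback for ever, by comparison with the zero solution. *)
Lemma free_plant th w n0 : inL2 w -> (N th <= n0)%N ->
  (forall i, (0 < i <= n0)%N -> sin_mode i w = 0) ->
  exists v, plant p theta J0 J (fun=> 0) v /\ eqL2 (v 0) w.
Proof.
move=> hw Nn0 w0; have [v [pv v0 _]] := nominal_plant th hw.
have pv1 : plant p theta J0 J (fun t => 1 * K th (v t)) v.
  by apply: (plant_eqb _ pv) => r _; rewrite mul1r.
exists v; split=> //; apply: (plant_eqb _ pv) => t t0.
have p00 : plant p theta J0 J (fun t => 1 * K th (cst 0)) (fun _ => cst 0).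
  by apply: plant_eqb (plant0 p theta J0 J) => r _; rewrite feedback_cst0 mulr0.
rewrite (feedback_modes_unique (a := 0) (b' := t) (@nbhd_gt R 0) _ _ _ pv1 p00) ?feedback_cst0 ?lexx ?andbT//.
- by move=> r /andP[].
- by move=> r /andP[].
- exact: ltW.
- move=> i /andP[i0 iN]; rewrite (sin_mode_eqL2 _ _ hw v0)//; last exact: (pl_C0 pv).1 (lexx _).
  by rewrite w0 ?i0 ?(leq_trans iN)// sin_mode_cst0.
- exact: ltW.
Qed.

(** [u = up + z + v]: [up] carries the boundary value, [z] corrects the first [n0] modes of the
    initial profile by free exponentials, and [v] starts from the rest, in which the feedback sees
    nothing. The last two have zero boundary value. *)
Lemma plant_exists0 th (lam : R) w : lam != 0 -> inL2 w ->
  exists v, plant p theta J0 J (fun t => lam * K th (v t)) v /\ eqL2 (v 0) w.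
Proof.
move=> lam0 hw.
have kaN i : (N th <= i)%N -> ka th i = 0.
  by move=> Ni; rewrite /ka; case: eqP => // h; exfalso; move: h; rewrite ltnNge Ni.
have [n0 [G [G1 [G2 [[Nn0 dG dG1 cG2] [G0 Gb GA]]]]]] := spatial_profile theta p0 lam0 kaN.
pose A := mode_matrix p theta lam (ka th) n0.
have [y [y0 dy]] := linear_ode_exists A (\col_i sin_mode i.+1 w).
pose up t x := \sum_i y i t * G i x; pose b t := \sum_i y i t * G i 1.
have pup : plant p theta J0 J b up.
  apply: (plant_separated (Y1 := fun i t => \sum_j A i j * y j t) (G1 := G1) (G2 := G2)) => //.
  - move=> i t.
    apply: (@is_derive_continuous _ _ _ (\sum_j A i j * \sum_k A j k * y k t)).
    by apply: is_derive_sumx => j; exact: is_deriveZx.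
  - move=> t x x01; have x01' : 0 <= x <= 1 by lra.
    transitivity (\sum_j y j t * \sum_i G i x * A i j).
      under [RHS]eq_bigr do rewrite mulr_sumr.
      rewrite exchange_big/=; apply: eq_bigr => i _; rewrite mulr_suml.
      by apply: eq_bigr => j _; ring.
    by apply: eq_bigr => j _; rewrite GA.
have J00 : J0 0 by rewrite /J0/= lexx.
pose w1 := w \- up 0.
have hup : inL2 (up 0) by exact: (pl_C0 pup).1.
have hw1 : inL2 w1 by exact: inL2B.
pose sn (i : nat) x := sin (i.+1%:R * pi * x) : R.
have hsn i : inL2 (sn i) by apply: inL2_wcont; exact: wcont_sin_lin.
pose mu (i : nat) := sin_mode i.+1 w1 / sin_mode i.+1 (sn i).
pose z t x := \sum_(i < n0) mu i * expR ((theta - p * (i.+1%:R * pi) ^+ 2) * t) * sin (i.+1%:R * pi * x).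
have pz : plant p theta J0 J (fun=> 0) z.
  apply: (plant_sum (h := fun (i : 'I_n0) t x => mu i * expR ((theta - p * (i.+1%:R * pi) ^+ 2) * t) * sin (i.+1%:R * pi * x))).
    exact: nbhd_gt.
  by move=> i; exact: plant_sine.
have hz : inL2 (z 0) by exact: (pl_C0 pz).1.
pose w2 := w1 \- z 0.
have hw2 : inL2 w2 by exact: inL2B.
have w20 i : (0 < i <= n0)%N -> sin_mode i w2 = 0.
  case: i => // i /andP[_ ilt]; rewrite /w2 sin_modeB//.
  have -> : z 0 = fun x => \sum_(j < n0) mu j * sn j x.
    by apply/funext => x; apply: eq_bigr => j _; rewrite mulr0 expR0 mulr1.
  rewrite sin_mode_sum => [|j]; last exact: inL2Z.
  rewrite (bigD1 (Ordinal ilt))//= big1 => [|j ji].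
    by rewrite addr0 sin_modeZ// /mu divfK ?subrr//; exact: sin_mode_sine_eq.
  by rewrite sin_modeZ// sin_mode_sine_neq ?mulr0.
have [v [pv v0]] := free_plant hw2 Nn0 w20.
pose u t x := up t x + z t x + v t x.
have nJ : nbhd_set J := @nbhd_gt R 0.
have pu : plant p theta J0 J b u.
  by apply: plant_eqb (plantD nJ (plantD nJ pup pz) pv) => t _; rewrite !addr0.
have u0 : eqL2 (u 0) w.
  have h1 : eqL2 (u 0) (fun x => up 0 x + z 0 x + w2 x).
    by apply: (@filterS _ _ (ae_filter_ringOfSetsType _)) v0 => x /= h xI; rewrite /u h.
  by apply: (eqL2_trans h1); apply: eqL2_in => x _; rewrite /w2 /w1 /=; ring.
(* The loop closes here: mode [i] of [u] and [y i] solve one scalar equation with the same forcing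
   [b], so the boundary value built from [y] is the feedback of [u]. *)
have um (i : 'I_n0) t : 0 <= t -> sin_mode i.+1 (u t) = y i t.
  move=> t0.
  pose g t := - ((-1) ^+ i.+1 * p * (i.+1%:R * pi) * b t).
  apply: (@scalar_ode_unique R (fun t => sin_mode i.+1 (u t)) (y i) (theta - p * (i.+1%:R * pi) ^+ 2) g 0 t).
  - have hJ r : 0 <= r <= t -> J0 r by case/andP.
    by apply: (wcont_sub_seg hJ); apply: C0_L2_sin_mode; exact: (pl_C0 pu).
  - by apply: wcont_continuous => r; exact: is_derive_continuous.
  - by move=> r /andP[r0 _]; exact: (plant_sin_mode _ nJ pu r0).
  - move=> r _; apply: (is_derive_eq (dy i r)).
    rewrite mode_matrix_sum /g /b; congr (_ + _).
    have -> : \sum_i y i r * G i 1 = lam * \sum_(j < n0) ka th j * y j r.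
      by rewrite mulr_sumr; apply: eq_bigr => j _; rewrite Gb; ring.
    ring.
  - by rewrite y0 mxE; apply: sin_mode_eqL2 => //; exact: (pl_C0 pu).1.
  - by rewrite t0 lexx.
exists u; split=> //; apply: (plant_eqb _ pu) => t t0.
have t0' : 0 <= t by exact: ltW.
rewrite feedbackE; last exact: (pl_C0 pu).1.
pose F j := ka th j * sin_mode j.+1 (u t).
have -> : b t = lam * \sum_(j < n0) F j.
  by rewrite /b mulr_sumr; apply: eq_bigr => j _; rewrite /F um// Gb; ring.
congr (_ * _); rewrite -!(big_mkord predT F) (big_cat_nat _ Nn0)//=.
rewrite [X in _ + X]big1_seq ?addr0// => j; rewrite mem_index_iota => /andP[_ /andP[Nj _]].
by rewrite /F kaN// mul0r.
Qed.

Lemma plant_exists th (lam t0 : R) w : lam != 0 -> inL2 w ->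
  exists v, boundary_solution p theta t0 (fun z => lam * K th z) v /\ eqL2 (v t0) w.
Proof.
move=> lam0 hw; have [v [pv v0]] := plant_exists0 th lam0 hw.
exists (fun t => v (t - t0)); split; last by rewrite subrr.
apply/boundary_solution_plant.
apply: plant_sub (plant_shift t0 (@nbhd_gt R 0) pv) => t /=.
  by rewrite /J0/= subr_ge0.
by rewrite /J/= subr_gt0.
Qed.

Lemma nominal_solution t0 w : inL2 w -> exists v,
  [/\ boundary_solution p theta t0 (K theta) v, eqL2 (v t0) w &
   forall t, t0 <= t -> L2norm (v t) <= Rc theta * expR (- omb theta * (t - t0)) * L2norm w].
Proof.
move=> hw; have [v [pv v0 vle]] := nominal_plant theta hw.
exists (fun t => v (t - t0)); split; last 2 first.
- by rewrite subrr.
- move=> t tt; have := vle (t - t0); rewrite subrr mul0r expR0 mul1r subr_ge0; exact.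
apply/boundary_solution_plant.
apply: plant_sub (plant_shift t0 (@nbhd_gt R 0) pv) => t /=.
  by rewrite /J0/= subr_ge0.
by rewrite /J/= subr_gt0.
Qed.

End feedback.
End existence.

(** * Event triggers *)

Section trigger.
Context {R : realType}.
Implicit Types (t x : R) (u v : R -> R -> R) (f g w : R -> R).
Variables (p theta c T a : R) (N : R -> nat) (kc : forall th : R, 'rV[R]_(N th)) (Rc omb : R -> R).
Hypotheses (p0 : 0 < p) (nom : nominal_feedback p kc Rc omb) (c0 : 0 < c) (T0 : 0 < T) (a0 : 0 < a).
Let k := nominal_kernel kc.
Let trig := trigger_time p theta c k Rc T a.
Let Bc th ch := fun z : R -> R => c * control k th ch z.

(** The nominal bound at time 0, for a profile of nonzero norm. It places the threshold
    [Rc th * (1 + a) * L2norm w] strictly above the starting norm when that norm is positive. *)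
Lemma Rc_ge1 th : 1 <= Rc th.
Proof.
have hs : inL2 (fun x : R => sin (1%:R * pi * x)) by apply: inL2_wcont; exact: wcont_sin_lin.
have [_ _ _ /(_ _ hs)[v [[pv v0] _ /(_ 0 (lexx _))]]] := nom th.
have hv : inL2 (v 0) by apply: (bs_C0 pv).1; rewrite /= lexx.
rewrite mulr0 expR0 mulr1 (eqL2_L2norm hv hs v0) ler_pMl//.
by apply: lt_le_trans (sin_mode_le 1 hs); rewrite normr_gt0 sin_mode_sine_eq.
Qed.

Lemma controlE th ch : Bc th ch = (fun z => c / ch * feedback k th z).
Proof. by apply/funext => z; rewrite /Bc /control mulrA. Qed.

Lemma bs_plant th ch t0 v : boundary_solution p theta t0 (Bc th ch) v ->
  plant p theta [set t | t0 <= t] [set t | t0 < t] (fun t => c / ch * feedback k th (v t)) v.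
Proof. by rewrite controlE => /boundary_solution_plant. Qed.

Lemma bs_unique th ch t0 v v' : boundary_solution p theta t0 (Bc th ch) v ->
  boundary_solution p theta t0 (Bc th ch) v' -> eqL2 (v t0) (v' t0) ->
  (forall t x, t0 < t -> 0 <= x <= 1 -> v t x = v' t x) /\
  (forall t, t0 <= t -> eqL2 (v t) (v' t)).
Proof.
move=> /bs_plant pv /bs_plant pv' vv.
have H t x : t0 < t -> 0 <= x <= 1 -> v t x = v' t x.
  move=> tt x01.
  have s0 r : t0 <= r <= t + 1 -> [set t | t0 <= t] r by case/andP.
  have s1 r : t0 < r < t + 1 -> [set t | t0 < t] r by case/andP.
  have t01 : t0 <= t + 1 by rewrite (le_trans (ltW tt))// lerDl.
  have [_ h] := closed_loop_unique (@nbhd_gt R t0) s0 s1 t01 pv pv' vv.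
  by apply: h => //; rewrite tt ltrDl ltr01.
split=> // t; rewrite le_eqVlt => /predU1P[<-//|tt].
by apply: eqL2_in => x /andP[x0 x1]; apply: H => //; rewrite !ltW.
Qed.

Lemma bs_inL2 th ch t0 v t : boundary_solution p theta t0 (Bc th ch) v -> t0 <= t -> inL2 (v t).
Proof. by move=> h tt; apply: (bs_C0 h).1. Qed.

(** The trigger time is defined through some solution with frozen estimates; as this solution is
    unique, the time depends only on the class of [w] and on the estimates. *)
Lemma trigger_time_unique ti w w' th ch r r' : inL2 w -> inL2 w' -> eqL2 w w' ->
  trig ti w th ch r -> trig ti w' th ch r' -> r = r'.
Proof.
move=> hw hw' ww [r1 r2] [r1' r2'].
have [w0|w0] := pselect (eqL2 w (cst 0)).
  by rewrite r2// r2'//; apply: eqL2_trans w0; exact: eqL2_sym.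
have w0' : ~ eqL2 w' (cst 0) by move=> h; apply: w0; exact: eqL2_trans h.
have [v [bv vw ->]] := r1 w0; have [v' [bv' vw' ->]] := r1' w0'.
have vv : eqL2 (v ti) (v' ti).
  by apply: (eqL2_trans vw); apply: (eqL2_trans ww); exact: eqL2_sym.
have [_ H] := bs_unique bv bv' vv.
have E t : ti < t -> L2norm (v t) = L2norm (v' t).
  move=> tt; apply: eqL2_L2norm; [exact: bs_inL2 bv (ltW tt)|exact: bs_inL2 bv' (ltW tt)|].
  by apply: H; exact: ltW.
rewrite (eqL2_L2norm hw hw' ww); congr (ereal_inf [set t%:E | t in _]).
by apply/seteqP; split=> t /= [tt h]; split=> //; rewrite -h E.
Qed.

Lemma bs_zero th ch t0 : boundary_solution p theta t0 (Bc th ch) (fun _ => cst 0).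
Proof.
rewrite controlE; apply/boundary_solution_plant; apply: plant_eqb (plant0 _ _ _ _) => t _.
by rewrite (feedback_cst0 kc th) mulr0.
Qed.

Lemma bs_eq0 th ch t0 v : boundary_solution p theta t0 (Bc th ch) v -> eqL2 (v t0) (cst 0) ->
  (forall t x, t0 < t -> 0 <= x <= 1 -> v t x = 0) /\ (forall t, t0 <= t -> L2norm (v t) = 0).
Proof.
move=> bv v0; have [H1 H2] := bs_unique bv (bs_zero th ch t0) v0; split=> // t tt.
by apply/eqL20_L2norm; [exact: bs_inL2 bv tt|exact: H2].
Qed.

Lemma bs_restart th ch t0 t1 v : t0 <= t1 -> boundary_solution p theta t0 (Bc th ch) v ->
  boundary_solution p theta t1 (Bc th ch) v.
Proof.
move=> tt; rewrite controlE => /boundary_solution_plant pv; apply/boundary_solution_plant.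
by apply: plant_sub pv => t /= ht; [exact: le_trans ht|exact: le_lt_trans ht].
Qed.

Lemma trigger_exists ti w th ch : ch != 0 -> inL2 w -> exists v r t1,
  [/\ boundary_solution p theta ti (Bc th ch) v, eqL2 (v ti) w & trig ti w th ch r] /\
  [/\ t1%:E = Order.min (ti + T)%:E r, ti < t1, t1 <= ti + T &
      forall t, ti <= t <= t1 -> L2norm (v t) <= Rc th * (1 + a) * L2norm w].
Proof.
move=> ch0 hw.
have lam0 : c / ch != 0 by rewrite mulf_neq0 ?invr_eq0// gt_eqF.
have [v [bv vw]] := plant_exists theta p0 nom th ti lam0 hw.
have {}bv : boundary_solution p theta ti (Bc th ch) v by rewrite controlE.
have R1 := Rc_ge1 th.
have R0 : 0 <= Rc th * (1 + a) by rewrite mulr_ge0 ?addr_ge0 ?(ltW a0)// (le_trans ler01).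
have [w0|w0] := pselect (eqL2 w (cst 0)).
  exists v, (ti + T)%:E, (ti + T); split; split=> //.
  - by rewrite minxx.
  - by rewrite ltrDl.
  - move=> t /andP[tt _]; rewrite (bs_eq0 bv (eqL2_trans vw w0)).2// mulr_ge0 ?L2norm_ge0//.
pose L := Rc th * (1 + a) * L2norm w.
pose S : set R := [set t | ti < t /\ L2norm (v t) = L].
pose r := ereal_inf [set t%:E | t in S].
have wn : 0 < L2norm w.
  rewrite lt_neqAle L2norm_ge0 andbT eq_sym; apply/eqP => h; apply: w0; exact: L2norm_eq0.
have vti : L2norm (v ti) = L2norm w.
  by apply: eqL2_L2norm => //; apply: (bs_inL2 bv).
have wL : L2norm w < L.
  rewrite /L ltr_pMl//; apply: (@lt_le_trans _ _ (1 + a)); first by rewrite ltrDl.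
  by rewrite ler_peMl// addr_ge0// ltW.
have cN := C0_L2_L2norm (bs_C0 bv).
have [d d0 dH] : exists2 d, 0 < d & forall t, ti <= t < ti + d -> L2norm (v t) < L.
  move/wcontP/(_ ti (lexx _))/cvg_withinP : cN => /(_ (L - L2norm w)).
  rewrite subr_gt0 => /(_ wL)[d d0 dH]; exists d => // t /andP[t1 t2].
  have := dH t t1; rewrite vti ger0_norm ?subr_ge0// => h.
  have : `|L2norm (v t) - L2norm w| < L - L2norm w by apply: h; lra.
  by move/(le_lt_trans (ler_norm _)); rewrite ltrD2r.
have rd : ((ti + d)%:E <= r)%E.
  apply: le_ereal_inf_tmp => _ [t [t1 tL] <-]; rewrite lee_fin leNgt; apply/negP => t2.
  by have := dH t; rewrite (ltW t1) t2 tL ltxx => /(_ isT).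
(* The infimum is [+oo] if the threshold is never met, and [rd] excludes [-oo]; the minimum with
   [ti + T] is real in either case. *)
have [t1 t1E] : exists t1, t1%:E = Order.min (ti + T)%:E r.
  case: r rd => [s rd|rd|rd//]; first by exists (Num.min (ti + T) s); rewrite EFin_min.
  by exists (ti + T); rewrite minEle leey.
have t1T : t1 <= ti + T by rewrite -lee_fin t1E ge_min lexx.
have t1r : (t1%:E <= r)%E by rewrite t1E ge_min lexx orbT.
have tit1 : ti < t1.
  by rewrite -lte_fin t1E lt_min lte_fin ltrDl T0/= (lt_le_trans _ rd)// lte_fin ltrDl.
exists v, r, t1; split; split=> //.
  by split=> // _; exists v.
move=> t /andP[tt tt1]; rewrite leNgt; apply/negP => Lt.
have ne : ti != t by apply/eqP => E; move: Lt; rewrite -E vti ltNge (ltW wL).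
have tlt : ti < t by rewrite lt_neqAle ne.
have [|||s sI sL] := @IVT R (fun t => L2norm (v t)) ti t L.
- exact: ltW.
- by apply: (wcont_sub_seg (J0 := [set t | ti <= t])) => // s /andP[].
- by rewrite vti ge_min le_max (ltW wL) (ltW Lt) orbT.
move: sI; rewrite in_itv/= => /andP[s1 s2].
have sti : ti < s.
  rewrite lt_neqAle s1 andbT; apply/eqP => E; move: sL; rewrite -E vti => h.
  by move: wL; rewrite h ltxx.
have st : s < t.
  by rewrite lt_neqAle s2 andbT; apply/eqP => E; move: Lt; rewrite -E sL ltxx.
have rs : (r <= s%:E)%E by apply: ereal_inf_lbound; exists s.
by have := le_trans t1r rs; rewrite lee_fin leNgt (lt_le_trans st tt1).
Qed.

(** Under the decay the norm stays at or below [Rc theta * L2norm w], strictly under the threshold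
    when [w] is nonzero because [a > 0]. No crossing occurs, the infimum is [+oo], and the timer
    decides. *)
Lemma trigger_time_decay ti v w ch : inL2 w -> boundary_solution p theta ti (Bc theta ch) v ->
  eqL2 (v ti) w ->
  (forall t, ti <= t -> L2norm (v t) <= Rc theta * expR (- omb theta * (t - ti)) * L2norm w) ->
  exists r, trig ti w theta ch r /\ (ti + T)%:E = Order.min (ti + T)%:E r.
Proof.
move=> hw bv vw vle; have R1 := Rc_ge1 theta.
have [_ _ o0 _] := nom theta.
have [w0|w0] := pselect (eqL2 w (cst 0)).
  by exists (ti + T)%:E; rewrite minxx; split=> //; split.
have wn : 0 < L2norm w.
  rewrite lt_neqAle L2norm_ge0 andbT eq_sym; apply/eqP => h; apply: w0; exact: L2norm_eq0.
exists +oo%E; rewrite minEle leey; split=> //; split=> // _.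
exists v; split=> //; apply/esym; rewrite (_ : [set _ | _] = set0); last first.
  rewrite -subset0 => t /= [tt E]; have := vle t (ltW tt); rewrite E leNgt => /negP; apply.
  rewrite ltr_pM2r// ltr_pM2l; last by rewrite (lt_le_trans ltr01).
  apply: (@le_lt_trans _ _ 1); last by rewrite ltrDl.
  rewrite -expR0 ler_expR mulNr oppr_le0 mulr_ge0 ?(ltW o0)// subr_ge0 ltW//.
by rewrite image_set0 ereal_inf0.
Qed.

End trigger.

(** * Identification of the parameters *)

Section window.
Context {R : realType}.
Notation leb := (@lebesgue_measure R).
Notation TR := (measurableTypeR R).
Implicit Types (F G f : R -> R) (a b m : R).

Lemma primitive_exists f a b : a < b -> {within `[a, b], continuous f} ->
  exists F, {within `[a, b], continuous F} /\ forall x, a < x < b -> is_derive x 1 F (f x).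
Proof.
move=> ab cf; have fi := integrable_seg cf.
exists (fun x => \int[leb]_(t in `[a, x]) f t); split.
  exact: (parameterized_integral_continuous (ltW ab) fi).
move=> x /andP[ax xb].
have cx : {for x, continuous f}.
  have /cvg_withinP h : f y @[y --> within `[a, b] (nbhs x)] --> f x.
    by apply: (wcontP _ _).1 => //; rewrite /= in_itv /= !ltW.
  have : f y @[y --> within setT (nbhs x)] --> f x; last by rewrite withinET.
  apply/cvg_withinP => e /h [d d0 hd].
  exists (Num.min d (Num.min (x - a) (b - x))); first by rewrite !lt_min d0 !subr_gt0 ax.
  move=> y _; rewrite !lt_min => /and3P[h1 h2 h3]; apply: hd => //.
  move: h2 h3; rewrite /= in_itv /= !ltr_norml => /andP[h2 _] /andP[_ h3].
  by apply/andP; split; [move: h2|move: h3]; clear; lra.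
have [d e] := continuous_FTC1_closed xb fi ax cx.
by rewrite derive1E in e; exact: (DeriveDef d e).
Qed.

(** Increments over all subsegments instead of a derivative: [U] may jump at events, where its
    primitive need not be differentiable, while increments still add up. *)
Definition primitive_on f F a b := leb.-integrable `[a, b] (EFin \o f) /\
  forall s t, a <= s -> s <= t -> t <= b -> \int[leb]_(x in `[s, t]) f x = F t - F s.

Lemma primitive_onP f g F a b : a <= b -> {within `[a, b], continuous F} ->
  {within `[a, b], continuous g} -> (forall x, a < x < b -> is_derive x 1 F (g x)) ->
  (forall x, a < x < b -> g x = f x) -> primitive_on f F a b.
Proof.
move=> ab cF cg dF fg; split.
  exact: (integrable_eq_oo fg (integrable_seg cg)).
move=> s t as_ st tb.
have sub (h : R -> R) : {within `[a, b], continuous h} -> {within `[s, t], continuous h}.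
  by apply: wcont_sub_seg => x; rewrite /= in_itv /= => /andP[h1 h2]; apply/andP; split; lra.
rewrite -(@Rintegral_eq_oo _ g).
- apply: Rintegral_FTC => //; [exact: sub|exact: sub|].
  by move=> x /andP[h1 h2]; apply: dF; apply/andP; split; lra.
- by move=> x /andP[h1 h2]; apply: fg; apply/andP; split; lra.
- exact: integrable_seg (sub _ cg).
Qed.

Lemma primitive_on_cat f F a b m : a <= m -> m <= b ->
  primitive_on f F a m -> primitive_on f F m b -> primitive_on f F a b.
Proof.
move=> am mb [i1 e1] [i2 e2].
have fi : leb.-integrable `[a, b] (EFin \o f).
  have mU : `[a, b]%classic = (`[a, m]%classic `|` `]m, b]%classic : set R).
    apply/seteqP; split=> x /=; rewrite !in_itv /=; first by case: (leP x m) => h /andP[-> ->]; [left|right].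
    by case=> /andP[h1 h2]; apply/andP; split; lra.
  have i2' : leb.-integrable `]m, b] (EFin \o f).
    apply: integrableS i2 => //.
    by move=> x /=; rewrite !in_itv /= => /andP[h ->]; rewrite (ltW h).
  have mA : measurable (`[a, m]%classic : set TR) by exact: measurable_itv.
  have mB : measurable (`]m, b]%classic : set TR) by exact: measurable_itv.
  rewrite mU; apply/(integrable_mkcond _ (measurableU _ _ mA mB)).
  have := integrableD measurableT ((integrable_mkcond _ mA).1 i1) ((integrable_mkcond _ mB).1 i2').
  apply: eq_integrable => // x _ /=.
  rewrite /patch in_setU; case: ifPn => xA; case: ifPn => xB //=; rewrite ?adde0 ?add0e //.
  by exfalso; move: xA xB; rewrite !inE /= !in_itv /= => /andP[h1 h2] /andP[h3 h4]; lra.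
split=> // s t as_ st tb.
have [tm|mt] := leP t m; first exact: e1.
have [ms|sm] := leP m s; first exact: e2.
have ist : leb.-integrable `[s, t] (EFin \o f).
  apply: integrableS fi => //.
  by move=> x /=; rewrite !in_itv /= => /andP[h1 h2]; apply/andP; split; lra.
have imt : leb.-integrable `]m, t] (EFin \o f).
  apply: integrableS ist => //.
  by move=> x /=; rewrite !in_itv /= => /andP[h1 ->]; rewrite (ltW (lt_trans sm h1)).
have := @Rintegral_itvB R f (BLeft s) (BRight t) m ist.
rewrite !bnd_simp => /(_ (ltW sm) (ltW mt)).
rewrite (Rintegral_itv_obnd_cbnd imt) (e1 s m) // ?(ltW sm) // (e2 m t) // ?(ltW mt) //.
lra.
Qed.

Lemma measurable_square m b : measurable ((`[m, b]%classic : set TR) `*` (`[m, b]%classic : set TR)).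
Proof. by apply: measurableX; exact: measurable_itv. Qed.

Lemma measure_rectangle (a b m d : R) : a < b -> m < d ->
  (leb \x leb)%E ((`[a, b]%classic : set TR) `*` (`[m, d]%classic : set TR)) =
  ((b - a) * (d - m))%:E.
Proof.
move=> ab md; have mA : measurable (`[a, b]%classic : set TR) by exact: measurable_itv.
have mB : measurable (`[m, d]%classic : set TR) by exact: measurable_itv.
transitivity (leb `[a, b]%classic * leb `[m, d]%classic)%E; first exact: product_measure1E.
by rewrite !lebesgue_measure_itv /= !lte_fin ab md -!EFinD -!EFinM.
Qed.

Lemma window_integrable F G m b : m < b -> {within `[m, b], continuous F} ->
  {within `[m, b], continuous G} ->
  (leb \x leb)%E.-integrable (`[m, b] `*` `[m, b])
    (EFin \o (fun z : TR * TR => (F z.1 - F z.2) * (G z.1 - G z.2))).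
Proof.
move=> mb cF cG; have mS := measurable_square m b.
have mI : measurable (`[m, b]%classic : set TR) by exact: measurable_itv.
have mf (H : R -> R) : {within `[m, b], continuous H} ->
    measurable_fun ((`[m, b]%classic : set TR) `*` (`[m, b]%classic : set TR))
     (fun z : TR * TR => H z.1 - H z.2).
  move=> cH; have mH : measurable_fun (`[m, b]%classic : set TR) H.
    exact: subspace_continuous_measurable_fun.
  apply: measurable_funB.
    apply: (measurable_comp mI _ mH); first by move=> _ [z [z1 z2] <-].
    exact: measurable_funS measurable_fst.
  apply: (measurable_comp mI _ mH); first by move=> _ [z [z1 z2] <-].
  exact: measurable_funS measurable_snd.
have [C1 C10 b1] := wcont_bounded (ltW mb) cF.
have [C2 C20 b2] := wcont_bounded (ltW mb) cG.
apply: measurable_bounded_integrable => //.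
- have : ((leb \x leb) ((`[m, b]%classic : set TR) `*` (`[m, b]%classic : set TR)) < +oo)%E => //.
  by rewrite measure_rectangle // ltry.
- by apply: measurable_funM; exact: mf.
exists (2 * C1 * (2 * C2)); split; first exact: num_real.
move=> y hy z [z1 z2]; apply: le_trans (ltW hy); rewrite normrM.
have bd (H : R -> R) C : (forall x, m <= x <= b -> `|H x| <= C) -> `|H z.1 - H z.2| <= 2 * C.
  move=> hH; apply: le_trans (ler_normB _ _) _.
  move: z1 z2; rewrite /= !in_itv /= => /hH h1 /hH h2; lra.
by apply: ler_pM => //; exact: bd.
Qed.

(** On a window [f_n], [g_n] and [j_n] are all increments of functions of time, so every [H] and [Q]
    of the update is a value of this bilinear form. *)
Definition win m b F G : R :=
  window_integral m b (fun t s => F t - F s) (fun t s => G t - G s).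

Lemma win_sym m b F G : win m b F G = win m b G F.
Proof. by apply: eq_Rintegral => z _; rewrite mulrC. Qed.

Lemma win_lin m b F G H (x y : R) : m < b -> {within `[m, b], continuous F} ->
  {within `[m, b], continuous G} -> {within `[m, b], continuous H} ->
  win m b (fun t => x * F t + y * G t) H = x * win m b F H + y * win m b G H.
Proof.
move=> mb cF cG cH; have mS := measurable_square m b.
have i1 := window_integrable mb cF cH; have i2 := window_integrable mb cG cH.
rewrite /win /window_integral -(RintegralZl x mS i1) -(RintegralZl y mS i2) -RintegralD //.
- by apply: eq_Rintegral => z _; ring.
- have := integrableZl mS x i1; by apply: eq_integrable => // z _ /=; rewrite EFinM.
- have := integrableZl mS y i2; by apply: eq_integrable => // z _ /=; rewrite EFinM.
Qed.

Lemma win_cst m b F G : (forall s t, m <= s <= b -> m <= t <= b -> F t = F s) -> win m b F G = 0.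
Proof.
move=> cF; transitivity (\int[(leb \x leb)%E]_(z in `[m, b] `*` `[m, b]) (cst 0 z : R)); last first.
  by rewrite Rintegral_cst ?mul0r //; exact: measurable_square.
apply: eq_Rintegral => z; rewrite inE /= => -[]; rewrite /= !in_itv /= => z1 z2.
by rewrite (cF z.2 z.1) // subrr mul0r.
Qed.

Lemma near_seg F m b (t e : R) : m < b -> {within `[m, b], continuous F} -> m <= t <= b -> 0 < e ->
  exists l r : R, [/\ m <= l, l < r, r <= b & forall s, l <= s <= r -> `|F s - F t| < e].
Proof.
move=> mb cF /andP[mt tb] e0.
have /cvg_withinP /(_ e e0) [d d0 hd] : F y @[y --> within `[m, b] (nbhs t)] --> F t.
  by apply: (wcontP _ _).1 => //; rewrite /= in_itv /= mt tb.
have [tb'|bt] := ltP t b.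
  exists t, (Num.min b (t + d / 2)); split=> //.
  - by rewrite lt_min tb' ltrDl divr_gt0.
  - by rewrite ge_min lexx.
  move=> s /andP[h1]; rewrite le_min => /andP[h2 h3]; apply: hd.
    by rewrite /= in_itv /=; apply/andP; split; lra.
  by rewrite ger0_norm; lra.
exists (Num.max m (t - d / 2)), t; split=> //.
- by rewrite le_max lexx.
- by rewrite gt_max; apply/andP; split; lra.
move=> s; rewrite ge_max => /andP[/andP[h1 h2] h3]; apply: hd.
  by rewrite /= in_itv /=; apply/andP; split; lra.
by rewrite ler0_norm; lra.
Qed.

(** If [F] took two different values, increments of modulus at least [2 e] would fill a rectangle of
    positive area, [e] being a quarter of the gap. [near_seg] supplies its sides, at the end points
    of the window as well. *)
Lemma win_eq0 m b F : m < b -> {within `[m, b], continuous F} -> win m b F F = 0 ->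
  forall s t, m <= s <= b -> m <= t <= b -> F t = F s.
Proof.
move=> mb cF w0 s t hs ht; apply/eqP/contraT => ne; exfalso.
pose e := `|F t - F s| / 4.
have e0 : 0 < e by rewrite divr_gt0 // normr_gt0 subr_eq0.
have [l1 [r1 [ml1 lr1 rb1 h1]]] := near_seg mb cF ht e0.
have [l2 [r2 [ml2 lr2 rb2 h2]]] := near_seg mb cF hs e0.
have mS := measurable_square m b.
have mA : measurable (`[l1, r1]%classic : set TR) by exact: measurable_itv.
have mB : measurable (`[l2, r2]%classic : set TR) by exact: measurable_itv.
have iF := window_integrable mb cF cF.
pose sq := EFin \o (fun z : TR * TR => (F z.1 - F z.2) * (F z.1 - F z.2)).
have sq0 z : (0 <= sq z)%E by rewrite lee_fin -expr2 sqr_ge0.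
have msq := measurable_int _ iF.
have mAB : measurable (`[l1, r1]%classic `*` `[l2, r2]%classic : set (TR * TR)) by exact: measurableX.
have sub : (`[l1, r1]%classic `*` `[l2, r2]%classic : set (TR * TR)) `<=` `[m, b]%classic `*` `[m, b]%classic .
  move=> z []; rewrite /= !in_itv /= => /andP[? ?] /andP[? ?].
  by split; apply/andP; split; lra.
have I0 : (\int[(leb \x leb)%E]_(z in `[m, b] `*` `[m, b]) sq z)%E = 0%E.
  have fin := integrable_fin_num mS iF.
  by rewrite -(fineK fin); congr EFin.
have := ge0_subset_integral (leb \x leb)%E mAB mS msq (fun z _ => sq0 z) sub.
rewrite I0.
have : (((2 * e) ^+ 2)%:E * ((leb \x leb)%E (`[l1, r1]%classic `*` `[l2, r2]%classic)) <=
  \int[(leb \x leb)%E]_(z in `[l1, r1]%classic `*` `[l2, r2]%classic) sq z)%E.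
  rewrite -integral_cst //; apply: ge0_le_integral => //.
  - by move=> z _; rewrite lee_fin sqr_ge0.
  - exact: measurable_funS msq.
  move=> z []; rewrite /= !in_itv /= => /h1 k1 /h2 k2; rewrite lee_fin -expr2.
  rewrite -[leRHS]real_normK ?num_real // ler_sqr ?nnegrE ?normr_ge0 ?mulr_ge0 ?(ltW e0) //.
  have e4 : `|F t - F s| = 4 * e by rewrite /e; lra.
  have -> : F z.1 - F z.2 = (F t - F s) - ((F t - F z.1) - (F s - F z.2)) by lra.
  apply: le_trans (lerB_dist _ _); rewrite e4.
  have := ler_normB (F t - F z.1) (F s - F z.2); rewrite (distrC (F t)) (distrC (F s)) => h.
  lra.
move=> /le_trans H /H {H}.
rewrite measure_rectangle // -!EFinM lee_fin.
have e20 : 0 < (2 * e) ^+ 2 by rewrite exprn_gt0 // mulr_gt0.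
by rewrite leNgt (mulr_gt0 e20) // mulr_gt0 // subr_gt0.
Qed.
End window.

(** * The least-squares test for the parameters *)

Section identification.
Context {R : realType}.
Notation leb := (@lebesgue_measure R).
Implicit Types (F G f U V : R -> R) (a b m s t : R) (u : R -> R -> R).

Lemma wcont_oo_eq0 f a b : a < b -> {within `[a, b], continuous f} ->
  (forall t, a < t < b -> f t = 0) -> forall t, a <= t <= b -> f t = 0.
Proof.
move=> ab cf f0 t ht; apply/eqP/contraT => ne; exfalso.
have e0 : 0 < `|f t| by rewrite normr_gt0.
have [l [r [al lr rb h]]] := near_seg ab cf ht e0.
have : l <= (l + r) / 2 <= r by apply/andP; split; lra.
by move=> /h; rewrite f0 ?sub0r ?normrN ?ltxx //; apply/andP; split; lra.
Qed.

Lemma oint_primitive f F a b s t : primitive_on f F a b ->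
  a <= s <= b -> a <= t <= b -> oint s t f = F t - F s.
Proof.
move=> [_ h] /andP[as_ sb] /andP[at_ tb]; rewrite /oint.
by case: (leP s t) => st; rewrite h ?(ltW st) //; lra.
Qed.

Lemma eq_window m b (F G F' G' : R -> R -> R) :
  (forall t s, m <= t <= b -> m <= s <= b -> F t s = F' t s /\ G t s = G' t s) ->
  window_integral m b F G = window_integral m b F' G'.
Proof.
move=> h; apply: eq_Rintegral => z; rewrite inE /= => -[]; rewrite /= !in_itv /= => z1 z2.
by have [-> ->] := h _ _ z1 z2.
Qed.

Variables (p theta c : R).
Hypotheses (p0 : 0 < p) (c0 : 0 < c).

(** One interval between events. The function [g] says that [U] extends continuously to the right
    end, where the control itself may jump. *)
Definition piece s t u U := [/\ s < t,
  plant p theta [set r | s <= r <= t] [set r | s < r < t] (fun r => c * U r) u &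
  exists2 g, {within `[s, t], continuous g} & forall r, s <= r < t -> U r = g r].

Let kap (n : nat) : R := (-1) ^+ n * p * n%:R * pi.

Lemma kap_neq0 n : (0 < n)%N -> kap n != 0.
Proof.
move=> n0; rewrite /kap !mulf_neq0 ?signr_eq0 // ?gt_eqF ?ltr0n ?pi_gt0 //.
Qed.

Variables (u : R -> R -> R) (U : R -> R) (tau : nat -> R) (j k : nat).
Hypothesis jk : (j < k)%N.
Hypothesis tau_j : 0 <= tau j.
Hypothesis uC : C0_L2 [set t | 0 <= t] u.
Hypothesis pc : forall i, (j <= i < k)%N -> piece (tau i) (tau i.+1) u U.
Let m := tau j.
Let b := tau k.
Let Y n t := sin_mode n (u t).

Lemma tau_mono i l : (j <= i <= l)%N -> (l <= k)%N -> tau i <= tau l.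
Proof.
move=> /andP[ji]; elim: l => [|l IH]; first by rewrite leqn0 => /eqP->.
rewrite leq_eqVlt => /orP[/eqP-> //|]; rewrite ltnS => il lk.
have lk' : (j <= l < k)%N by rewrite (leq_trans ji il) lk.
by apply: le_trans (IH il (ltnW lk)) _; have [/ltW] := pc lk'.
Qed.

Lemma tau_seg i t : (j <= i < k)%N -> tau i <= t <= tau i.+1 -> m <= t <= b.
Proof.
move=> /andP[ji ik] /andP[h1 h2]; apply/andP; split.
  by apply: le_trans h1; apply: tau_mono; rewrite ?leqnn ?ji // ltnW.
by apply: le_trans h2 _; apply: tau_mono => //; rewrite (leq_trans ji) // ik.
Qed.

Lemma window_lt : m < b.
Proof.
have [|h _ _] := pc (i := j); first by rewrite leqnn.
by apply: lt_le_trans h _; apply: tau_mono => //; rewrite leqnSn.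
Qed.

Lemma wcont_piece f i : (j <= i < k)%N -> {within `[m, b], continuous f} ->
  {within `[tau i, tau i.+1], continuous f}.
Proof.
by move=> ik; apply: wcont_sub_seg => t /(tau_seg ik); rewrite /= in_itv.
Qed.

Lemma pieces_primitive f F l : (j < l <= k)%N ->
  (forall i, (j <= i < k)%N -> primitive_on f F (tau i) (tau i.+1)) -> primitive_on f F m (tau l).
Proof.
move=> jl h; elim: l jl => // l IH /andP[]; rewrite ltnS leq_eqVlt => /orP[/eqP<-|jl] lk.
  by apply: h; rewrite leqnn.
apply: (primitive_on_cat (m := tau l)); last by apply: h; rewrite ltnW.
- by apply: tau_mono; rewrite ?leqnn /= ltnW.
- by apply: tau_mono => //; rewrite ltnW //=.
- by apply: IH; rewrite jl ltnW.
Qed.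

Lemma pieces_derive0 F : {within `[m, b], continuous F} ->
  (forall i t, (j <= i < k)%N -> tau i < t < tau i.+1 -> is_derive t 1 F 0) ->
  forall t, m <= t <= b -> F t = F m.
Proof.
move=> cF dF; have : (j <= k <= k)%N by rewrite leqnn ltnW.
rewrite /b; move: {1 2 4}k => l; elim: l => [|l IH].
  rewrite leqn0 => /andP[/eqP j0 _] t; rewrite /m j0 => h; by rewrite (le_anti h).
move=> /andP[]; rewrite leq_eqVlt => /orP[/eqP<- _ t h|jl lk t /andP[mt tl]].
  by rewrite -(le_anti h).
have jlk : (j <= l <= k)%N by rewrite -ltnS jl ltnW.
have [tl'|lt] := leP t (tau l); first by apply: IH; rewrite ?mt.
have il : (j <= l < k)%N by rewrite -ltnS jl.
rewrite -(IH jlk (tau l)); last by rewrite lexx andbT; apply: tau_mono; rewrite ?leqnn //; case/andP: jlk.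
apply: (derive0_cst (ltW lt)).
  apply: (wcont_sub_seg _ (wcont_piece il cF)) => x /andP[h1 h2].
  by rewrite /= in_itv /= h1 (le_trans h2).
by move=> x /andP[h1 h2]; apply: (dF l) => //; rewrite h1 (lt_le_trans h2).
Qed.

Lemma wcont_mode n : {within `[m, b], continuous (Y n)}.
Proof.
have h : forall x, m <= x <= b -> [set r | 0 <= r] x by move=> x /andP[h _]; exact: le_trans h.
exact: (wcont_sub_seg h (C0_L2_sin_mode (n := n) uC)).
Qed.

(** A primitive of the piecewise continuous [U] is found by solving the mode equation for it: it is
    a combination of [Ga n] and of the mode itself, both continuous across events. Every [n > 0]
    gives the same increments, so mode 1 is used for [V]. *)
Lemma window_data : exists (Ga : nat -> R -> R) V,
  [/\ forall n, {within `[m, b], continuous (Ga n)} /\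
        forall t, m < t < b -> is_derive t 1 (Ga n) (Y n t),
      {within `[m, b], continuous V} /\
        forall i t, (j <= i < k)%N -> tau i < t < tau i.+1 -> is_derive t 1 V (U t),
      forall n, primitive_on (Y n) (Ga n) m b, primitive_on U V m b &
      forall n, (0 < n)%N -> forall s t, m <= s <= b -> m <= t <= b ->
        Y n t - Y n s = (theta - p * (n%:R * pi) ^+ 2) * (Ga n t - Ga n s)
                        - kap n * c * (V t - V s)].
Proof.
have [Ga hG] := choice (fun n => primitive_exists window_lt (wcont_mode (n := n))).
have [V VE] : exists V : nat -> R -> R, forall n, V n = fun t =>
    (kap n * c)^-1 * ((theta - p * (n%:R * pi) ^+ 2) * Ga n t - Y n t) by eexists.
have cV n : {within `[m, b], continuous (V n)}.
  by rewrite VE; apply: wcontZ; apply: wcontB; [apply: wcontZ; have [] := hG n|exact: wcont_mode].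
have dV n i t : (0 < n)%N -> (j <= i < k)%N -> tau i < t < tau i.+1 -> is_derive t 1 (V n) (U t).
  move=> n0 ik ht; have [_ pu _] := pc ik.
  have dY := plant_sin_mode n (nbhd_oo (a := tau i) (c := tau i.+1)) pu ht.
  have mt : m < t < b.
    have := tau_seg (t := tau i) ik; have := tau_seg (t := tau i.+1) ik.
    by rewrite !lexx andbT /=; case/andP: ht => h1 h2 H1 H2; apply/andP; split; lra.
  have dG := (hG n).2 _ mt.
  rewrite VE; have := is_deriveZx (kap n * c)^-1 (is_deriveBx (is_deriveZx (theta - p * (n%:R * pi) ^+ 2) dG) dY).
  suff -> : (kap n * c)^-1 * ((theta - p * (n%:R * pi) ^+ 2) * Y n t -
     ((theta - p * (n%:R * pi) ^+ 2) * sin_mode n (u t) - (-1) ^+ n * p * (n%:R * pi) * (c * U t))) = U t by [].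
  rewrite /Y (mulrA _ n%:R pi) -/(kap n); field.
  by rewrite kap_neq0 // gt_eqF.
have pV n : (0 < n)%N -> primitive_on U (V n) m b.
  move=> n0; apply: pieces_primitive; first by rewrite jk leqnn.
  move=> i ik; have [tt _ [g cg Ug]] := pc ik.
  have Ug' x : tau i < x < tau i.+1 -> g x = U x by move=> /andP[h1 h2]; rewrite Ug // (ltW h1).
  apply: (primitive_onP (ltW tt) (wcont_piece ik (cV n)) cg _ Ug') => x hx.
  by rewrite Ug' //; exact: (dV n i).
exists Ga, (V 1%N); split; first exact: hG.
- by split; [exact: cV|move=> i t; exact: dV].
- move=> n; have [h1 h2] := hG n.
  exact: (primitive_onP (ltW window_lt) h1 (wcont_mode (n := n)) h2).
- exact: pV.
move=> n n0 s t hs ht.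
have e : V n t - V n s = V 1%N t - V 1%N s.
  by rewrite -!(oint_primitive (pV _ _)).
rewrite -e !VE; field.
by rewrite kap_neq0 // gt_eqF.
Qed.

(* A parameter pair passes the test iff theta - q.1 and c - q.2 annihilate every difference of the
   primitives of the modes and of the control; comparing the growth in n of the two terms
   of the differentiated identity decouples the two conditions. *)
Lemma param_setP q : param_set p u U m b q <->
  (q.1 = theta \/ forall i n t, (j <= i < k)%N -> (0 < n)%N -> tau i <= t <= tau i.+1 ->
     sin_mode n (u t) = 0) /\
  (q.2 = c \/ forall i t, (j <= i < k)%N -> tau i <= t < tau i.+1 -> U t = 0).
Proof.
have [Ga [V [hG [cV dV] pG pV idY]]] := window_data.
have mb := window_lt.
pose J n t := - kap n * V t.
have cJ n : {within `[m, b], continuous (J n)} by apply: wcontZ.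
have cG n : {within `[m, b], continuous (Ga n)} by have [] := hG n.
(* The mode equation integrated in time: [f_n] is the increment of [Phi n], because the term in
   [n^2 pi^2 p] of its definition cancels the diffusion. *)
pose Phi n t := theta * Ga n t + c * J n t.
have eqs n : (0 < n)%N -> forall t s, m <= t <= b -> m <= s <= b ->
   [/\ f_data p u n t s = Phi n t - Phi n s, g_data u n t s = Ga n t - Ga n s &
       j_data p U n t s = J n t - J n s].
  move=> n0 t s ht hs.
  have eg : g_data u n t s = Ga n t - Ga n s by rewrite /g_data (oint_primitive (pG n)).
  have ej : j_data p U n t s = J n t - J n s.
    by rewrite /j_data (oint_primitive pV) // /J /kap; ring.
  split=> //; rewrite /f_data eg sin_modeB; [|apply: uC.1..]; last 2 first.
  - by rewrite /=; apply: le_trans tau_j _; case/andP: ht.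
  - by rewrite /=; apply: le_trans tau_j _; case/andP: hs.
  by rewrite -/(Y n t) -/(Y n s) idY // /Phi /J; ring.
(* The residual of the pair [q]. The test makes its increments orthogonal to those of [Ga n] and
   [J n]; as a combination of the two it is orthogonal to itself, hence constant. *)
pose E n t := (theta - q.1) * Ga n t + (c - q.2) * J n t.
have cE n : {within `[m, b], continuous (E n)} by apply: wcontD; exact: wcontZ.
have winE n H : {within `[m, b], continuous H} -> win m b (E n) H =
    win m b (Phi n) H - (q.1 * win m b (Ga n) H + q.2 * win m b (J n) H).
  by move=> cH; rewrite !win_lin //; ring.
have iff1 : param_set p u U m b q <-> (forall n, (0 < n)%N -> forall s t,
    m <= s <= b -> m <= t <= b -> E n t = E n s).
  have wE n : (0 < n)%N ->
    [/\ window_integral m b (f_data p u n) (g_data u n) = win m b (Phi n) (Ga n),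
        window_integral m b (f_data p u n) (j_data p U n) = win m b (Phi n) (J n),
        window_integral m b (g_data u n) (g_data u n) = win m b (Ga n) (Ga n),
        window_integral m b (g_data u n) (j_data p U n) = win m b (Ga n) (J n) &
        window_integral m b (j_data p U n) (j_data p U n) = win m b (J n) (J n)].
    by move=> n0; split; apply: eq_window => t s ht hs; have [e1 e2 e3] := eqs n n0 t s ht hs; rewrite ?e1 ?e2 ?e3.
  split=> h n n0.
    have [] := h n n0; rewrite /=; have [-> -> -> -> ->] := wE n n0 => h1 h2.
    apply: (win_eq0 mb (cE n)).
    have w1 : win m b (E n) (Ga n) = 0.
      by rewrite winE // h1 (win_sym m b (J n)); ring.
    have w2 : win m b (E n) (J n) = 0 by rewrite winE // h2; ring.
    transitivity ((theta - q.1) * win m b (Ga n) (E n) + (c - q.2) * win m b (J n) (E n)).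
      exact: win_lin.
    by rewrite !(win_sym m b _ (E n)) w1 w2 !mulr0 addr0.
  rewrite /=; have [-> -> -> -> ->] := wE n n0.
  have w0 H : win m b (E n) H = 0 by apply: win_cst; exact: h.
  have := winE n _ (cG n); have := winE n _ (cJ n); rewrite !w0 (win_sym m b (J n) (Ga n)).
  by move=> h1 h2; split; lra.
rewrite iff1; split=> [h|[h1 h2] n n0 s t hs ht].
  have key i n t : (j <= i < k)%N -> (0 < n)%N -> tau i < t < tau i.+1 ->
      (theta - q.1) * Y n t = (c - q.2) * U t * kap n.
    move=> ik n0 /andP[it ti].
    have tm : m < t < b.
      have := tau_seg (t := tau i) ik; have := tau_seg (t := tau i.+1) ik.
      by rewrite !lexx andbT /= => H1 H2; apply/andP; split; lra.
    have dE : is_derive t 1 (E n) ((theta - q.1) * Y n t + (c - q.2) * (- kap n * U t)).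
      apply: is_deriveDx; apply: is_deriveZx; first by have [_] := hG n; apply.
      by apply: is_deriveZx; apply: (dV i) => //; rewrite it.
    have d0 : 0 < Num.min (t - m) (b - t) by rewrite lt_min !subr_gt0.
    have dE0 : is_derive t 1 (E n) 0.
      apply: (is_derive_eqnear d0 (f := cst (E n t))) => y; rewrite lt_min !ltr_norml => /andP[/andP[y1 _] /andP[_ y2]].
      have my : m <= y by lra.
      have yb : y <= b by lra.
      by case/andP: tm => tm1 tm2; apply: h => //; rewrite ?my // !ltW.
    have := is_derive_unique dE dE0; lra.
  (* In [key] the modes are bounded by the norm of [u t], uniformly in [n], while [kap n] grows
     linearly. Hence the coefficient [(c - q.2) * U t] is 0, and with it the left side. *)
  have U0 i t : (j <= i < k)%N -> tau i < t < tau i.+1 -> (c - q.2) * U t = 0.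
    move=> ik ht; apply/eqP/contraT => ne; exfalso.
    have t0 : 0 <= t.
      case/andP: ht => h1 h2; have : tau i <= t <= tau i.+1 by rewrite !ltW.
      by move=> /(tau_seg ik) /andP[h3 _]; exact: le_trans h3.
    pose A := `|theta - q.1| * L2norm (u t); pose B := `|(c - q.2) * U t| * (p * pi).
    have B0 : 0 < B by rewrite mulr_gt0 ?normr_gt0 // mulr_gt0 // pi_gt0.
    have bd n : (0 < n)%N -> B * n%:R <= A.
      move=> n0; have := congr1 Num.norm (key i n t ik n0 ht).
      have -> : `|(c - q.2) * U t * kap n| = B * n%:R.
        rewrite /kap !normrM normrX normrN1 expr1n (gtr0_norm p0) normr_nat (gtr0_norm (pi_gt0 R)) /B normrM.
        by ring.
      move=> <-; rewrite normrM ler_wpM2l //.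
      by apply: sin_mode_le; apply: uC.1.
    have := bd (Num.truncn (A / B)).+1 isT.
    by rewrite leNgt -ltr_pdivrMl // mulrC truncnS_gt.
  split.
    have [|ne] := eqVneq q.1 theta; first by left.
    right=> i n t ik n0 ht.
    have [tt _ _] := pc ik.
    apply: (wcont_oo_eq0 tt (wcont_piece ik (wcont_mode (n := n)))) ht => s hs.
    have := key i n s ik n0 hs; rewrite (U0 i s) // mul0r => /eqP.
    by rewrite mulf_eq0 subr_eq0 eq_sym (negbTE ne) => /eqP.
  have [|ne] := eqVneq q.2 c; first by left.
  right=> i t ik ht.
  have [tt _ [g cg Ug]] := pc ik; rewrite Ug //.
  apply: (wcont_oo_eq0 tt cg); last by case/andP: ht => -> /ltW.
  move=> s hs; rewrite -Ug; last by case/andP: hs => /ltW ->.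
  have /eqP := U0 i s ik hs.
  by rewrite mulf_eq0 subr_eq0 eq_sym (negbTE ne) => /eqP.
have gE : forall t, m <= t <= b -> (theta - q.1) * Ga n t = (theta - q.1) * Ga n m.
  move=> {ht}t ht; case: h1 => [->|Y0]; first by rewrite subrr !mul0r.
  congr (_ * _); apply: (pieces_derive0 (cG n)) ht => i r ik hr.
  have <- : Y n r = 0 by apply: (Y0 i) => //; case/andP: hr => h3 h4; rewrite !ltW.
  apply: (hG n).2.
  have := tau_seg (t := tau i) ik; have := tau_seg (t := tau i.+1) ik.
  by case/andP: hr => h3 h4; rewrite !lexx andbT /= => H1 H2; apply/andP; split; lra.
have vE : forall t, m <= t <= b -> (c - q.2) * V t = (c - q.2) * V m.
  move=> {ht gE}t ht; case: h2 => [->|V0]; first by rewrite subrr !mul0r.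
  congr (_ * _); apply: (pieces_derive0 cV) ht => i r ik hr.
  have <- : U r = 0 by apply: (V0 i) => //; case/andP: hr => h3 h4; rewrite ltW.
  exact: (dV i).
rewrite /E /J !gE // !(mulrCA (c - q.2)) !vE //.
Qed.

End identification.

(** * The closed loop *)

Section gluing.
Context {R : realType}.
Implicit Types (s t x : R) (u v w : R -> R -> R) (J : set R) (f g : R -> R).

(** The value at [t1] is that of [v]: a profile at the end of an interval is regular, whereas [w t1]
    is only a representative of an initial class. *)
Definition glue t1 v w t : R -> R := if t <= t1 then v t else w t.

Lemma glue_le t1 v w t : t <= t1 -> glue t1 v w t = v t.
Proof. by rewrite /glue => ->. Qed.

Lemma glue_gt t1 v w t : t1 < t -> glue t1 v w t = w t.
Proof. by rewrite /glue leNgt => ->. Qed.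

Lemma C0_L2_glue t1 J J' v w : J t1 -> J' t1 -> (forall t, t1 <= t -> J t -> J' t) ->
  C0_L2 J v -> C0_L2 J' w -> eqL2 (v t1) (w t1) -> C0_L2 J (glue t1 v w).
Proof.
move=> J1 J'1 JJ' /C0_L2P[v1 v2] /C0_L2P[w1 w2] vw; apply/C0_L2P; split.
  by move=> t Jt; rewrite /glue; case: leP => tt; [exact: v1|apply: w1; apply: JJ' => //; exact: ltW].
move=> t Jt e e0; have [tt|tt|->] := ltgtP t t1.
- have [d d0 h] := v2 t Jt e e0; exists (Num.min d (t1 - t)); first by rewrite lt_min d0 subr_gt0.
  move=> s Js; rewrite lt_min => /andP[h1 h2].
  have st : s <= t1 by move: h2; rewrite ltr_norml; lra.
  by rewrite !glue_le ?(ltW tt) //; exact: h.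
- have J't := JJ' t (ltW tt) Jt.
  have [d d0 h] := w2 t J't e e0; exists (Num.min d (t - t1)); first by rewrite lt_min d0 subr_gt0.
  move=> s Js; rewrite lt_min => /andP[h1 h2].
  have st : t1 < s by move: h2; rewrite ltr_norml; lra.
  by rewrite !glue_gt //; apply: h => //; apply: JJ' => //; exact: ltW.
have [d1 d10 h1] := v2 t1 J1 e e0; have [d2 d20 h2] := w2 t1 J'1 e e0.
exists (Num.min d1 d2); first by rewrite lt_min d10.
move=> s Js; rewrite lt_min => /andP[k1 k2]; rewrite (glue_le _ _ (lexx t1)).
have [st|st] := leP s t1; first by rewrite glue_le //; exact: h1.
have J's := JJ' s (ltW st) Js.
rewrite glue_gt //; have <- : L2norm (w s \- w t1) = L2norm (w s \- v t1); last exact: h2.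
apply: eqL2_L2norm; [by apply: inL2B; exact: w1|by apply: inL2B; [exact: w1|exact: v1]|].
by apply: eqL2B; [exact: eqL2_refl|exact: eqL2_sym].
Qed.

Lemma deriv_within_local (A B : set R) f g x (l d : R) : 0 < d -> f x = g x ->
  (forall y, A y -> `|y - x| < d -> B y /\ f y = g y) ->
  deriv_within B g x l -> deriv_within A f x l.
Proof.
move=> d0 fg h /deriv_withinP H; apply/deriv_withinP => e /H [d' d'0 {}H].
exists (Num.min d d'); first by rewrite lt_min d0.
move=> y Ay yx; rewrite lt_min => /andP[k1 k2].
by have [By ->] := h y Ay k1; rewrite fg; exact: H.
Qed.

Lemma wcont_local (T : topologicalType) (A : set T) (h : T -> R) :
  (forall z, A z -> exists B h', [/\ B z, {within B, continuous h'}, h z = h' z &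
     \forall y \near z, A y -> B y /\ h y = h' y]) ->
  {within A, continuous h}.
Proof.
move=> H; apply/subspace_continuousP => z Az; have [B [h' [Bz ch hz nz]]] := H z Az.
have /subspace_continuousP /(_ z Bz) c' := ch.
move=> U nU; have {}nU : nbhs (h' z) U by rewrite -hz.
have c'' : \forall y \near z, B y -> U (h' y) := c' U nU.
change (\forall y \near z, A y -> U (h y)).
apply: (@filterS T (nbhs z) _ _ _ _ (filterI c'' nz)) => y [hB hA] Ay.
by have [By] := hA Ay; rewrite /= => ->; exact: hB.
Qed.

Lemma wcont_glue t1 (J J' : set R) (Z : set R) v w :
  (forall t, J t -> t < t1) -> (forall t, J' t -> t1 < t) ->
  {within J `*` Z, continuous (fun z : R * R => v z.1 z.2)} ->
  {within J' `*` Z, continuous (fun z : R * R => w z.1 z.2)} ->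
  {within (J `|` J') `*` Z, continuous (fun z : R * R => glue t1 v w z.1 z.2)}.
Proof.
move=> hJ hJ' cv cw; apply: wcont_local => -[t x] [/= Jt Zx].
have near1 (O : set R) : open O -> O t -> \forall y \near (t, x), O (y.1 : R).
  move=> oO Ot; apply: (@cvg_fst _ _ (nbhs t) (nbhs x) _ O).
  exact: open_nbhs_nbhs.
case: Jt => Jt.
  have tt := hJ _ Jt; exists (J `*` Z), (fun z => v z.1 z.2); split=> //.
    by rewrite /= glue_le // ltW.
  have n1 := near1 [set s | s < t1] (open_lt (y := t1)) tt.
  apply: (filterS _ n1) => -[s y] /= st [[Js|/hJ' Js] Zy].
    by rewrite glue_le // ltW.
  by have := lt_trans st Js; rewrite ltxx.
have tt := hJ' _ Jt; exists (J' `*` Z), (fun z => w z.1 z.2); split=> //.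
  by rewrite /= glue_gt.
have n1 := near1 [set s | t1 < s] (open_gt (y := t1)) tt.
apply: (filterS _ n1) => -[s y] /= st [[/hJ Js|Js] Zy].
  by have := lt_trans st Js; rewrite ltxx.
by rewrite glue_gt.
Qed.

Lemma C1_on_glue t1 J J' v w : (forall t, J t -> t < t1) -> (forall t, J' t -> t1 < t) ->
  C1_on J v -> C1_on J' w -> C1_on (J `|` J') (glue t1 v w).
Proof.
move=> hJ hJ' [vt [vx [v1 v2 v3 v4]]] [wt [wx [w1 w2 w3 w4]]].
exists (glue t1 vt wt), (glue t1 vx wx); split; [|exact: wcont_glue..].
move=> t x [Jt|Jt] xI.
  have tt := hJ _ Jt; rewrite !(glue_le _ _ (ltW tt)).
  have [d1 d2] := v1 t x Jt xI; split=> //.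
  apply: (deriv_within_local (d := t1 - t) _ _ _ d1); rewrite ?subr_gt0 ?glue_le ?ltW //.
  move=> s [Js _|/hJ' Js]; first by rewrite glue_le // ltW // hJ.
  by rewrite ltr_norml => /andP[_ h]; exfalso; lra.
have tt := hJ' _ Jt; rewrite !(glue_gt _ _ tt).
have [d1 d2] := w1 t x Jt xI; split=> //.
apply: (deriv_within_local (d := t - t1) _ _ _ d1); rewrite ?subr_gt0 ?glue_gt //.
move=> s [/hJ Js|Js _]; last by rewrite glue_gt // hJ'.
by rewrite ltr_norml => /andP[h _]; exfalso; lra.
Qed.

Lemma pde_at_local p theta u v t x (d : R) : 0 < d -> (forall s, `|s - t| < d -> u s = v s) ->
  pde_at p theta v t x -> pde_at p theta u t x.
Proof.
move=> d0 h; rewrite /pde_at (h t) ?subrr ?normr0 // => <-.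
rewrite !derive1E; apply: near_eq_derive.
apply/nbhs_ballP; exists d => // s hs.
by rewrite h // distrC.
Qed.

End gluing.

(** * Euclidean projection onto a product *)

Section projection.
Context {R : realType}.
Implicit Types (x y q : R * R) (P Q : Prop).

(** The set is a product whose factors are a point or the whole line, so the nearest point exists,
    is unique, and is found coordinate by coordinate. *)
Lemma is_proj_prod (S : set (R * R)) P Q (th c : R) x y :
  (forall q, S q <-> (q.1 = th \/ P) /\ (q.2 = c \/ Q)) ->
  is_proj S x y <-> y = (if `[< P >] then x.1 else th, if `[< Q >] then x.2 else c).
Proof.
move=> SE; set z := (X in y = X).
have zS : S z by apply/SE; rewrite /z /=; split; case: asboolP => h; by [right|left].
have comp (X Z B : R) : Z = X \/ B = Z ->
    (X - Z) ^+ 2 <= (X - B) ^+ 2 /\ ((X - B) ^+ 2 <= (X - Z) ^+ 2 -> B = Z).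
  case=> [->|->//]; rewrite subrr expr0n /=; split; first exact: sqr_ge0.
  move=> h; have /eqP : (X - B) ^+ 2 = 0 by apply/le_anti; rewrite h sqr_ge0.
  by rewrite sqrf_eq0 subr_eq0 => /eqP.
have zE b : S b -> (z.1 = x.1 \/ b.1 = z.1) /\ (z.2 = x.2 \/ b.2 = z.2).
  by move=> /SE[[h1|h1] [h2|h2]]; rewrite /z /=; split; case: asboolP => h; by [left|right].
split=> [[yS ym]|->].
  have [/comp[a1 b1] /comp[a2 b2]] := zE y yS.
  have := ym z zS; rewrite /eucl_dist ler_psqrt ?nnegrE ?addr_ge0 ?sqr_ge0 // => le.
  have pe (w w' : R * R) : w.1 = w'.1 -> w.2 = w'.2 -> w = w'.
    by case: w w' => [? ?] [? ?] /= -> ->.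
  by apply: pe; [apply: b1|apply: b2]; lra.
split=> // b /zE[/comp[a1 _] /comp[a2 _]].
by apply: ler_wsqrtr; apply: lerD.
Qed.

End projection.

(** * Trajectories along which the control vanishes *)

Section silent.
Context {R : realType}.
Implicit Types (t x : R) (u v : R -> R -> R).

(* Applying the operators [d/dt - D j], [j != i], to the sum kills every term but the i-th. *)
Lemma exp_indep (m : nat) (D : 'I_m -> R) (g : 'I_m -> R -> R) (a b : R) : injective D ->
  (forall i t, a < t < b -> is_derive t 1 (g i) (D i * g i t)) ->
  (forall t, a < t < b -> \sum_i g i t = 0) ->
  forall i t, a < t < b -> g i t = 0.
Proof.
move=> Di dg g0 i t ht.
have key (l : seq 'I_m) : forall t, a < t < b -> \sum_k \prod_(j <- l) (D k - D j) * g k t = 0.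
  elim: l => [|j l IH] r hr.
    by rewrite -[RHS](g0 r hr); apply: eq_bigr => k _; rewrite big_nil mul1r.
  have d1 : is_derive r 1 (fun s => \sum_k \prod_(j <- l) (D k - D j) * g k s)
      (\sum_k \prod_(j <- l) (D k - D j) * (D k * g k r)).
    by apply: is_derive_sumx => k; apply: is_deriveZx; exact: dg.
  have d0 : is_derive r 1 (fun s => \sum_k \prod_(j <- l) (D k - D j) * g k s) 0.
    have e0 : 0 < Num.min (r - a) (b - r) by rewrite lt_min !subr_gt0.
    apply: (is_derive_eqnear e0 (f := cst 0)) => y; rewrite lt_min !ltr_norml => /andP[/andP[y1 _] /andP[_ y2]].
    by rewrite IH //; apply/andP; split; lra.
  have E := is_derive_unique d1 d0.
  transitivity (\sum_k \prod_(j <- l) (D k - D j) * (D k * g k r) -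
     D j * \sum_k \prod_(j <- l) (D k - D j) * g k r).
    by rewrite mulr_sumr -sumrB; apply: eq_bigr => k _; rewrite big_cons; ring.
  by rewrite E (IH r hr) mulr0 subrr.
have := key [seq j <- enum 'I_m | j != i] t ht.
rewrite (bigD1 i) //= [X in _ + X]big1 ?addr0; last first.
  move=> k ki; rewrite (_ : \prod_(j <- _) _ = 0) ?mul0r //.
  apply/eqP; rewrite prodf_seq_eq0; apply/hasP.
  by exists k; rewrite ?subrr ?eqxx //= mem_filter ki mem_enum.
move/eqP; rewrite mulf_eq0 => /orP[|/eqP//].
rewrite prodf_seq_eq0 => /hasP[j]; rewrite mem_filter => /andP[ji _] /=.
by rewrite subr_eq0 => /eqP /Di ij; rewrite ij eqxx in ji.
Qed.

Variables (p theta : R) (N : R -> nat) (kc : forall th : R, 'rV[R]_(N th)).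
Hypothesis p0 : 0 < p.
Let K th := feedback (nominal_kernel kc) th.
Let rate (n : nat) : R := theta - p * (n%:R * pi) ^+ 2.

(** With zero boundary value each mode is an exponential, and the rates are distinct, so [exp_indep]
    separates the terms of the feedback. Only the products with the gains vanish, since a gain may
    be 0. *)
Lemma silent_modes th (a b : R) (J0 J : set R) u : nbhd_set J -> a < b ->
  (forall t, a <= t <= b -> J0 t) -> (forall t, a < t < b -> J t) ->
  plant p theta J0 J (fun=> 0) u -> (forall t, a < t < b -> K th (u t) = 0) ->
  forall i t, a <= t <= b -> kc th 0 i * sin_mode i.+1 (u t) = 0.
Proof.
move=> nJ ab J0s Js pu K0 i.
have cY n : {within `[a, b], continuous (fun t => sin_mode n (u t))}.
  exact: (wcont_sub_seg J0s (C0_L2_sin_mode (n := n) (pl_C0 pu))).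
apply: (wcont_oo_eq0 ab); first exact: wcontZ.
pose g (i : 'I_(N th)) t := kc th 0 i * Num.sqrt 2 * sin_mode i.+1 (u t).
have g0 := @exp_indep (N th) (fun i => rate i.+1) g a b.
move=> t ht; have : g i t = 0.
  apply: g0 ht.
  - move=> k l /eqP; rewrite /rate (inj_eq (addrI _)) eqr_opp (inj_eq (mulfI (lt0r_neq0 p0))).
    rewrite eqrXn2 ?mulr_ge0 ?pi_ge0 // (inj_eq (mulIf (lt0r_neq0 (pi_gt0 R)))) eqr_nat eqSS.
    by move/eqP/val_inj.
  - move=> k r hr; have := plant_sin_mode k.+1 nJ pu (Js r hr); rewrite mulr0 subr0 => d.
    apply: (is_derive_eq (is_deriveZx (kc th 0 k * Num.sqrt 2) d)).
    by rewrite /g /rate; ring.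
  move=> r hr; rewrite -[RHS](K0 r hr) /K feedback_modes //.
  by apply: (pl_C0 pu).1; apply: J0s; case/andP: hr => h1 h2; rewrite !ltW.
rewrite /g mulrAC => /eqP; rewrite mulf_eq0 => /orP[/eqP//|].
by rewrite sqrtr_eq0 leNgt ltr0n.
Qed.

(* The products [k_i y_i] themselves solve a linear system. *)
Lemma silent_feedback th (lam a : R) (v : R -> R -> R) :
  boundary_solution p theta a (fun z => lam * K th z) v ->
  (forall i : 'I_(N th), kc th 0 i * sin_mode i.+1 (v a) = 0) ->
  forall t, a <= t -> K th (v t) = 0.
Proof.
move=> /boundary_solution_plant pv v0 t at_.
pose ka i := kc th 0 i * Num.sqrt 2.
pose g (i : 'I_(N th)) t := ka i * sin_mode i.+1 (v t).
have KE r : a <= r -> K th (v r) = \sum_i g i r.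
  by move=> ar; rewrite /K feedback_modes //; exact: (pl_C0 pv).1.
pose A : 'M[R]_(N th) := \matrix_(i, j)
  ((i == j)%:R * rate i.+1 - ka i * ((-1) ^+ i.+1 * p * (i.+1%:R * pi) * lam)).
have Y := @linear_ode_unique R (N th) A g a t.
rewrite KE // big1 // => i _; apply: Y; last by rewrite at_ lexx.
- move=> k; apply: wcontZ; apply: (wcont_sub_seg _ (C0_L2_sin_mode (n := k.+1) (pl_C0 pv))).
  by move=> r /andP[].
- move=> k r /andP[ar rt]; have d := plant_sin_mode k.+1 (nbhd_gt (a := a)) pv ar.
  apply: (is_derive_eq (is_deriveZx (ka k) d)).
  rewrite KE ?ltW //.
  have -> : \sum_j A k j * g j r = \sum_j (k == j)%:R * (rate k.+1 * g k r) -
      ka k * ((-1) ^+ k.+1 * p * (k.+1%:R * pi) * lam) * \sum_j g j r.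
    rewrite mulr_sumr -sumrB; apply: eq_bigr => j _; rewrite !mxE mulrBl; congr (_ - _).
    by have [->|] := eqVneq k j; rewrite ?mul1r ?mul0r.
  have -> : \sum_j (k == j)%:R * (rate k.+1 * g k r) = rate k.+1 * g k r.
    rewrite (bigD1 k) //= eqxx mul1r big1 ?addr0 // => j jk.
    by rewrite eq_sym (negbTE jk) mul0r.
  by rewrite /g /rate; ring.
by move=> k; rewrite /g /ka mulrAC v0 mul0r.
Qed.

End silent.

(** * Structure and uniqueness of closed-loop solutions *)

Section closed_loop_solution.
Context {R : realType}.
Implicit Types (t x r : R) (u v : R -> R -> R) (w : R -> R).
Variables (p theta c T a : R) (N : R -> nat) (kc : forall th : R, 'rV[R]_(N th)) (Rc omb : R -> R).
Hypotheses (p0 : 0 < p) (nom : nominal_feedback p kc Rc omb) (c0 : 0 < c) (T0 : 0 < T) (a0 : 0 < a).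
Let k := nominal_kernel kc.
Let trig := trigger_time p theta c k Rc T a.
Let piece := piece p theta c.

Lemma control_eqL2 th ch w w' : inL2 w -> inL2 w' -> eqL2 w w' ->
  control k th ch w = control k th ch w'.
Proof. by move=> h1 h2 h; rewrite /control /k (feedback_eqL2 kc th h1 h2 h). Qed.

Lemma closed_loop_piece u U (s t th ch : R) : 0 <= s -> s < t -> C0_L2 [set r | 0 <= r] u ->
  C1_on [set r | s < r < t] u ->
  (forall r, s < r < t -> [/\ C2_01 (u r), forall x, 0 < x < 1 -> pde_at p theta u r x,
     u r 0 = 0 & u r 1 = c * U r]) ->
  (forall r, s <= r < t -> U r = control k th ch (u r)) ->
  piece s t u U /\ plant p theta [set r | s <= r <= t] [set r | s < r < t]
     (fun r => c / ch * feedback k th (u r)) u.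
Proof.
move=> s0 st uC uC1 h hU.
have uC' : C0_L2 [set r | s <= r <= t] u.
  by apply: C0_L2_sub uC => r /= /andP[sr _]; exact: le_trans sr.
have pl : plant p theta [set r | s <= r <= t] [set r | s < r < t] (fun r => c * U r) u.
  split=> //.
  - by move=> r /h[].
  - by move=> r x /h[_ H _ _]; exact: H.
  - by move=> r /h[].
  - by move=> r /h[].
split; last first.
  apply: plant_eqb pl => r /= /andP[sr rt].
  by rewrite hU ?rt ?(ltW sr) // /control mulrA.
split=> //; exists (fun r => control k th ch (u r)); last exact: hU.
have h1 : forall r, s <= r <= t -> [set r | s <= r <= t] r by [].
exact: (wcontZ (c := ch^-1) (wcont_sub_seg h1 (C0_L2_feedback (kc := kc) (th := th) uC'))).
Qed.

(** [trigger_exists] proves these bounds for one trigger time, and [trigger_time_unique] carries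
    them to any other. *)
Lemma trigger_next ti w th ch (r : \bar R) (t1 : R) : ch != 0 -> inL2 w -> trig ti w th ch r ->
  t1%:E = Order.min (ti + T)%:E r -> ti < t1 <= ti + T.
Proof.
move=> ch0 hw hr ht1.
have [v [r' [t1' [[_ _ hr'] [e l1 l2 _]]]]] := trigger_exists theta p0 nom c0 T0 a0 ti th ch0 hw.
have rr : r' = r by apply: (trigger_time_unique hw hw (eqL2_refl w) hr' hr).
have -> : t1 = t1' by apply: EFin_inj; rewrite ht1 e rr.
by rewrite l1.
Qed.

(** The update in closed form: by [param_setP] the feasible set is a product, so each estimate is
    kept when its data are silent on the window and becomes exact otherwise. *)
Lemma window_param_proj u U (tau : nat -> R) (i j : nat) (x y : R * R) : (j <= i)%N -> 0 <= tau j ->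
  C0_L2 [set t | 0 <= t] u ->
  (forall l, (j <= l < i.+1)%N -> piece (tau l) (tau l.+1) u U) ->
  is_proj (param_set p u U (tau j) (tau i.+1)) x y <->
  y = (if `[< forall l n t, (j <= l < i.+1)%N -> (0 < n)%N -> tau l <= t <= tau l.+1 ->
                sin_mode n (u t) = 0 >] then x.1 else theta,
       if `[< forall l t, (j <= l < i.+1)%N -> tau l <= t < tau l.+1 -> U t = 0 >]
       then x.2 else c).
Proof.
move=> ji tj uC pc; apply: is_proj_prod => q.
by apply: param_setP => //; rewrite ltnS.
Qed.

Lemma seq_lt (tau : nat -> R) i j : (forall l, tau l < tau l.+1) -> (i < j)%N -> tau i < tau j.
Proof.
move=> h; elim: j => // j IH; rewrite ltnS leq_eqVlt => /orP[/eqP->//|/IH] ij.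
exact: lt_trans (h j).
Qed.

Lemma non_events_between (tau : nat -> R) i t : (forall l, tau l < tau l.+1) -> 0 <= tau i ->
  tau i < t < tau i.+1 -> non_events tau t.
Proof.
move=> h ti /andP[h1 h2]; split; first by apply: le_trans ti (ltW h1).
move=> l; have [li|il] := leqP l i.
  rewrite gt_eqF //; apply: le_lt_trans h1.
  by move: li; rewrite leq_eqVlt => /orP[/eqP->//|/(seq_lt h)/ltW].
rewrite lt_eqF //; apply: lt_le_trans h2 _.
by move: il; rewrite leq_eqVlt => /orP[/eqP->//|/(seq_lt h)/ltW].
Qed.

Section solution.
Variables (Nt : nat) (u0 : R -> R) (th0 ch0 : R).
Let solution := closed_loop p k Rc T a Nt theta c u0 th0 ch0.

Section one.
Variables (tau : nat -> R) (U that chat : R -> R) (u : R -> R -> R).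
Hypothesis sol : solution tau U that chat u.

Lemma solution_events i : [/\ 0 <= tau i, tau i < tau i.+1 & tau i.+1 <= tau i + T].
Proof.
have step l : 0 <= tau l -> tau l < tau l.+1 <= tau l + T.
  move=> tl; have [r [hr ht]] := cl_event sol l.
  by apply: (trigger_next (cl_chat_neq0 sol l) _ hr ht); exact: (cl_C0 sol).1.
have t0 l : 0 <= tau l.
  elim: l => [|l IH]; first by rewrite (cl_tau0 sol).
  by have /andP[h _] := step l IH; exact: le_trans (ltW h).
by have /andP[h1 h2] := step i (t0 i); split.
Qed.

Lemma solution_piece i : piece (tau i) (tau i.+1) u U /\
  plant p theta [set r | tau i <= r <= tau i.+1] [set r | tau i < r < tau i.+1]
     (fun r => c / chat (tau i) * feedback k (that (tau i)) (u r)) u.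
Proof.
have [ti tt _] := solution_events i.
have lt l : tau l < tau l.+1 by have [] := solution_events l.
have ne := non_events_between (i := i) lt ti.
apply: closed_loop_piece => //; first exact: (cl_C0 sol).
- by apply: C1_on_sub (cl_C1 sol) => r; exact: ne.
- move=> r hr; have [u_0 u_1] := cl_bc sol (ne r hr).
  split=> //; [apply: (cl_C2 sol)|by move=> x; apply: (cl_pde sol); exact: ne|].
    by case/andP: hr => h _; exact: le_lt_trans h.
  by apply/eqP; rewrite -subr_eq0 u_1.
by move=> r /(cl_between sol)[].
Qed.

End one.

(** Induction over the events of the first solution, which exhaust the half-line. Those of the
    second coincide with them one by one, so they cannot accumulate either. *)
Lemma solution_unique tau U that chat u tau' U' that' chat' u' :
  solution tau U that chat u -> solution tau' U' that' chat' u' ->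
  (forall t, 0 <= t -> exists i, tau i <= t < tau i.+1) ->
  [/\ forall t, 0 <= t -> that' t = that t, forall t, 0 <= t -> chat' t = chat t &
      same_trajectory u' u].
Proof.
move=> sol sol' cover.
have inu t : 0 <= t -> inL2 (u t) := (cl_C0 sol).1 t.
have inu' t : 0 <= t -> inL2 (u' t) := (cl_C0 sol').1 t.
have key i : [/\ [/\ forall l, (l <= i)%N -> tau' l = tau l, that' (tau i) = that (tau i) &
      chat' (tau i) = chat (tau i)],
    forall t, 0 <= t <= tau i -> eqL2 (u' t) (u t),
    forall t x, 0 < t <= tau i -> 0 <= x <= 1 -> u' t x = u t x &
    forall t, 0 <= t < tau i -> U' t = U t].
  elim: i => [|i [[IH1 IH2 IH3] IH4 IH5 IH6]].
    split; first split.
    - by move=> l; rewrite leqn0 => /eqP->; rewrite (cl_tau0 sol) (cl_tau0 sol').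
    - by rewrite (cl_tau0 sol) (cl_that0 sol) (cl_that0 sol').
    - by rewrite (cl_tau0 sol) (cl_chat0 sol) (cl_chat0 sol').
    - rewrite (cl_tau0 sol) => t /le_anti <-.
      exact: (eqL2_trans (cl_u0 sol') (eqL2_sym (cl_u0 sol))).
    - by rewrite (cl_tau0 sol) => t x /andP[h1 h2]; move: (lt_le_trans h1 h2); rewrite ltxx.
    - by rewrite (cl_tau0 sol) => t /andP[h1 h2]; move: (le_lt_trans h1 h2); rewrite ltxx.
  have [ti tlt _] := solution_events sol i.
  have ei := IH1 i (leqnn i).
  have uu : eqL2 (u' (tau i)) (u (tau i)) by apply: IH4; rewrite ti lexx.
  have eS : tau' i.+1 = tau i.+1.
    have [r [hr ht]] := cl_event sol i; have [r' [hr' ht']] := cl_event sol' i.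
    apply: EFin_inj; rewrite ht ht' ei; congr Order.min; move: hr'; rewrite ei IH2 IH3 => hr'.
    exact: (trigger_time_unique (inu' _ ti) (inu _ ti) uu hr' hr).
  have [_ pl] := solution_piece sol i.
  have [_] := solution_piece sol' i; rewrite ei eS IH2 IH3 => pl'.
  have [M E] := closed_loop_unique (@nbhd_oo R (tau i) (tau i.+1))
     (fun t h => h) (fun t h => h) (ltW tlt) pl' pl uu.
  (* The right end is included: profiles are [C2_01] at every positive time, events too, so equal
     modes give equal values there. *)
  have E' t x : tau i < t <= tau i.+1 -> 0 <= x <= 1 -> u' t x = u t x.
    move=> /andP[h1 h2] hx; have t0 : 0 < t by exact: le_lt_trans h1.
    apply: (profile_eq (C2_01_wcont (cl_C2 sol' t0)) (C2_01_wcont (cl_C2 sol t0))) hx => n _.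
    by apply: M; rewrite h2 ltW.
  have H4 t : 0 <= t <= tau i.+1 -> eqL2 (u' t) (u t).
    move=> /andP[h1 h2]; have [h|h] := leP t (tau i); first by apply: IH4; rewrite h1.
    by apply: eqL2_in => x /andP[x0 x1]; apply: E'; rewrite ?h // !ltW.
  have H5 t x : 0 < t <= tau i.+1 -> 0 <= x <= 1 -> u' t x = u t x.
    move=> /andP[h1 h2]; have [h|h] := leP t (tau i); first by apply: IH5; rewrite h1.
    by apply: E'; rewrite h.
  have H6 t : 0 <= t < tau i.+1 -> U' t = U t.
    move=> /andP[h1 h2]; have [h|h] := ltP t (tau i); first by apply: IH6; rewrite h1.
    have hb : tau i <= t < tau i.+1 by rewrite h.
    have hb' : tau' i <= t < tau' i.+1 by rewrite ei eS h.
    have [-> _ _] := cl_between sol hb; have [-> _ _] := cl_between sol' hb'.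
    rewrite ei IH2 IH3; apply: control_eqL2; [exact: inu'|exact: inu|].
    by apply: H4; rewrite h1 ltW.
  have H1 l : (l <= i.+1)%N -> tau' l = tau l.
    by rewrite leq_eqVlt => /orP[/eqP->//|]; rewrite ltnS; exact: IH1.
  have [m [[[j [ji -> mj]] mlb] pr]] := cl_update sol i.
  have [m' [[[j' [ji' -> mj']] mlb'] pr']] := cl_update sol' i.
  have mm : tau' j' = tau j.
    apply: le_anti; apply/andP; split.
      by apply: mlb'; exists j; rewrite !H1 // ltnW.
    by apply: mlb; exists j'; rewrite -!H1 // ltnW.
  have sub l t : (l <= i)%N -> tau l <= t <= tau l.+1 -> 0 <= t <= tau i.+1.
    move=> li /andP[h1 h2]; have [tl _ _] := solution_events sol l.
    rewrite (le_trans tl h1) /= (le_trans h2) //.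
    move: li; rewrite -ltnS leq_eqVlt => /orP[/eqP->//|li].
    by apply/ltW/seq_lt => // n; have [] := solution_events sol n.
  have proj' : (that' (tau' i.+1), chat' (tau' i.+1)) = (that (tau i.+1), chat (tau i.+1)).
    move: pr; rewrite window_param_proj //; first last.
    - by move=> l _; have [] := solution_piece sol l.
    - exact: (cl_C0 sol).
    - by have [] := solution_events sol j.
    move=> ->; move: pr'; rewrite mm -(H1 j) ?leqW // window_param_proj //; first last.
    - by move=> l _; have [] := solution_piece sol' l.
    - exact: (cl_C0 sol').
    - by have [] := solution_events sol' j.
    have inA l t : (j <= l < i.+1)%N -> tau l <= t <= tau l.+1 -> 0 <= t <= tau i.+1.
      by move=> /andP[_ li]; exact: sub.
    have tl l : (j <= l < i.+1)%N -> tau' l = tau l /\ tau' l.+1 = tau l.+1.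
      by move=> /andP[_ li]; rewrite !H1 // leqW.
    (* By the closed form of the projection the update sees the trajectory only through two silence
       conditions, [EA] for the modes and [EB] for the control; both agree on the common window. *)
    have EA : (forall l n t, (j <= l < i.+1)%N -> (0 < n)%N -> tau' l <= t <= tau' l.+1 ->
        sin_mode n (u' t) = 0) = (forall l n t, (j <= l < i.+1)%N -> (0 < n)%N ->
        tau l <= t <= tau l.+1 -> sin_mode n (u t) = 0).
      have e l n t : (j <= l < i.+1)%N -> tau l <= t <= tau l.+1 ->
          sin_mode n (u' t) = sin_mode n (u t).
        move=> jl lt; have t0 := inA l t jl lt; case/andP: (t0) => t1 _.
        by apply: sin_mode_eqL2; [exact: inu'|exact: inu|exact: H4].
      apply/propext; split=> H l n t jl n0; have [e1 e2] := tl l jl => lt.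
        by rewrite -(e l) //; apply: (H l) => //; rewrite e1 e2.
      by rewrite e1 e2 in lt; rewrite (e l) //; exact: (H l).
    have EB : (forall l t, (j <= l < i.+1)%N -> tau' l <= t < tau' l.+1 -> U' t = 0) =
        (forall l t, (j <= l < i.+1)%N -> tau l <= t < tau l.+1 -> U t = 0).
      have e l t : (j <= l < i.+1)%N -> tau l <= t < tau l.+1 -> U' t = U t.
        move=> /andP[_ li] /andP[h1 h2]; apply: H6; have [tl0 _ _] := solution_events sol l.
        rewrite (le_trans tl0 h1) (lt_le_trans h2) //.
        move: li; rewrite leq_eqVlt => /orP[/eqP[->]//|li].
        by apply/ltW/seq_lt => // n; have [] := solution_events sol n.
      apply/propext; split=> H l t jl; have [e1 e2] := tl l jl => lt.
        by rewrite -(e l) //; apply: (H l) => //; rewrite e1 e2.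
      by rewrite e1 e2 in lt; rewrite (e l) //; exact: (H l).
    by rewrite EA EB ei IH2 IH3.
  by split=> //; split=> //; move: proj'; rewrite eS => -[].
have big t : 0 <= t -> exists i, [/\ tau i <= t, t < tau i.+1, tau' i = tau i & tau' i.+1 = tau i.+1].
  move=> /cover[i /andP[h1 h2]]; exists i; split=> //.
    by have [[H _ _] _ _ _] := key i; exact: H.
  by have [[H _ _] _ _ _] := key i.+1; exact: H.
split.
- move=> t /big[i [h1 h2 e1 e2]]; have [[_ E _] _ _ _] := key i.
  have hb : tau i <= t < tau i.+1 by rewrite h1.
  have hb' : tau' i <= t < tau' i.+1 by rewrite e1 e2.
  by have [_ -> _] := cl_between sol hb; have [_ -> _] := cl_between sol' hb'; rewrite e1.
- move=> t /big[i [h1 h2 e1 e2]]; have [[_ _ E] _ _ _] := key i.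
  have hb : tau i <= t < tau i.+1 by rewrite h1.
  have hb' : tau' i <= t < tau' i.+1 by rewrite e1 e2.
  by have [_ _ ->] := cl_between sol hb; have [_ _ ->] := cl_between sol' hb'; rewrite e1.
split=> [t t0|t x t0 hx].
  have [i [_ h2 _ _]] := big t t0; have [_ H _ _] := key i.+1.
  by apply: H; rewrite t0 ltW.
have [i [_ h2 _ _]] := big t (ltW t0); have [_ _ H _] := key i.+1.
by apply: H; [rewrite t0 ltW|move: hx; rewrite in_itv].
Qed.

End solution.
End closed_loop_solution.

(** Before [t2 <= 2 * T] no decay is available, and after it the exponential starts late; the factor
    [expR (om * (2 * T))] pays for both. The constants are at least 1, so the bounds of the earlier
    pieces can be weakened to the common one. *)
Lemma glued_decay {R : realType} (A1 A2 A3 om T t1 t2 n0 : R) (f0 f1 f2 : R -> R) :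
  1 <= A1 -> 1 <= A2 -> 1 <= A3 -> 0 < om -> 0 <= n0 -> 0 <= t1 -> t1 <= t2 -> t2 <= 2 * T ->
  (forall t, 0 <= t <= t1 -> f0 t <= A1 * n0) ->
  (forall t, t1 <= t <= t2 -> f1 t <= A2 * f0 t1) ->
  (forall t, t2 <= t -> f2 t <= A3 * expR (- om * (t - t2)) * f1 t2) ->
  forall t, 0 <= t -> (if t <= t1 then f0 t else if t <= t2 then f1 t else f2 t) <=
    A1 * A2 * A3 * expR (om * (2 * T)) * expR (- om * t) * n0.
Proof.
move=> E1 E2 E3 om0 n00 t10 t12 t2T b0 b1 b2 t t0.
have A10 := le_trans ler01 E1; have A20 := le_trans ler01 E2; have A30 := le_trans ler01 E3.
have A120 : 0 <= A1 * A2 by exact: mulr_ge0.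
have b1' s : t1 <= s <= t2 -> f1 s <= A1 * A2 * n0.
  move=> /b1 h; apply: le_trans h _; rewrite (mulrC A1) -mulrA ler_wpM2l //.
  by apply: b0; rewrite t10 lexx.
rewrite -(mulrA (A1 * A2 * A3)); set E := expR _ * expR _.
have E_ge1 : t <= t2 -> 1 <= E.
  move=> tt; rewrite /E -expRD -[leLHS]expR0 ler_expR.
  have := mulr_ge0 (ltW om0) (_ : 0 <= 2 * T - t); rewrite subr_ge0 (le_trans tt) // => /(_ isT).
  lra.
have early (x : R) : t <= t2 -> x <= A1 * A2 * n0 -> x <= A1 * A2 * A3 * E * n0.
  move=> /E_ge1 e h; apply: le_trans h _; rewrite ler_wpM2r // -mulrA ler_peMr //.
  exact: mulr_ege1.
case: (leP t t1) => [h|t1t] /=.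
  apply: early; first exact: le_trans t12.
  apply: le_trans (b0 t _) _; first by rewrite t0.
  by rewrite ler_wpM2r // ler_peMr.
case: (leP t t2) => [h|h] /=; first by apply: early => //; apply: b1'; rewrite h ltW.
apply: le_trans (b2 t (ltW h)) _.
have L : expR (- om * (t - t2)) <= E.
  rewrite /E -expRD ler_expR; have := ler_wpM2l (ltW om0) t2T; lra.
apply: (@le_trans _ _ (A3 * E * (A1 * A2 * n0))); last first.
  by rewrite le_eqVlt; apply/orP; left; apply/eqP; ring.
apply: (@le_trans _ _ (A3 * expR (- om * (t - t2)) * (A1 * A2 * n0))).
  by rewrite ler_wpM2l ?mulr_ge0 ?expR_ge0 // b1' // t12 lexx.
by rewrite ler_wpM2r ?mulr_ge0 // ler_wpM2l.
Qed.

(** * Construction of a closed-loop solution *)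

Section existence_closed_loop.
Context {R : realType}.
Implicit Types (t x r : R) (u v : R -> R -> R) (w : R -> R).
Variables (p theta c T a : R) (N : R -> nat) (kc : forall th : R, 'rV[R]_(N th)) (Rc omb : R -> R).
Hypotheses (p0 : 0 < p) (nom : nominal_feedback p kc Rc omb) (c_gt0 : 0 < c) (T0 : 0 < T) (a0 : 0 < a).
Let k := nominal_kernel kc.
Let K th := feedback k th.
Let trig := trigger_time p theta c k Rc T a.
Let Bc th ch := fun z : R -> R => c * control k th ch z.

Lemma trigger_time_eqL2 ti w w' th ch (r : \bar R) : inL2 w -> inL2 w' -> eqL2 w w' ->
  trigger_time p theta c k Rc T a ti w th ch r -> trigger_time p theta c k Rc T a ti w' th ch r.
Proof.
move=> hw hw' ww [r1 r2]; split=> h.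
  have [h0|] := pselect (eqL2 w (cst 0)); last first.
    by move=> /r1[v [bv vw ->]]; exists v; split=> //; [exact: eqL2_trans ww|rewrite (eqL2_L2norm hw hw' ww)].
  by case: h; apply: eqL2_trans h0; exact: eqL2_sym.
by apply: r2; exact: eqL2_trans h.
Qed.

Lemma nominalE : K theta = Bc theta c.
Proof. by apply/funext => z; rewrite /Bc /control mulVKf // gt_eqF. Qed.

(** [nominal_solution] bounds a solution from its own starting time. By uniqueness the one started
    at [t1] is the same trajectory, which yields the bound from every later event. *)
Lemma nominal_decay (t0 t1 : R) v t : boundary_solution p theta t0 (K theta) v ->
  t0 <= t1 -> t1 <= t ->
  L2norm (v t) <= Rc theta * expR (- omb theta * (t - t1)) * L2norm (v t1).
Proof.
rewrite nominalE => bv t01 t1t; have bv1 := bs_restart t01 bv.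
have h1 : inL2 (v t1) by exact: bs_inL2 bv t01.
have [v' [bv' vv dv]] := nominal_solution theta nom t1 h1.
have bv2 : boundary_solution p theta t1 (Bc theta c) v' by rewrite -nominalE.
have [_ E] := bs_unique bv1 bv2 (eqL2_sym vv).
rewrite (eqL2_L2norm (bs_inL2 bv1 t1t) (bs_inL2 bv2 t1t) (E t t1t)); exact: dv.
Qed.

(** Index [i] qualifies because an interval lasts at most [T <= Nt * T]; along increasing times the
    least qualifying index gives the least time. *)
Lemma window_start_exists (tau : nat -> R) (Nt i : nat) : (1 <= Nt)%N ->
  (forall l, tau l < tau l.+1) -> tau i.+1 <= tau i + T ->
  exists2 j, (j <= i)%N & is_min [set t | exists j : nat,
    [/\ (j <= i)%N, t = tau j & tau i.+1 - Nt%:R * T <= tau j]] (tau j).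
Proof.
move=> Nt1 lt tT; pose P j := tau i.+1 - Nt%:R * T <= tau j.
have Pi : P i.
  rewrite /P lerBlDr; apply: le_trans tT _; rewrite lerD2l ler_peMl ?ler1n //; exact: ltW.
have exP : exists j, P j by exists i.
case: (ex_minnP exP) => j Pj jmin; exists j; first exact: jmin.
split; first by exists j; split=> //; exact: jmin.
move=> _ [l [li -> Pl]]; have := jmin l Pl.
by rewrite leq_eqVlt => /orP[/eqP->//|/(seq_lt lt)/ltW].
Qed.

(** The update rule is asked for every start [j <= i], so that the window need not be located. The
    piece [vi i] is used on []tau i, tau i.+1]], in accordance with [glue], whereas the estimates
    change at the event itself. *)
Lemma closed_loop_intro (Nt : nat) (u0 : R -> R) (th0 c0 : R) (tau : nat -> R)
    (vi : nat -> R -> R -> R) (thi chi : nat -> R) (that chat : R -> R) u :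
  let U t := control k (that t) (chat t) (u t) in
  (1 <= Nt)%N -> tau 0%N = 0 -> (forall i, tau i < tau i.+1) ->
  (forall t, 0 <= t -> exists i, tau i <= t < tau i.+1) ->
  C0_L2 [set t | 0 <= t] u -> C1_on (non_events tau) u ->
  (forall i, boundary_solution p theta (tau i) (Bc (thi i) (chi i)) (vi i)) ->
  (forall i t, tau i < t <= tau i.+1 -> u t = vi i t) ->
  eqL2 (u 0) u0 -> thi 0%N = th0 -> chi 0%N = c0 -> (forall i, chi i != 0) ->
  (forall i t, tau i <= t < tau i.+1 -> that t = thi i /\ chat t = chi i) ->
  (forall i, exists r : \bar R, trig (tau i) (u (tau i)) (thi i) (chi i) r /\
     (tau i.+1)%:E = Order.min (tau i + T)%:E r) ->
  (forall i j, (j <= i)%N -> (thi i.+1, chi i.+1) =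
     (if `[< forall l n t, (j <= l < i.+1)%N -> (0 < n)%N -> tau l <= t <= tau l.+1 ->
                sin_mode n (u t) = 0 >] then thi i else theta,
      if `[< forall l t, (j <= l < i.+1)%N -> tau l <= t < tau l.+1 -> U t = 0 >]
      then chi i else c)) ->
  closed_loop p k Rc T a Nt theta c u0 th0 c0 tau U that chat u.
Proof.
move=> U Nt1 tau0 lt cover uC uC1 bs uv u00 th00 ch00 chi0 est tr upd.
have t0 i : 0 <= tau i by case: i => [|i]; rewrite -tau0 // ltW // seq_lt.
have est_i i : that (tau i) = thi i /\ chat (tau i) = chi i by apply: est; rewrite lexx lt.
have inside i t : tau i < t < tau i.+1 -> non_events tau t := non_events_between lt (t0 i).
have half t : 0 < t -> exists i, tau i < t <= tau i.+1.
  move=> tgt; have [i /andP[]] := cover t (ltW tgt); rewrite le_eqVlt => /orP[/eqP e _|h1 h2].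
    case: i e => [e|i <-]; first by move: tgt; rewrite -e tau0 ltxx.
    by exists i; rewrite lt lexx.
  by exists i; rewrite h1 ltW.
have C2 t : 0 < t -> C2_01 (u t).
  by move=> /half[i hi]; rewrite (uv i) //; apply: (bs_C2 (bs i)); case/andP: hi.
have bet i t : tau i <= t < tau i.+1 -> U t = control k (that (tau i)) (chat (tau i)) (u t).
  by move=> /est[h1 h2]; rewrite /U; have [-> ->] := est_i i; rewrite h1 h2.
have open i t : tau i < t < tau i.+1 -> [/\ C2_01 (u t), forall x, 0 < x < 1 -> pde_at p theta u t x,
     u t 0 = 0 & u t 1 = c * U t].
  move=> /andP[h1 h2]; have tgt : 0 < t by exact: le_lt_trans h1.
  have e : u t = vi i t by apply: uv; rewrite h1 ltW.
  split; [exact: C2|move=> x hx|by rewrite e (bs_left (bs i))|].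
    have d0 : 0 < Num.min (t - tau i) (tau i.+1 - t) by rewrite lt_min !subr_gt0 h1.
    apply: (pde_at_local d0 _ (bs_pde (bs i) h1 hx)) => s.
    rewrite lt_min !ltr_norml => /andP[/andP[s1 _] /andP[_ s2]].
    by apply: uv; apply/andP; split; lra.
  rewrite (bet i); last by rewrite h2 ltW.
  by have [-> ->] := est_i i; rewrite e (bs_right (bs i)).
have ne t : non_events tau t -> exists i, tau i < t < tau i.+1.
  move=> [tge tne]; have [i /andP[h1 h2]] := cover t tge; exists i.
  by rewrite h2 lt_neqAle eq_sym tne h1.
split=> //.
- by move=> t x /ne[i /open[_ H _ _]]; exact: H.
- by move=> t /ne[i /open[_ _ -> ->]]; rewrite subrr.
- by rewrite -tau0; have [-> _] := est_i 0%N.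
- by rewrite -tau0; have [_ ->] := est_i 0%N.
- by move=> i; have [_ ->] := est_i i.
- by move=> i t h; have [h1 h2] := est i t h; rewrite (bet i t h); have [-> ->] := est_i i.
- by move=> i; have [-> ->] := est_i i; exact: tr.
move=> i; have [-> ->] := est_i i; have [-> ->] := est_i i.+1.
have tT : tau i.+1 <= tau i + T.
  have [r [_ e]] := tr i; have : ((tau i.+1)%:E <= (tau i + T)%:E)%E by rewrite e ge_min lexx.
  by rewrite lee_fin.
have [j ji jm] := window_start_exists Nt1 lt tT.
have pc l : (j <= l < i.+1)%N -> piece p theta c (tau l) (tau l.+1) u U.
  move=> _; have [|||//] := closed_loop_piece (p := p) (theta := theta) (c := c) (kc := kc)
    (U := U) (th := that (tau l)) (ch := chat (tau l)) (t0 l) (lt l) uC.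
  - by apply: C1_on_sub uC1 => s; exact: inside.
  - by move=> s; exact: open.
  - by move=> s; exact: bet.
exists (tau j); split=> //.
apply: (iffRL (window_param_proj p0 c_gt0 _ _ ji (t0 j) uC pc)).
exact: (upd i j ji).
Qed.

Lemma arith_cover (b t : R) : b <= t -> exists i, b + i%:R * T <= t < b + i.+1%:R * T.
Proof.
move=> bt; exists (Num.truncn ((t - b) / T)).
have h : 0 <= (t - b) / T by rewrite divr_ge0 ?subr_ge0 // ltW.
by rewrite -lerBrDl -ler_pdivlMr // truncn_le h /= -ltrBlDl -ltr_pdivrMr // truncnS_gt.
Qed.

(** Along the zero profile every window is silent, so the estimates keep their initial values, and
    the trigger rule for a zero profile puts the events at the multiples of [T]. *)
Lemma closed_loop_zero (Nt : nat) (u0 : R -> R) (th0 c0 : R) : (1 <= Nt)%N -> 0 < c0 ->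
  eqL2 u0 (cst 0) -> exists (tau : nat -> R) (U that chat : R -> R) (u : R -> R -> R),
  [/\ closed_loop p k Rc T a Nt theta c u0 th0 c0 tau U that chat u,
      forall t, 0 <= t -> exists i, tau i <= t < tau i.+1,
      forall t, L2norm (u t) = 0 & forall t, U t = 0].
Proof.
move=> Nt1 c00 u00; pose tau i : R := i%:R * T.
have lt i : tau i < tau i.+1 by rewrite /tau ltr_pM2r // ltr_nat.
have cover t : 0 <= t -> exists i, tau i <= t < tau i.+1.
  by move=> /arith_cover[i]; rewrite !add0r; exists i.
have fb : control k th0 c0 (cst 0) = 0 by rewrite /control feedback_cst0 mulr0.
exists tau, (fun t => control k th0 c0 (cst 0)), (fun=> th0), (fun=> c0), (fun=> cst 0).
split=> //; last by move=> t; rewrite L2norm_cst0.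
apply: (closed_loop_intro (vi := fun _ _ => cst 0) (thi := fun=> th0) (chi := fun=> c0)) => //.
- by rewrite /tau mul0r.
- exact: C0_L2_const inL20.
- exact: (pl_C1 (plant0 p theta setT (non_events tau))).
- by move=> i; exact: bs_zero.
- exact: eqL2_sym.
- by move=> i; rewrite gt_eqF.
- move=> i; exists (tau i + T)%:E; split; last by rewrite minxx /tau -natr1 mulrDl mul1r.
  by split=> // h; case: h; exact: eqL2_refl.
move=> i j ji; case: asboolP => h1; last first.
  by case: h1 => *; exact: sin_mode_cst0.
by case: asboolP => h2 //; case: h2.
Qed.

(** By [silent_modes] every product of a gain with its mode is 0 up to [t1]; the nominal solution
    from there inherits this and [silent_feedback] preserves it. The estimate [ch] may be wrong,
    since it only scales a zero control. *)
Lemma nominal_start (t0 t1 ch : R) (v w : R -> R -> R) : t0 < t1 -> ch != 0 ->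
  boundary_solution p theta t0 (Bc theta ch) v ->
  (forall t, t0 < t < t1 -> K theta (v t) = 0) -> eqL2 (w t1) (v t1) ->
  boundary_solution p theta t1 (K theta) w -> forall t, t1 <= t -> K theta (w t) = 0.
Proof.
move=> t01 ch0 bv v0 wv bw.
have pv : plant p theta [set t | t0 <= t <= t1] [set t | t0 < t < t1] (fun=> 0) v.
  have := plant_sub _ _ (bs_plant bv).
  move=> /(_ [set t | t0 <= t <= t1] [set t | t0 < t < t1]) h.
  apply: plant_eqb (h _ _) => t /=; [by move=> ht; rewrite [feedback _ _ _]v0 // mulr0|by case/andP..].
have m0 := silent_modes p0 (@nbhd_oo R t0 t1) t01 (fun t h => h) (fun t h => h) pv v0.
have bw1 : boundary_solution p theta t1 (fun z => 1 * K theta z) w.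
  by rewrite (_ : (fun z => _) = K theta) //; apply/funext => z; rewrite mul1r.
apply: (silent_feedback bw1) => i.
rewrite (sin_mode_eqL2 _ _ _ wv); first by rewrite m0 // lexx ltW.
- by apply: (bs_C0 bw).1; rewrite /=.
- by apply: (bs_C0 bv).1; rewrite /= ltW.
Qed.

(** Three trajectories suffice for infinitely many events: from [t2] on no update changes the
    control, so one nominal solution serves all later intervals. *)
Lemma closed_loop_nonzero (Nt : nat) (u0 : R -> R) (th0 c0 : R) : (1 <= Nt)%N -> 0 < c0 ->
  inL2 u0 -> ~ eqL2 u0 (cst 0) ->
  exists (tau : nat -> R) (U that chat : R -> R) (u : R -> R -> R),
  [/\ closed_loop p k Rc T a Nt theta c u0 th0 c0 tau U that chat u,
      forall t, 0 <= t -> exists i, tau i <= t < tau i.+1,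
      forall t, 0 <= t -> L2norm (u t) <= Rc th0 * (1 + a) * (Rc theta * (1 + a)) * Rc theta *
        expR (omb theta * (2 * T)) * expR (- omb theta * t) * L2norm u0,
      forall t, tau 1%N <= t -> that t = theta &
      (exists2 t, 0 <= t & U t != 0) -> forall t, tau 2%N <= t -> chat t = c].
Proof.
move=> Nt1 c00 hu0 u0N; have c0N : c0 != 0 by rewrite gt_eqF.
have [v0 [r0 [t1 [[bs0 v00 tr0] [min0 t1_gt0 t1T bd0]]]]] :=
  trigger_exists theta p0 nom c_gt0 T0 a0 0 th0 c0N hu0.
rewrite add0r in t1T.
have v0L t : 0 <= t -> inL2 (v0 t) := bs_inL2 bs0 (t := t).
have v0t1 : inL2 (v0 t1) by apply: v0L; exact: ltW.
(* [B0], and [B1] below, say that the control is silent on the first and on the second interval;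
   they decide whether the estimate of [c] is kept. *)
pose B0 := forall t, 0 <= t < t1 -> control k th0 c0 (v0 t) = 0.
pose c1 := if `[< B0 >] then c0 else c.
have c1N : c1 != 0 by rewrite /c1; case: ifP => _; rewrite gt_eqF.
have [v1 [r1 [t2 [[bs1 v11 tr1] [min1 t12 t2T bd1]]]]] :=
  trigger_exists theta p0 nom c_gt0 T0 a0 t1 theta c1N v0t1.
have v1L t : t1 <= t -> inL2 (v1 t) := bs_inL2 bs1 (t := t).
have v1t2 : inL2 (v1 t2) by apply: v1L; exact: ltW.
pose B1 := forall t, t1 <= t < t2 -> control k theta c1 (v1 t) = 0.
pose c2 := if `[< B1 >] then c1 else c.
have c2N : c2 != 0 by rewrite /c2; case: ifP => // _; rewrite gt_eqF.
have [v2 [bs2n v22 dec2]] := nominal_solution theta nom t2 v1t2.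
have v2L t : t2 <= t -> inL2 (v2 t) by move=> h; apply: (bs_C0 bs2n).1.
(* when [c2] differs from [c], the control has vanished up to [t2], and then vanishes for ever *)
have silent : c2 != c -> [/\ B0, B1 & forall t, t2 <= t -> K theta (v2 t) = 0].
  rewrite /c2; case: asboolP => b1; last by rewrite eqxx.
  rewrite /c1; case: asboolP => b0; last by rewrite eqxx.
  move=> _; split=> //; apply: (nominal_start t12 c1N bs1 _ v22 bs2n) => t /andP[h1 h2].
  have : control k theta c1 (v1 t) = 0 by apply: b1; rewrite h2 ltW.
  by rewrite /control => /eqP; rewrite mulf_eq0 invr_eq0 (negbTE c1N) => /eqP.
(* [v2] was built without reference to [c2]. It also solves the loop with estimate [c2]: either
   [c2 = c], or its feedback vanishes and the factor in front is immaterial. *)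
have bs2 : boundary_solution p theta t2 (Bc theta c2) v2.
  have [->|/silent[_ _ K0]] := eqVneq c2 c; first by rewrite -nominalE.
  move: bs2n => /boundary_solution_plant pv; apply/boundary_solution_plant.
  apply: plant_eqb pv => t /= ht.
  by rewrite /Bc /control [feedback k _ _]K0 ?mulr0 ?mulr0 ?K0 // ltW.
pose tau i : R := match i with 0%N => 0 | 1%N => t1 | j.+2 => t2 + j%:R * T end.
pose vi i := match i with 0%N => v0 | 1%N => v1 | _ => v2 end.
pose thi i := if i is 0%N then th0 else theta.
pose chi i := match i with 0%N => c0 | 1%N => c1 | _ => c2 end.
pose that t := if t < t1 then th0 else theta.
pose chat t := if t < t1 then c0 else if t < t2 then c1 else c2.
pose u := glue t1 v0 (glue t2 v1 v2).
pose U t := control k (that t) (chat t) (u t).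
have tau2 j : t2 <= tau j.+2 by rewrite /tau lerDl mulr_ge0 // ltW.
have lt i : tau i < tau i.+1.
  case: i => [|[|i]] //=; first by rewrite mul0r addr0.
  by rewrite ltrD2l ltr_pM2r // ltr_nat.
have cover t : 0 <= t -> exists i, tau i <= t < tau i.+1.
  move=> t0; have [h|h] := ltP t t1; first by exists 0%N; rewrite /= t0.
  have [h'|h'] := ltP t t2; first by exists 1%N; rewrite /= h mul0r addr0.
  by have [i hi] := arith_cover h'; exists i.+2.
have uE i t : tau i < t <= tau i.+1 -> u t = vi i t.
  case: i => [|[|i]] /andP[] /=.
  - by move=> _ h; rewrite /u glue_le.
  - by rewrite mul0r addr0 => h1 h2; rewrite /u glue_gt // glue_le.
  - move=> h1 _; have h2 : t2 < t := le_lt_trans (tau2 i) h1.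
    by rewrite /u !glue_gt // (lt_trans t12).
have u_at2 : u t2 = v1 t2 by rewrite /u glue_gt // glue_le.
have estE i t : tau i <= t < tau i.+1 -> that t = thi i /\ chat t = chi i.
  rewrite /that /chat; case: i => [|[|i]] /andP[] /=.
  - by move=> _ ->.
  - by rewrite mul0r addr0 => h1 h2; rewrite ltNge h1 /= h2.
  - move=> h1 _; have h2 : t2 <= t := le_trans (tau2 i) h1.
    by rewrite ltNge (le_trans (ltW t12) h2) /= ltNge h2.
have U_0 t : 0 <= t < t1 -> U t = control k th0 c0 (v0 t).
  by move=> /andP[h1 h2]; rewrite /U /that /chat h2 /u glue_le // ltW.
have u_1 t : t1 <= t <= t2 -> eqL2 (u t) (v1 t).
  move=> /andP[]; rewrite le_eqVlt => /orP[/eqP<- _|h1 h2].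
    by rewrite /u glue_le //; exact: eqL2_sym.
  by rewrite /u glue_gt // glue_le //; exact: eqL2_refl.
have uC : C0_L2 [set t | 0 <= t] u.
  apply: (C0_L2_glue (J' := [set t | t1 <= t])) => //=; [exact: ltW|by case: bs0| |].
  - apply: (C0_L2_glue (J' := [set t | t2 <= t])) => //=; [exact: ltW|by case: bs1|by case: bs2|].
    exact: eqL2_sym.
  - by rewrite glue_le ?(ltW t12) //; exact: eqL2_sym.
have U_1 t : t1 <= t < t2 -> U t = control k theta c1 (v1 t).
  move=> ht; have [h1 h2] := andP ht; rewrite /U /that /chat ltNge h1 /= h2.
  apply: control_eqL2; [apply: uC.1|exact: v1L|by apply: u_1; rewrite h1 ltW].
  by apply: le_trans h1; exact: ltW.
have u_2 t : t2 <= t -> eqL2 (u t) (v2 t).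
  rewrite le_eqVlt => /orP[/eqP<-|h]; first by rewrite u_at2; exact: eqL2_sym.
  by rewrite /u !glue_gt //; [exact: eqL2_refl|exact: lt_trans h].
have silentU : c2 != c -> forall t, 0 <= t -> U t = 0.
  move=> /silent[b0 b1 b2] t t0; have [h|h] := ltP t t1; first by rewrite U_0 ?b0 // t0.
  have [h'|h'] := ltP t t2; first by rewrite U_1 ?b1 // h.
  rewrite /U /that /chat ltNge h /= ltNge h' /=; transitivity (control k theta c2 (v2 t)).
    by apply: control_eqL2; [exact: uC.1|exact: v2L|exact: u_2].
  by rewrite /control [feedback k _ _]b2 // mulr0.
have tau_ge0 i : 0 <= tau i.
  by case: i => [//|[|i]]; [exact: ltW|exact: le_trans (ltW (lt_trans t1_gt0 t12)) (tau2 i)].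
have uC1 : C1_on (non_events tau) u.
  have := C1_on_glue (t1 := t1) (J := [set t | 0 < t < t1])
    (J' := [set t | t1 < t < t2] `|` [set t | t2 < t]) (v := v0) (w := glue t2 v1 v2).
  move=> h; apply: (C1_on_sub _ (h _ _ _ _)).
  - move=> t [t0 tne]; have n0 := tne 0%N; have n1 := tne 1%N; have n2 := tne 2%N.
    rewrite /= mul0r addr0 in n0 n1 n2.
    have t_gt0 : 0 < t by rewrite lt_neqAle eq_sym n0.
    have [l1|g1|e] := ltgtP t t1; [by left; rewrite /= t_gt0|right|by rewrite e eqxx in n1].
    by have [l2|g2|e] := ltgtP t t2; [left; rewrite /= g1|right|rewrite e eqxx in n2].
  - by move=> t /andP[].
  - by move=> t [/andP[]//|/=]; exact: lt_trans.
  - by apply: C1_on_sub (bs_C1 bs0) => t /andP[].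
  apply: C1_on_glue; [by move=> t /andP[]|by []| |exact: (bs_C1 bs2)].
  by apply: C1_on_sub (bs_C1 bs1) => t /andP[].
exists tau, U, that, chat, u; split=> //.
- apply: (closed_loop_intro (vi := vi) (thi := thi) (chi := chi)) => //.
  + case=> [|[|i]] //=; rewrite ?mul0r ?addr0 //.
    by apply: bs_restart bs2; exact: tau2 i.
  + by rewrite /u glue_le // ltW.
  + by case=> [|[|i]].
  + case=> [|[|i]] /=.
    * exists r0; split; last by rewrite min0.
      apply: trigger_time_eqL2 tr0 => //; first by apply: uC.1; rewrite /=.
      by rewrite /u glue_le ?ltW //; exact: eqL2_sym.
    * by exists r1; rewrite mul0r addr0 /u glue_le.
    have w2 : inL2 (u (tau i.+2)) by apply: uC.1; exact: le_trans (ltW t1_gt0) (le_trans (ltW t12) (tau2 i)).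
    have e2 := u_2 _ (tau2 i).
    have bs2' := bs_restart (tau2 i) bs2.
    have [] := trigger_time_decay T nom a0 w2 bs2' (eqL2_sym e2).
      move=> t ht; rewrite (eqL2_L2norm w2 (v2L _ (tau2 i)) e2).
      exact: nominal_decay bs2n (tau2 i) ht.
    move=> r [tr e]; exists r; split=> //; rewrite -e /tau; congr EFin.
    by rewrite -natr1 mulrDl mul1r addrA.
  + move=> i j; case: i => [|i] ji.
      (* The first interval cannot be silent: vanishing modes make the norm 0 at positive times,
         hence at 0 by continuity, against [u0N]. *)
      move: ji; rewrite leqn0 => /eqP->; rewrite /thi /chi; case: asboolP => [h|_].
        case: u0N; apply: (eqL2_trans (eqL2_sym v00)); apply/(eqL20_L2norm (v0L _ (lexx 0))).
        have cn : {within `[0, t1], continuous (fun t => L2norm (v0 t))}.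
          by apply: (wcont_sub_seg _ (C0_L2_L2norm (bs_C0 bs0))) => t /andP[].
        apply: (wcont_oo_eq0 t1_gt0 cn); last by rewrite lexx ltW.
        move=> t ht; have [h1 h2] := andP ht.
        apply/(eqL20_L2norm (v0L _ (ltW h1))); apply: eqL2_in => x /andP[x0 x1].
        apply: (profile_eq (C2_01_wcont (bs_C2 bs0 h1)) (wcont_cst (c := 0))); last by rewrite !ltW.
        move=> n n_gt0; rewrite sin_mode_cst0 -[RHS](h 0%N n t) //; last by rewrite !ltW.
        by rewrite /u glue_le // ltW.
      congr pair; rewrite /c1; case: asboolP => b; case: asboolP => h //.
        case: h => l t; rewrite ltnS leqn0 => /eqP-> ht.
        exact: (etrans (U_0 t ht) (b t ht)).
      by case: b => t ht; exact: (etrans (esym (U_0 t ht)) (h 0%N t isT ht)).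
    rewrite /thi (_ : (if _ then _ else _) = theta); last by case: asboolP.
    (* A window with nonzero control forces [c2 = c], since otherwise [silentU] applies. For the
       update at [t2] a silent window contains the second interval, so [B1] holds and [c2 = c1]. *)
    congr pair; case: i ji => [|i] ji /=; last first.
      case: asboolP => h //; apply/eqP/contraT => c2c; case: h => l t _ /andP[ht _].
      by apply: silentU => //; apply: le_trans ht; exact: tau_ge0.
    case: asboolP => h.
      rewrite /c2; case: asboolP => // b; case: b => t ht.
      apply: (etrans (esym (U_1 t ht)) (h 1%N t _ _)); first by rewrite ji.
      by rewrite /tau mul0r addr0.
    apply/eqP/contraT => c2c; case: h => l t _ /andP[ht _].
    by apply: silentU => //; apply: le_trans ht; exact: tau_ge0.
- move=> t t0; have E th : 1 <= Rc th * (1 + a).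
    by apply: mulr_ege1; rewrite ?(Rc_ge1 nom) // lerDl ltW.
  have om0 : 0 < omb theta by have [] := nom theta.
  have t22 : t2 <= 2 * T by lra.
  have := glued_decay (E th0) (E theta) (Rc_ge1 nom theta) om0 (L2norm_ge0 u0) (ltW t1_gt0)
    (ltW t12) t22 bd0 bd1 dec2 t0.
  by rewrite /u /glue; case: ifP => // _; case: ifP.
- by move=> t /= h; rewrite /that ltNge h.
move=> [t t0 Ut] s; rewrite /= mul0r addr0 => hs.
rewrite /chat ltNge (le_trans (ltW t12) hs) /= ltNge hs /=; apply/eqP/contraT => c2c.
by rewrite silentU ?eqxx in Ut.
Qed.

End existence_closed_loop.

Theorem theorem2p2 (R : realType) (p : R)
    (N : R -> nat) (kc : forall th : R, 'rV[R]_(N th)) (Rc omb : R -> R)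
    (T a : R) (Nt : nat) :
  0 < p -> nominal_feedback p kc Rc omb ->
  0 < T -> 0 < a -> (1 <= Nt)%N ->
  exists (M : R -> R -> R -> R -> R) (omega : R -> R),
  [/\ forall theta th0 c c0, 0 < c -> 0 < c0 -> 0 < M theta th0 c c0,
      forall theta, 0 < omega theta &
  forall (theta c : R) (u0 : R -> R) (th0 c0 : R),
  0 < c -> inL2 u0 -> 0 < c0 ->
  let solution := closed_loop p (nominal_kernel kc) Rc T a Nt theta c u0 th0 c0 in
  exists (tau : nat -> R) (U that chat : R -> R) (u : R -> R -> R),
  [/\ solution tau U that chat u,
      (forall tau' U' that' chat' u', solution tau' U' that' chat' u' ->
        [/\ forall t, 0 <= t -> that' t = that t,
            forall t, 0 <= t -> chat' t = chat t &
            same_trajectory u' u]),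
      (forall t, 0 <= t ->
        L2norm (u t) <= M theta th0 c c0 * expR (- omega theta * t) * L2norm u0),
      (~ eqL2 u0 (cst 0) -> forall t, tau 1%N <= t -> that t = theta) &
      ((exists2 t, 0 <= t & U t != 0) -> forall t, tau 2%N <= t -> chat t = c)]].
Proof.
move=> p0 nom T0 a0 Nt1.
(* One factor per piece: the trigger thresholds at [th0] and [theta] for the first two intervals,
   the nominal bound afterwards, and an exponential for the time before tau_2, which is at most
   [2 * T]. The rate is the nominal one. *)
pose M theta th0 (c c0 : R) := Rc th0 * (1 + a) * (Rc theta * (1 + a)) * Rc theta *
  expR (omb theta * (2 * T)).
exists M, omb; split.
- move=> theta th0 c c0 _ _.
  have Rc0 th : 0 < Rc th by have [] := nom th.
  have a1 : 0 < 1 + a by rewrite addr_gt0.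
  by rewrite /M !mulr_gt0 // expR_gt0.
- by move=> theta; have [] := nom theta.
move=> theta c u0 th0 c0 c_gt0 hu0 c00 solution.
have [u00|u0N] := pselect (eqL2 u0 (cst 0)).
  have [tau [U [that [chat [u [sol cover un U0]]]]]] :=
    closed_loop_zero theta a kc Rc p0 c_gt0 T0 th0 Nt1 c00 u00.
  exists tau, U, that, chat, u; split=> //.
  - by move=> tau' U' that' chat' u' sol'; exact: (solution_unique p0 nom c_gt0 T0 a0 sol sol' cover).
  - move=> t t0; rewrite un /M.
    have Rc0 th : 0 <= Rc th by have [_ /ltW] := nom th.
    have a1 : 0 <= 1 + a by rewrite addr_ge0 ?ltW.
    by rewrite !mulr_ge0 ?expR_ge0 ?L2norm_ge0.
  - by move=> [t _]; rewrite U0 eqxx.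
have [tau [U [that [chat [u [sol cover bd h1 h2]]]]]] :=
  closed_loop_nonzero theta p0 nom c_gt0 T0 a0 th0 Nt1 c00 hu0 u0N.
exists tau, U, that, chat, u; split=> //.
by move=> tau' U' that' chat' u' sol'; exact: (solution_unique p0 nom c_gt0 T0 a0 sol sol' cover).
Qed.
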